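(* Let $\rho$ be a finite, compactly supported, non-negative Borel measure on $\mathbf{R}$, let $\mathcal{H}=L_2(\mathbf{R},\rho)$, let $A$ be the multiplication operator $(Af)(\mu)=\mu f(\mu)$ on $\mathcal{H}$, and let $B=(\cdot,g)g$, where $g(\mu)=1$ for $\rho$-almost every $\mu$. Then the following assertions are equivalent: (i) the pair $A,B$ has the HUE property; (ii) the pair $A,B$ has the FH property; (iii) the pair $A,B$ has the CLI property; (iv) the measure $\rho$ has the BTB property.
   Context: Inner products are linear in the first argument, so $(\cdot,g)g$ is the operator $f\mapsto (f,g)g$. For $\gamma\in\mathbf{C}$ put $A_\gamma=A+\gamma B$, and for $\delta>0$ put $D_\delta=\{\gamma\in\mathbf{C}: |\gamma|<\delta\}$. $\sigma(\cdot)$ denotes the spectrum. Holomorphy of a function with values in the bounded operators on $\mathcal{H}$ is understood in the operator norm topology (equivalently, the weak operator topology). HUE (Holomorphic Unitary Equivalence): there exist $\delta>0$ and a family of unitary operators $\{U_\gamma\}_{\gamma\in(-\delta,\delta)}$ on $\mathcal{H}$ such that $A_\gamma=(U_\gamma)^{-1}AU_\gamma$ for all $\gamma\in(-\delta,\delta)$, and the operator function $\gamma\mapsto U_\gamma$ admits a holomorphic continuation from $(-\delta,\delta)$ to $D_\delta$. FH (Functional Holomorphy): there exists $\delta>0$ such that for every continuous function $\phi:\mathbf{R}\to\mathbf{C}$ the operator function $\gamma\mapsto\phi(A_\gamma)$, $\gamma\in(-\delta,\delta)$ (continuous functional calculus of a self-adjoint operator), admits a holomorphic continuation to $D_\delta$.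 CLI (Complex Local Isospectrality): there exists $\delta>0$ such that $\sigma(A_\gamma)=\sigma(A)$ for all $\gamma\in D_\delta$. BTB (Borel Transform Boundedness): the Borel transform $\mathrm{B}\rho(\lambda)=\int_{\mathbf{R}}\frac{\rho(dt)}{t-\lambda}$ is bounded on the open upper half-plane (equivalently, it belongs to the Hardy class $H_\infty$ there; it is then also bounded on the lower half-plane). *)

(* Defs.v *)
From HB Require Import structures.
From mathcomp Require Import all_boot all_order all_algebra.
From mathcomp Require Import all_classical all_reals all_analysis.
From mathcomp Require Import measurable_realfun complex ring lra.

Set Implicit Arguments.
Unset Strict Implicit.
Unset Printing Implicit Defensive.

Import Order.TTheory GRing.Theory Num.Theory.
Import numFieldNormedType.Exports.

Local Open Scope classical_set_scope.
Local Open Scope ring_scope.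
Local Open Scope complex_scope.

Local Notation Re := complex.Re.
Local Notation Im := complex.Im.

Section complex_integral.
Context d (T : measurableType d) (R : realType).
Variable mu : {measure set T -> \bar R}.
Implicit Types (f g : T -> R[i]) (c : R[i]).

(* R[i] carries no measurable structure in the library: measurability and
   integrals of complex-valued functions are taken componentwise. *)
Definition cmeasurable f :=
  measurable_fun setT (fun x => Re (f x)) /\
  measurable_fun setT (fun x => Im (f x)).

Definition cintegrable f :=
  mu.-integrable setT (fun x => (Re (f x))%:E) /\
  mu.-integrable setT (fun x => (Im (f x))%:E).

Definition cintegral f : R[i] :=
  (\int[mu]_x Re (f x)) +i* (\int[mu]_x Im (f x)).

Lemma cintegralD f g : cintegrable f -> cintegrable g ->
  cintegral (fun x => f x + g x) = cintegral f + cintegral g.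
Proof.
move=> [f1 f2] [g1 g2]; rewrite /cintegral.
under eq_Rintegral do rewrite raddfD /=.
rewrite RintegralD//; under [X in _ +i* X]eq_Rintegral do rewrite raddfD /=.
by rewrite RintegralD.
Qed.

Lemma cintegrableZ c f : cintegrable f -> cintegrable (fun x => c * f x).
Proof.
case: c => a b [f1 f2]; split.
  apply: (eq_integrable _ (fun x => (a%:E * (Re (f x))%:E - b%:E * (Im (f x))%:E)%E)) => //.
    by move=> x _; case: (f x) => u v /=; rewrite -!EFinM -EFinB.
  by apply: integrableB => //; exact: integrableZl.
apply: (eq_integrable _ (fun x => (a%:E * (Im (f x))%:E + b%:E * (Re (f x))%:E)%E)) => //.
  by move=> x _; case: (f x) => u v /=; rewrite -!EFinM -EFinD.
by apply: integrableD => //; exact: integrableZl.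
Qed.

Lemma cintegralZ c f : cintegrable f ->
  cintegral (fun x => c * f x) = c * cintegral f.
Proof.
case: c => a b [f1 f2]; rewrite /cintegral.
have h k u : mu.-integrable setT (fun x => (u x)%:E) ->
  mu.-integrable setT (EFin \o (fun x => k * u x)).
  move=> iu; apply: (eq_integrable _ (fun x => (k%:E * (u x)%:E)%E)) => //.
  exact: integrableZl.
have -> : \int[mu]_x Re ((a +i* b) * f x) =
    a * \int[mu]_x Re (f x) - b * \int[mu]_x Im (f x).
  rewrite -!RintegralZl// -RintegralB//; [|exact: h|exact: h].
  by apply: eq_Rintegral => x _; case: (f x).
have -> : \int[mu]_x Im ((a +i* b) * f x) =
    a * \int[mu]_x Im (f x) + b * \int[mu]_x Re (f x).
  rewrite -!RintegralZl// -RintegralD//; [|exact: h|exact: h].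
  by apply: eq_Rintegral => x _; case: (f x).
by [].
Qed.

Lemma cintegral_conj f : cintegrable f ->
  cintegral (fun x => (f x)^*%R) = (cintegral f)^*%R.
Proof.
move=> [f1 f2]; rewrite /cintegral /=; congr (_ +i* _).
  by apply: eq_Rintegral => x _; case: (f x).
have -> : \int[mu]_x Im (f x)^*%R = \int[mu]_x (-1 * Im (f x)).
  by apply: eq_Rintegral => x _; case: (f x) => u v /=; rewrite mulN1r.
by rewrite RintegralZl// mulN1r.
Qed.

Lemma ae_eq_cintegral f g : cmeasurable f -> cmeasurable g ->
  (\forall x \ae mu, f x = g x) -> cintegral f = cintegral g.
Proof.
move=> [f1 f2] [g1 g2] fg; rewrite /cintegral /Rintegral.
congr (fine _ +i* fine _); apply: ae_eq_integral => //.
- exact/measurable_EFinP.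
- exact/measurable_EFinP.
- by apply: filterS fg => x /= -> _.
- exact/measurable_EFinP.
- exact/measurable_EFinP.
- by apply: filterS fg => x /= -> _.
Qed.

Definition sqintegrable f :=
  cmeasurable f /\ (\int[mu]_x (Normc.normc (f x) ^+ 2)%:E < +oo)%E.

Lemma sqintegrableP f : sqintegrable f <->
  ((fun x => Re (f x)) \in Lfun mu 2%:E) /\ ((fun x => Im (f x)) \in Lfun mu 2%:E).
Proof.
have nE x : Normc.normc (f x) ^+ 2 = Re (f x) ^+ 2 + Im (f x) ^+ 2.
  by case: (f x) => a b /=; rewrite sqr_sqrtr// addr_ge0 ?sqr_ge0.
split=> [[[m1 m2] fi]|[f1 f2]].
  have h (u : T -> R) : measurable_fun setT u ->
      (forall x, u x ^+ 2 <= Normc.normc (f x) ^+ 2) -> u \in Lfun mu 2%:E.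
    move=> mu_ uf; rewrite inE; apply/andP; split; rewrite inE//=.
    rewrite /finite_norm unlock; apply: poweR_lty; apply: le_lt_trans fi.
    apply: ge0_le_integral => //.
    - by move=> x _; exact: poweR_ge0.
    - apply/measurable_EFinP.
      apply/(@measurableT_comp _ _ _ _ _ _ (fun x : R => x `^ 2)%R) => //.
      exact/measurableT_comp.
    - under eq_fun do rewrite nE.
      by apply/measurable_EFinP/measurable_funD; exact: measurable_funX.
    - by move=> x _; rewrite /= lee_fin powR_mulrn// real_normK ?num_real.
  split; apply: h => // x; rewrite nE ?lerDl ?lerDr sqr_ge0//.
move: (f1) (f2); rewrite !inE => /andP[/[!inE]/= m1 _] /andP[/[!inE]/= m2 _].
split=> //.
have i1 := Lfun2_integrable_sqr f1; have i2 := Lfun2_integrable_sqr f2.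
have := integrableD measurableT i1 i2.
move=> /integrableP[_]; apply: le_lt_trans.
apply: ge0_le_integral => //.
- by move=> x _; rewrite lee_fin sqr_ge0.
- under eq_fun do rewrite nE.
  by apply/measurable_EFinP/measurable_funD; exact: measurable_funX.
- apply: measurableT_comp => //; apply: emeasurable_funD.
    by case/integrableP: i1.
  by case/integrableP: i2.
- by move=> x _ /=; rewrite nE lee_fin; exact: ler_norm.
Qed.

Lemma sqintegrable_mulC f g : sqintegrable f -> sqintegrable g ->
  cintegrable (fun x => f x * (g x)^*).
Proof.
move=> /sqintegrableP[f1 f2] /sqintegrableP[g1 g2].
have h (u v : T -> R) : u \in Lfun mu 2%:E -> v \in Lfun mu 2%:E ->
    mu.-integrable setT (fun x => (u x * v x)%:E).
  by move=> uL vL; exact/Lfun1_integrable/Lfun2_mul_Lfun1.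
split.
  apply: (eq_integrable _ (fun x =>
    ((Re (f x) * Re (g x))%:E + (Im (f x) * Im (g x))%:E)%E)) => //.
    by move=> x _; case: (f x) (g x) => [a b] [a' b'] /=; rewrite mulrN opprK.
  by apply: integrableD => //; exact: h.
apply: (eq_integrable _ (fun x =>
  ((Im (f x) * Re (g x))%:E - (Re (f x) * Im (g x))%:E)%E)) => //.
  by move=> x _; case: (f x) (g x) => [a b] [a' b'] /=; rewrite mulrN addrC.
by apply: integrableB => //; exact: h.
Qed.

Definition L2pred : {pred T -> R[i]} := mem [set f | sqintegrable f].

Lemma L2predP f : reflect (sqintegrable f) (f \in L2pred).
Proof. by apply: (iffP idP); rewrite inE. Qed.

Lemma L2pred_submod_closed : submod_closed L2pred.
Proof.
have le12 : (1 <= 2%:E :> \bar R)%E by rewrite lee_fin ler1n.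
have [L0 LZ] := Lfun_submod_closed mu le12.
split; first by apply/L2predP/sqintegrableP; split.
move=> c f g /L2predP/sqintegrableP[f1 f2] /L2predP/sqintegrableP[g1 g2].
apply/L2predP/sqintegrableP.
have h (a b : R) (u v w : T -> R) : u \in Lfun mu 2%:E ->
    v \in Lfun mu 2%:E -> w \in Lfun mu 2%:E ->
    (fun x => a * u x + b * v x + w x) \in Lfun mu 2%:E.
  move=> uL vL wL; have := LZ a u _ uL (LZ b v w vL wL); rewrite addrA; exact.
case: c => a b; split.
  rewrite [X in X \in _](_ : _ = fun x =>
    a * Re (f x) + (- b) * Im (f x) + Re (g x)); first exact: h.
  apply/funext => x; rewrite !fctE; case: (f x) (g x) => [? ?] [? ?] /=.
  by rewrite mulNr.
rewrite [X in X \in _](_ : _ = fun x =>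
  a * Im (f x) + b * Re (f x) + Im (g x)); first exact: h.
by apply/funext => x; rewrite !fctE; case: (f x) (g x) => [? ?] [? ?].
Qed.

End complex_integral.

Section L2_space.
Context d (T : measurableType d) (R : realType).
Variable mu : {measure set T -> \bar R}.

HB.instance Definition _ := GRing.isSubmodClosed.Build R[i] (T -> R[i])
  (L2pred mu) (L2pred_submod_closed mu).

Record L2fun := L2Fun {
  L2fun_val :> T -> R[i];
  L2fun_subproof : L2fun_val \in L2pred mu }.

HB.instance Definition _ := [isSub for L2fun_val].
HB.instance Definition _ := [Choice of L2fun by <:].
HB.instance Definition _ := [SubChoice_isSubLmodule of L2fun by <:].

Lemma L2funP (f : L2fun) : sqintegrable mu f.
Proof. exact/L2predP/L2fun_subproof. Qed.

Definition L2eq (f g : L2fun) := `[< \forall x \ae mu, f x = g x >].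

Let L2eq_refl : reflexive L2eq.
Proof. by move=> f; apply/asboolP; apply: aeW. Qed.

Let L2eq_sym : symmetric L2eq.
Proof.
move=> f g; apply/idP/idP => /asboolP h; apply/asboolP;
  by apply: filterS h => x ->.
Qed.

Let L2eq_trans : transitive L2eq.
Proof.
move=> f g h /asboolP gf /asboolP fh; apply/asboolP.
by apply: filterS2 gf fh => x -> ->.
Qed.

Canonical L2eq_canonical := EquivRel L2eq L2eq_refl L2eq_sym L2eq_trans.

Local Open Scope quotient_scope.

Definition L2 : Type := {eq_quot L2eq}.
HB.instance Definition _ := Choice.on L2.
HB.instance Definition _ := EqQuotient.on L2.

Definition L2repr (f : L2) : L2fun := repr f.
Coercion L2repr : L2 >-> L2fun.

Lemma L2_eqP (f g : L2) : f = g <-> \forall x \ae mu, f x = g x.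
Proof.
split=> [->|h]; first exact: aeW.
by rewrite -[f]reprK -[g]reprK; apply/eqmodP/asboolP.
Qed.

Lemma pi_L2E (f : L2fun) : \forall x \ae mu, (\pi_L2 f : L2) x = f x.
Proof.
by have /eqmodP/asboolP : L2repr (\pi_L2 f) = f %[mod L2] by exact: reprK.
Qed.

Definition L2_add (f g : L2) : L2 := \pi_L2 ((f : L2fun) + g).
Definition L2_opp (f : L2) : L2 := \pi_L2 (- (f : L2fun)).
Definition L2_scale (c : R[i]) (f : L2) : L2 := \pi_L2 (c *: (f : L2fun)).
Definition L2_zero : L2 := \pi_L2 (0 : L2fun).

Lemma L2_addE f g : \forall x \ae mu, L2_add f g x = f x + g x.
Proof. exact: pi_L2E. Qed.
Lemma L2_oppE f : \forall x \ae mu, L2_opp f x = - f x.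
Proof. exact: pi_L2E. Qed.
Lemma L2_scaleE c f : \forall x \ae mu, L2_scale c f x = c * f x.
Proof. exact: pi_L2E. Qed.
Lemma L2_zeroE : \forall x \ae mu, L2_zero x = 0.
Proof. exact: pi_L2E. Qed.

Let L2_addA : associative L2_add.
Proof.
move=> f g h; apply/L2_eqP.
near=> x.
rewrite (near (L2_addE f (L2_add g h)) x)// (near (L2_addE g h) x)//.
by rewrite (near (L2_addE (L2_add f g) h) x)// (near (L2_addE f g) x)// addrA.
Unshelve. all: by end_near. Qed.

Let L2_addC : commutative L2_add.
Proof.
move=> f g; apply/L2_eqP; near=> x.
by rewrite (near (L2_addE f g) x)// (near (L2_addE g f) x)// addrC.
Unshelve. all: by end_near. Qed.

Let L2_add0 : left_id L2_zero L2_add.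
Proof.
move=> f; apply/L2_eqP; near=> x.
by rewrite (near (L2_addE L2_zero f) x)// (near L2_zeroE x)// add0r.
Unshelve. all: by end_near. Qed.

Let L2_addN : left_inverse L2_zero L2_opp L2_add.
Proof.
move=> f; apply/L2_eqP; near=> x.
rewrite (near (L2_addE (L2_opp f) f) x)// (near L2_zeroE x)//.
by rewrite (near (L2_oppE f) x)// addNr.
Unshelve. all: by end_near. Qed.

HB.instance Definition _ :=
  GRing.isZmodule.Build L2 L2_addA L2_addC L2_add0 L2_addN.

Let L2_scaleA a b f : L2_scale a (L2_scale b f) = L2_scale (a * b) f.
Proof.
apply/L2_eqP; near=> x.
rewrite (near (L2_scaleE a (L2_scale b f)) x)// (near (L2_scaleE b f) x)//.
by rewrite (near (L2_scaleE (a * b) f) x)// mulrA.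
Unshelve. all: by end_near. Qed.

Let L2_scale1 : left_id 1 L2_scale.
Proof.
move=> f; apply/L2_eqP; near=> x.
by rewrite (near (L2_scaleE 1 f) x)// mul1r.
Unshelve. all: by end_near. Qed.

Let L2_scaleDr : right_distributive L2_scale +%R.
Proof.
move=> a f g; apply/L2_eqP; near=> x.
rewrite (near (L2_scaleE a (f + g)) x)// (near (L2_addE f g) x)//.
rewrite (near (L2_addE (L2_scale a f) (L2_scale a g)) x)//.
by rewrite (near (L2_scaleE a f) x)// (near (L2_scaleE a g) x)// mulrDr.
Unshelve. all: by end_near. Qed.

Let L2_scaleDl f : {morph L2_scale^~ f : a b / a + b >-> a + b}.
Proof.
move=> a b; apply/L2_eqP; near=> x.
rewrite (near (L2_scaleE (a + b) f) x)//.
rewrite (near (L2_addE (L2_scale a f) (L2_scale b f)) x)//.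
by rewrite (near (L2_scaleE a f) x)// (near (L2_scaleE b f) x)// mulrDl.
Unshelve. all: by end_near. Qed.

HB.instance Definition _ := GRing.Zmodule_isLmodule.Build R[i] L2
  L2_scaleA L2_scale1 L2_scaleDr L2_scaleDl.

(* Class of a square-integrable u; the class of 0 when u is not one. *)
Definition L2class (u : T -> R[i]) : L2 := \pi_L2 (insubd (0 : L2fun) u).

Lemma L2classE u : sqintegrable mu u -> \forall x \ae mu, L2class u x = u x.
Proof.
move=> /L2predP uL; apply: filterS (pi_L2E (insubd (0 : L2fun) u)) => x.
by rewrite /L2class => ->; have := insubdK (0 : L2fun) uL => /= ->.
Qed.

End L2_space.

Section L2_inner_product.
Context d (T : measurableType d) (R : realType).
Variable mu : {measure set T -> \bar R}.
Implicit Types (f g h : L2 mu) (c : R[i]).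

Definition L2dot f g : R[i] := cintegral mu (fun x => f x * (g x)^*).

Lemma cmeasurable_mulC f g : cmeasurable (fun x => f x * (g x)^*).
Proof.
have [/measurable_int/measurable_EFinP m1 /measurable_int/measurable_EFinP m2] :=
  sqintegrable_mulC (L2funP f) (L2funP g).
by split.
Qed.

Lemma L2dot_conj f g : L2dot f g = (L2dot g f)^*%R.
Proof.
rewrite /L2dot -cintegral_conj; last exact: sqintegrable_mulC (L2funP _) (L2funP _).
congr cintegral; apply/funext => x.
by case: (f x) (g x) => [a b] [a' b'] /=; congr (_ +i* _); ring.
Qed.

Lemma L2dotDl f g h : L2dot (f + g) h = L2dot f h + L2dot g h.
Proof.
rewrite /L2dot -cintegralD; try exact: sqintegrable_mulC (L2funP _) (L2funP _).
apply: ae_eq_cintegral; first exact: cmeasurable_mulC.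
  have [[a b] [a' b']] := (cmeasurable_mulC f h, cmeasurable_mulC g h).
  by split; under eq_fun do rewrite raddfD; exact: measurable_funD.
by apply: filterS (L2_addE f g) => x; rewrite -mulrDl => <-.
Qed.

Lemma L2dotZl c f g : L2dot (c *: f) g = c * L2dot f g.
Proof.
have ifg := sqintegrable_mulC (L2funP f) (L2funP g).
rewrite /L2dot -cintegralZ//.
apply: ae_eq_cintegral; first exact: cmeasurable_mulC.
  have [/measurable_int/measurable_EFinP m1 /measurable_int/measurable_EFinP m2] :=
    cintegrableZ c ifg.
  by split.
by apply: filterS (L2_scaleE c f) => x; rewrite mulrA => <-.
Qed.

Lemma L2dotDr f g h : L2dot h (f + g) = L2dot h f + L2dot h g.
Proof. by rewrite L2dot_conj L2dotDl rmorphD /= -!L2dot_conj. Qed.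

Lemma L2dotZr c f g : L2dot f (c *: g) = c^* * L2dot f g.
Proof. by rewrite L2dot_conj L2dotZl rmorphM /= -L2dot_conj. Qed.

Lemma L2dot0l f : L2dot 0 f = 0.
Proof. by rewrite -(scale0r (0 : L2 mu)) L2dotZl mul0r. Qed.

Lemma L2dotff f :
  L2dot f f = (fine (\int[mu]_x (Normc.normc (f x) ^+ 2)%:E))%:C.
Proof.
rewrite /L2dot /cintegral; congr (_ +i* _).
  apply: eq_Rintegral => x _; case: (f x) => a b /=.
  by rewrite sqr_sqrtr ?addr_ge0 ?sqr_ge0//; ring.
rewrite /Rintegral (_ : (fun x => _) = cst 0%E) ?integral_cst// ?mul0e//.
apply/funext => x; case: (f x) => a b /=; congr (_%:E); ring.
Qed.

Lemma L2dot_ge0 f : 0 <= L2dot f f.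
Proof.
by rewrite L2dotff ler0c fine_ge0// integral_ge0// => x _; rewrite lee_fin sqr_ge0.
Qed.

Lemma L2dot_eq0 f : L2dot f f = 0 -> f = 0.
Proof.
rewrite L2dotff => -[/eqP]; rewrite -eqe fineK; last first.
  rewrite ge0_fin_numE; first by case: (L2funP f).
  by apply: integral_ge0 => x _; rewrite lee_fin sqr_ge0.
have mf : measurable_fun setT (fun x => (Normc.normc (f x) ^+ 2)%:E).
  have [/measurable_EFinP m1 _] := cmeasurable_mulC f f.
  apply: eq_measurable_fun m1 => x _ /=; case: (f x) => a b /=.
  by rewrite sqr_sqrtr ?addr_ge0 ?sqr_ge0//; congr (_%:E); ring.
move=> /eqP i0.
have /ae_eq_integral_abs : (\int[mu]_x `|(Normc.normc (f x) ^+ 2)%:E| = 0)%E.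
  rewrite -[RHS]i0; apply: eq_integral => x _.
  by rewrite gee0_abs// lee_fin sqr_ge0.
move=> /(_ measurableT mf) h; apply/L2_eqP.
apply: filterS2 h (L2_zeroE mu) => x /(_ I) [/eqP].
by rewrite sqrf_eq0 => /eqP/Normc.eq0_normc -> ->.
Qed.

Lemma L2_CauchySchwarz f g :
  `|L2dot f g| ^+ 2 <= L2dot f f * L2dot g g.
Proof.
have [g0|g0] := eqVneq (L2dot g g) 0.
  by rewrite (L2dot_eq0 g0) L2dot_conj !L2dot0l conjC0 normr0 expr0n mulr0.
have gp : 0 < L2dot g g by rewrite lt_neqAle eq_sym g0 L2dot_ge0.
have gJ : (L2dot g g)^*%R = L2dot g g by rewrite -L2dot_conj.
set c := L2dot f g / L2dot g g.
have := L2dot_ge0 (f - c *: g).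
have -> : f - c *: g = f + (- c) *: g by rewrite scaleNr.
rewrite L2dotDl !L2dotDr !L2dotZl !L2dotZr.
have cJ : (- c)^*%R = - (L2dot g f / L2dot g g).
  by rewrite rmorphN rmorphM fmorphV /= -L2dot_conj gJ.
rewrite cJ [X in _ + X](_ : _ = 0); last first.
  by rewrite -[X in _ * X + _]mul1r -[1](divff g0) /c; field.
rewrite addr0 mulNr subr_ge0 mulrAC ler_pdivrMr//; apply: le_trans.
by rewrite normCK -L2dot_conj mulrC.
Qed.

End L2_inner_product.

Section L2_norm.
Context d (T : measurableType d) (R : realType).
Variable mu : {measure set T -> \bar R}.
Implicit Types (f g h : L2 mu) (c : R[i]).

Let L2dot_linear :
  bilinear_for ( *%R ) (Num.conj \; *%R) (@L2dot _ _ _ mu).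
Proof.
by split=> [g a u v|g a u v] /=;
  rewrite (L2dotDl, L2dotDr) (L2dotZl, L2dotZr).
Qed.

HB.instance Definition _ :=
  bilinear_isBilinear.Build R[i] (L2 mu) (L2 mu) R[i] ( *%R )
    (Num.conj \; *%R) (@L2dot _ _ _ mu) L2dot_linear.

Let L2dot_hermitian f g : L2dot f g = (-1) ^+ false * Num.conj (L2dot g f).
Proof. by rewrite expr0 mul1r -L2dot_conj. Qed.

HB.instance Definition _ := isHermitianSesquilinear.Build R[i] (L2 mu)
  false Num.conj (@L2dot _ _ _ mu) L2dot_hermitian.

Let L2dot_gt0 f : f != 0 -> 0 < L2dot f f.
Proof.
move=> f0; rewrite lt_neqAle L2dot_ge0 andbT eq_sym.
by apply: contra f0 => /eqP/L2dot_eq0 ->.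
Qed.

HB.instance Definition _ :=
  isDotProduct.Build R[i] (L2 mu) (@L2dot _ _ _ mu) L2dot_gt0.

Definition L2norm f : R[i] := sqrtC (L2dot f f).

Let L2norm_ge0 f : 0 <= L2norm f.
Proof. by rewrite sqrtC_ge0 L2dot_ge0. Qed.

Let L2normD f g : L2norm (f + g) <= L2norm f + L2norm g.
Proof.
rewrite -ler_sqr ?nnegrE ?addr_ge0// sqrrD !sqrtCK L2dotDl !L2dotDr.
rewrite [leLHS](_ : _ = L2dot f f + L2dot g g + 2 * 'Re (L2dot f g)); last first.
  by rewrite ReE -[(L2dot f g)^*%R]L2dot_conj; field.
rewrite [leRHS]addrAC lerD2l.
rewrite -[leRHS]mulr_natl ler_pM2l ?ltr0n//.
apply: le_trans (leif_Re_Creal _) _.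
rewrite -ler_sqr ?nnegrE ?mulr_ge0// exprMn !sqrtCK.
exact: L2_CauchySchwarz.
Qed.

Let L2normZ c f : L2norm (c *: f) = `|c| * L2norm f.
Proof.
rewrite /L2norm L2dotZl L2dotZr mulrA -normCK rootCMl ?sqr_ge0 ?normr_ge0//.
by rewrite sqrCK.
Qed.

Let L2norm0_eq0 f : L2norm f = 0 -> f = 0.
Proof. by move/eqP; rewrite sqrtC_eq0 => /eqP/L2dot_eq0. Qed.

HB.instance Definition _ := Lmodule_isNormed.Build R[i] (L2 mu)
  L2normD L2normZ L2norm0_eq0.

Lemma L2normE f : `|f| = sqrtC (L2dot f f).
Proof. by []. Qed.
End L2_norm.

Section bounded_operators.
Context (R : realType) (V : normedModType R[i]).

Definition bounded_operator : {pred V -> V} := mem [set f : V -> V |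
  linear f /\ exists M : R, forall x, `|f x| <= M%:C * `|x|].

Lemma bounded_operatorP (f : V -> V) :
  reflect (linear f /\ exists M : R, forall x, `|f x| <= M%:C * `|x|)
          (f \in bounded_operator).
Proof. by apply: (iffP idP); rewrite inE. Qed.

Let Re_norm (z : R[i]) : (Re `|z|)%:C = `|z|.
Proof. by rewrite RRe_real// normr_real. Qed.

Let Re_normV (x : V) : (Re `|x|)%:C = `|x|.
Proof. by rewrite RRe_real// normr_real. Qed.

Lemma bounded_operator_submod_closed : submod_closed bounded_operator.
Proof.
split.
  apply/bounded_operatorP; split=> [a x y|]; first by rewrite scaler0 addr0.
  by exists 0 => x; rewrite normr0 mul0r.
move=> a f g /bounded_operatorP[lf [M Mf]] /bounded_operatorP[lg [N Ng]].
apply/bounded_operatorP; split=> [b x y|].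
  rewrite !fctE lf lg !scalerDr !scalerA [b * a]mulrC -!addrA; congr (_ + _).
  by rewrite addrCA.
exists (Re `|a| * M + N) => x; rewrite !fctE.
apply: le_trans (ler_normD _ _) _.
rewrite rmorphD rmorphM /= Re_norm mulrDl lerD// normrZ -mulrA.
by rewrite ler_wpM2l.
Qed.

HB.instance Definition _ := GRing.isSubmodClosed.Build R[i] (V -> V)
  bounded_operator bounded_operator_submod_closed.

(* The normed algebra of bounded operators on V: sum and scaling are pointwise,
   the ring product is composition, the norm is the operator norm. *)
Record bop := Bop {
  bop_fun :> V -> V;
  bop_subproof : bop_fun \in bounded_operator }.

HB.instance Definition _ := [isSub for bop_fun].
HB.instance Definition _ := [Choice of bop by <:].
HB.instance Definition _ := [SubChoice_isSubLmodule of bop by <:].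

Implicit Types S T : bop.

Lemma bop_linear T : linear T.
Proof. by have /bounded_operatorP[] := bop_subproof T. Qed.

HB.instance Definition _ T := GRing.isLinear.Build R[i] V V *:%R T
  (bop_linear T).

Lemma bopP S T : S = T <-> S =1 T.
Proof. by split=> [->//|ST]; apply/val_inj/funext. Qed.

Definition opnorm T : R[i] :=
  (sup [set Re `|T x| | x in [set x | `|x| <= 1]])%:C.

Let opset T := [set Re `|T x| | x in [set x | `|x| <= 1]].

Let opset_sup T : has_sup (opset T).
Proof.
split; first by exists (Re `|T 0|), 0 => //=; rewrite normr0.
have /bounded_operatorP[_ [M MT]] := bop_subproof T.
exists `|M| => _ [x /= x1 <-]; rewrite -lecR Re_normV.
apply: le_trans (MT x) _; rewrite -[leRHS]mulr1.
apply: le_trans (_ : `|M|%:C * `|x| <= _).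
  by rewrite ler_wpM2r// lecR ler_norm.
by rewrite ler_wpM2l// ler0c.
Qed.

Lemma opnorm_ub T x : `|x| <= 1 -> `|T x| <= opnorm T.
Proof.
move=> x1; rewrite -Re_normV lecR.
by apply: ub_le_sup; [case: (opset_sup T)|exists x].
Qed.

Lemma opnorm_le T (c : R[i]) :
  (forall x, `|x| <= 1 -> `|T x| <= c) -> opnorm T <= c.
Proof.
move=> Tc; have c0 : 0 <= c.
  by apply: le_trans (Tc 0 _); rewrite ?normr0 ?normr_ge0.
rewrite -(RRe_real (ger0_real c0)) lecR; apply: ge_sup.
  by case: (opset_sup T).
by move=> _ [x /= x1 <-]; rewrite -lecR Re_normV (RRe_real (ger0_real c0)) Tc.
Qed.

Lemma opnorm_ge0 T : 0 <= opnorm T.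
Proof.
by apply: le_trans (opnorm_ub T (_ : `|0| <= 1)); rewrite ?normr_ge0 ?normr0.
Qed.

Lemma ler_opnorm T x : `|T x| <= opnorm T * `|x|.
Proof.
have [->|x0] := eqVneq x 0; first by rewrite linear0 !normr0 mulr0.
have nx : `|x| != 0 by rewrite normr_eq0.
rewrite -ler_pdivrMr ?normr_gt0// mulrC.
have <- : `|T (`|x|^-1 *: x)| = `|x|^-1 * `|T x|.
  by rewrite linearZ /= normrZ normfV normr_id.
by apply: opnorm_ub; rewrite normrZ normfV normr_id mulVf.
Qed.

Let opnormD S T : opnorm (S + T) <= opnorm S + opnorm T.
Proof.
apply: opnorm_le => x x1; apply: le_trans (ler_normD _ _) _.
by rewrite lerD// opnorm_ub.
Qed.

Let opnormZ_le c T : opnorm (c *: T) <= `|c| * opnorm T.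
Proof.
by apply: opnorm_le => x x1; rewrite [leLHS]normrZ ler_wpM2l// opnorm_ub.
Qed.

Let opnormZ c T : opnorm (c *: T) = `|c| * opnorm T.
Proof.
apply/eqP; rewrite eq_le opnormZ_le /=.
have [->|c0] := eqVneq c 0; first by rewrite normr0 mul0r opnorm_ge0.
rewrite -ler_pdivlMl ?normr_gt0// -normfV.
by apply: le_trans (opnormZ_le _ _); rewrite scalerA mulVf// scale1r.
Qed.

Let opnorm_eq0 T : opnorm T = 0 -> T = 0.
Proof.
move=> T0; apply/bopP => x; apply/eqP; rewrite -normr_le0.
by apply: le_trans (ler_opnorm T x) _; rewrite T0 mul0r.
Qed.

HB.instance Definition _ := Lmodule_isNormed.Build R[i] bop
  opnormD opnormZ opnorm_eq0.

Lemma bop_id_subproof : idfun \in bounded_operator.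
Proof.
by apply/bounded_operatorP; split=> //; exists 1 => x; rewrite mul1r.
Qed.

Lemma bop_comp_subproof S T : S \o T \in bounded_operator.
Proof.
apply/bounded_operatorP; split=> [a x y|].
  by rewrite /= !linearP.
exists (Re (opnorm S) * Re (opnorm T)) => x.
rewrite (_ : (_ * _)%:C = opnorm S * opnorm T); last by rewrite -rmorphM.
rewrite -mulrA; apply: le_trans (ler_opnorm _ _) _.
by rewrite ler_wpM2l ?opnorm_ge0// ler_opnorm.
Qed.

Definition bop_id := Bop bop_id_subproof.
Definition bop_comp S T := Bop (bop_comp_subproof S T).

Let bop_compA : associative bop_comp.
Proof. by move=> ? ? ?; apply/bopP. Qed.
Let bop_comp1l : left_id bop_id bop_comp.
Proof. by move=> ?; apply/bopP. Qed.
Let bop_comp1r : right_id bop_id bop_comp.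
Proof. by move=> ?; apply/bopP. Qed.
Let bop_compDl : left_distributive bop_comp +%R.
Proof. by move=> ? ? ?; apply/bopP. Qed.
Let bop_compDr : right_distributive bop_comp +%R.
Proof. by move=> U S T; apply/bopP => x; exact: linearD. Qed.

HB.instance Definition _ := GRing.Zmodule_isPzRing.Build bop
  bop_compA bop_comp1l bop_comp1r bop_compDl bop_compDr.

End bounded_operators.

Arguments bounded_operator {R} V : rename.

Section operator_functions.
Context (R : realType) (V : normedModType R[i]).
Implicit Types S T A B : bop V.

Definition is_inverse T S := S * T = 1 /\ T * S = 1.

Definition spectrum T : set R[i] :=
  [set l | ~ exists S, is_inverse (T - l *: (1 : bop V)) S].

Definition bop_horner T (p : {poly R[i]}) : bop V :=
  \sum_(i < size p) p`_i *: T ^+ i.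

(* Continuous functional calculus of a self-adjoint T: phi(T) is the norm limit
   of p_n(T) for any polynomials p_n converging to phi uniformly on the (real)
   spectrum of T. Such a limit exists, and is unique, when T is self-adjoint and
   phi is continuous. *)
Definition is_cfc T (phi : R -> R[i]^o) S :=
  exists p : nat -> {poly R[i]},
    {uniform [set x : R | spectrum T x%:C],
       (fun n (x : R) => (p n).[x%:C] : R[i]^o) @ \oo --> phi} /\
    bop_horner T (p n) @[n --> \oo] --> S.

Definition cfc T (phi : R -> R[i]^o) : bop V := xget 0 [set S | is_cfc T phi S].

Definition disk (r : R) : set R[i] := [set z | `|z| < r%:C].

(* derivable F z 1 is existence of the limit of h^-1 *: (F (z + h) - F z) as the
   complex number h tends to 0, in the operator norm. *)
Definition holomorphic_on (D : set R[i]) (F : R[i]^o -> bop V) :=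
  forall z, D z -> derivable F z 1.

Definition holomorphic_continuation (r : R) (f : R -> bop V) :=
  exists2 F : R[i]^o -> bop V, holomorphic_on (disk r) F &
    forall t : R, `|t| < r -> F t%:C = f t.

Definition FH A B := exists2 r : R, 0 < r &
  forall phi : R -> R[i]^o, continuous phi ->
    holomorphic_continuation r (fun t => cfc (A + t%:C *: B) phi).

Definition CLI A B := exists2 r : R, 0 < r &
  forall z, disk r z -> spectrum (A + z *: B) = spectrum A.

End operator_functions.

Section unitary_equivalence.
Context d (T : measurableType d) (R : realType).
Variable mu : {measure set T -> \bar R}.
Implicit Types A B U : bop (L2 mu).

Definition unitary U :=
  (forall f g, L2dot (U f) (U g) = L2dot f g) /\ exists U', is_inverse U U'.

Definition HUE A B := exists2 r : R, 0 < r &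
  exists2 U : R -> bop (L2 mu),
    (forall t : R, `|t| < r -> unitary (U t) /\
       exists2 U', is_inverse (U t) U' & A + t%:C *: B = U' * A * U t) &
    holomorphic_continuation r U.

Lemma rank_one_subproof (g : L2 mu) :
  (fun f => L2dot f g *: g) \in bounded_operator (L2 mu).
Proof.
apply/bounded_operatorP; split=> [a u v|].
  by rewrite L2dotDl L2dotZl scalerDl scalerA.
exists (Re `|g| * Re `|g|) => f; rewrite normrZ.
have Rg : (Re `|g|)%:C = `|g| by rewrite RRe_real// normr_real.
rewrite (_ : (_ * _)%:C = `|g| * `|g|); last by rewrite -[in RHS]Rg -rmorphM.
rewrite mulrAC ler_wpM2r// mulrC.
rewrite -ler_sqr ?nnegrE ?mulr_ge0// exprMn !L2normE !sqrtCK.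
exact: L2_CauchySchwarz.
Qed.

Definition rank_one (g : L2 mu) := Bop (rank_one_subproof g).

End unitary_equivalence.

Section multiplication_operator.
Context d (T : measurableType d) (R : realType).
Variable mu : {measure set T -> \bar R}.
Variable a : T -> R.

Definition ae_bounded := exists2 M : R, 0 < M & \forall x \ae mu, `|a x| <= M.

Hypothesis ma : measurable_fun setT a.
Hypothesis ba : ae_bounded.

Implicit Type f : L2 mu.

Let normc_mul (x : R) (z : R[i]) :
  Normc.normc (x%:C * z) ^+ 2 = `|x| ^+ 2 * Normc.normc z ^+ 2.
Proof.
by rewrite Normc.normcM exprMn /= expr0n addr0 sqrtr_sqr.
Qed.

Let cmeasurable_mul f : cmeasurable (fun x => (a x)%:C * f x).
Proof.
have [[m1 m2] _] := L2funP f.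
split.
  apply: (@eq_measurable_fun _ _ _ _ _ (fun x => a x * Re (f x))).
    by move=> x _; case: (f x) => u v /=; rewrite mul0r subr0.
  exact: measurable_funM.
apply: (@eq_measurable_fun _ _ _ _ _ (fun x => a x * Im (f x))).
  by move=> x _; case: (f x) => u v /=; rewrite mul0r addr0.
exact: measurable_funM.
Qed.

Let cmeasurable_normc (u : T -> R[i]) : cmeasurable u ->
  measurable_fun setT (fun x => (Normc.normc (u x) ^+ 2)%:E).
Proof.
move=> [m1 m2]; apply/measurable_EFinP.
apply: (@eq_measurable_fun _ _ _ _ _ (fun x => Re (u x) ^+ 2 + Im (u x) ^+ 2)).
  by move=> x _; case: (u x) => b c /=; rewrite sqr_sqrtr// addr_ge0 ?sqr_ge0.
by apply: measurable_funD; exact: measurable_funX.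
Qed.

Let mul_bound M f : 0 < M -> (\forall x \ae mu, `|a x| <= M) ->
  (\int[mu]_x (Normc.normc ((a x)%:C * f x) ^+ 2)%:E <=
   (M ^+ 2)%:E * \int[mu]_x (Normc.normc (f x) ^+ 2)%:E)%E.
Proof.
move=> M0 aeM; have [mf fi] := L2funP f.
rewrite -ge0_integralZl//; last first.
- by rewrite lee_fin sqr_ge0.
- by move=> x _; rewrite lee_fin sqr_ge0.
- exact: cmeasurable_normc.
apply: ae_ge0_le_integral => //.
- by move=> x _; rewrite lee_fin sqr_ge0.
- exact: (cmeasurable_normc (cmeasurable_mul f)).
- by move=> x _; rewrite -EFinM lee_fin; apply: mulr_ge0; exact: sqr_ge0.
- by apply: measurable_funeM; exact: cmeasurable_normc.
apply: filterS aeM => x xM _; rewrite -EFinM lee_fin normc_mul.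
by rewrite ler_wpM2r ?sqr_ge0// ler_sqr ?nnegrE// ltW.
Qed.

Let mul_fun f : L2 mu := L2class mu (fun x => (a x)%:C * f x).

Let mul_funE f : \forall x \ae mu, mul_fun f x = (a x)%:C * f x.
Proof.
have [M M0 aeM] := ba; apply: L2classE; split; first exact: cmeasurable_mul.
apply: le_lt_trans (mul_bound _ M0 aeM) _.
by rewrite lte_mul_pinfty ?lee_fin ?sqr_ge0//; case: (L2funP f).
Qed.

Lemma mulop_subproof :
  (fun f => L2class mu (fun x => (a x)%:C * f x)) \in bounded_operator (L2 mu).
Proof.
apply/bounded_operatorP; split=> [c u v|].
  apply/L2_eqP; near=> x.
  rewrite (near (mul_funE (c *: u + v)) x)//.
  rewrite (near (L2_addE (c *: u) v) x)// (near (L2_scaleE c u) x)//.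
  rewrite (near (L2_addE (c *: mul_fun u) (mul_fun v)) x)//.
  rewrite (near (L2_scaleE c (mul_fun u)) x)//.
  rewrite (near (mul_funE u) x)// (near (mul_funE v) x)//.
  by rewrite mulrDr mulrCA.
have [M M0 aeM] := ba.
exists M => f.
have M0' := ltW M0.
rewrite -ler_sqr ?nnegrE ?mulr_ge0 ?ler0c// exprMn !L2normE !sqrtCK.
rewrite !L2dotff -rmorphXn -rmorphM lecR.
have fin (h : L2 mu) : (\int[mu]_x (Normc.normc (h x) ^+ 2)%:E)%E \is a fin_num.
  rewrite ge0_fin_numE; first by case: (L2funP h).
  by apply: integral_ge0 => x _; rewrite lee_fin sqr_ge0.
rewrite -lee_fin EFinM !fineK//.
apply: le_trans (mul_bound f M0 aeM).
have m1 : cmeasurable (mul_fun f) by case: (L2funP (mul_fun f)).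
rewrite le_eqVlt; apply/orP; left; apply/eqP; apply: ae_eq_integral => //.
- exact: cmeasurable_normc.
- exact: (cmeasurable_normc (cmeasurable_mul f)).
by apply: filterS (mul_funE f) => x /= -> _.
Unshelve. all: by end_near. Qed.

Definition mulop : bop (L2 mu) := Bop mulop_subproof.

Lemma mulopE f : \forall x \ae mu, (mulop f : L2 mu) x = (a x)%:C * f x.
Proof. exact: mul_funE. Qed.

End multiplication_operator.

Section borel_measures.
Context (R : realType).
Variable rho : {measure set (measurableTypeR R) -> \bar R}.

Definition compactly_supported := exists2 K : set R, compact K & rho (~` K) = 0.

Lemma compactly_supported_bounded :
  compactly_supported -> ae_bounded rho (idfun : measurableTypeR R -> R).
Proof.
move=> [K cK K0]; have /pinfty_ex_gt0[M M0 KM] := compact_bounded cK.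
exists M => //; exists (~` K); split=> //.
  by apply: measurableC; exact: compact_measurable.
by move=> x /= nx Kx; apply: nx; exact: KM.
Qed.

Definition mul_id (hrho : compactly_supported) : bop (L2 rho) :=
  mulop (@measurable_id _ (measurableTypeR R) setT)
    (compactly_supported_bounded hrho).

Definition borel_transform (l : R[i]) : R[i] :=
  cintegral rho (fun t : R => (t%:C - l)^-1).

Definition BTB := exists M : R, forall l,
  0 < Im l -> `|borel_transform l| <= M%:C.

End borel_measures.

Lemma ex_L2_one d (T : measurableType d) (R : realType)
    (mu : {finite_measure set T -> \bar R}) :
  exists g : L2 mu, \forall x \ae mu, g x = 1.
Proof.
exists (L2class mu (cst 1)); apply: L2classE; split.
  by split; exact: measurable_cst.
rewrite (_ : (fun x => _) = cst 1%E); last first.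
  by apply/funext => x /=; rewrite expr1n expr0n addr0 sqrtr1 expr1n.
by rewrite integral_cst// mul1e fin_num_fun_lty//; exact: fin_num_measure.
Qed.

(* Main.v *)
(* Let b(l) = ((A - l)^-1 g, g) be the Borel transform. By the rank one structure
   ((A + t B - l)^-1 g, g) = 1 / (t - z0) with z0 = - 1 / b(l). Under HUE or FH the
   left side continues holomorphically in t to a disk that does not depend on l,
   so the identity theorem keeps z0 away from 0 and b is bounded. Under CLI, if z0
   were in the disk, then l would be in the spectrum of A + z0 B but not in that of A.

   Conversely let |b| <= M. The operators K_e with kernel 1 / (y - x - i e) satisfy
   K_e A - A K_e - i e K_e = B, and a Lyapunov argument shows that such an equation
   has at most one solution and that a positive right side forces positivity. Hence
   K_e is skew-adjoint, - i K_e is nonnegative and monotone in e, and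
   K_e K_d = b_e K_(e+d) - K_(e+d) b_d^* with b_e = K_e g, which gives
   |K_e|^2 <= 2 M |K_(2e)| and thus |K_e| <= 2 M. So K_e has a strong limit H with
   H A - A H = B and H^2 = b H - H b^*, where b = H g is bounded. For small z the
   operator U(z) = 1 - z (1 + z b)^-1 H has the inverse 1 + z H (1 + z b^* )^-1,
   conjugates A to A + z B, and is unitary for real z; HUE, FH and CLI follow. *)
Require Import Defs.
From HB Require Import structures.
From mathcomp Require Import all_boot all_order all_algebra.
From mathcomp Require Import all_classical all_reals all_analysis.
From mathcomp Require Import measurable_realfun complex ring lra.

Set Implicit Arguments.
Unset Strict Implicit.
Unset Printing Implicit Defensive.

Import Order.TTheory GRing.Theory Num.Theory.
Import numFieldNormedType.Exports.

Local Open Scope classical_set_scope.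
Local Open Scope ring_scope.
Local Open Scope complex_scope.

Local Notation Re := complex.Re.
Local Notation Im := complex.Im.
Local Notation normc := Normc.normc.

(** The kernel $1/(y-x)$ need not be integrable against $\rho$, so the solution $H$ of $HA-AH=B$ has
    to be reached through the $K_e$. The formula for $K_eK_d$ is Cotlar's identity: by partial
    fractions the product of $1/(y-x-ie)$ and $1/(w-y-id)$ is their sum times $1/(w-x-i(e+d))$, and
    integrating in $y$ turns the two summands into $b_e(x)$ and $-b_d(w)^*$. Deriving it from
    uniqueness for the Sylvester equation avoids Fubini; skewness, positivity and monotonicity of
    the $K_e$ likewise come from their commutator with $A$ alone.

    The identity theorem is needed in one form: a holomorphic function vanishing on a real interval
    vanishes on a disk of comparable radius. Goursat's bisection gives this on finite midpoint sums,
    with no integral defined. The disk has a quarter of the original radius, which is the origin of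
    the bound $4/r$ on the Borel transform.

    In the functional calculus, adjoints are explicit operators, and the norm of a polynomial in a
    symmetric operator is read off its spectrum by factoring over the complex numbers, so no
    spectral theorem is involved. *)

Section normc_theory.
Context {R : realType}.
Implicit Types z w : R[i].

Lemma norm_normc z : `|z| = (normc z)%:C.
Proof. exact: erefl. Qed.

Lemma normc_ge0 z : 0 <= normc z.
Proof. by case: z => a b; exact: sqrtr_ge0. Qed.

Lemma normc_eq0 z : (normc z == 0) = (z == 0).
Proof.
apply/eqP/eqP => [/Normc.eq0_normc//|->]; exact: Normc.normc0.
Qed.

Lemma normc_gt0 z : (0 < normc z) = (z != 0).
Proof. by rewrite lt_neqAle normc_ge0 andbT eq_sym normc_eq0. Qed.

Lemma normcD z w : normc (z + w) <= normc z + normc w.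
Proof. exact: le_normcD. Qed.

Lemma normcB z w : normc (z - w) <= normc z + normc w.
Proof. by rewrite -(normcN w); exact: le_normcD. Qed.

Lemma normcBC z w : normc (z - w) = normc (w - z).
Proof. by rewrite -normcN opprB. Qed.

Lemma normc_real (x : R) : normc x%:C = `|x|.
Proof. by rewrite /= expr0n addr0 sqrtr_sqr. Qed.

Lemma normc_i : normc 'i = 1 :> R.
Proof. by rewrite /= expr0n expr1n add0r sqrtr1. Qed.

Lemma normc_conj z : normc z^* = normc z.
Proof. by case: z => a b /=; rewrite sqrrN. Qed.

Lemma normcX z n : normc (z ^+ n) = normc z ^+ n.
Proof.
by elim: n => [|n IH]; rewrite ?expr0 ?Normc.normc1// !exprS Normc.normcM IH.
Qed.

Lemma ler_abs_Re z : `|Re z| <= normc z.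
Proof.
case: z => a b /=; rewrite -sqrtr_sqr; apply: ler_wsqrtr.
by rewrite lerDl sqr_ge0.
Qed.

Lemma ler_abs_Im z : `|Im z| <= normc z.
Proof.
have := ler_abs_Re (z * 'i); rewrite ReiNIm normrN.
by rewrite Normc.normcM normc_i mulr1.
Qed.

Lemma normc2 : normc (2 : R[i]) = 2.
Proof.
have -> : (2 : R[i]) = (2 : R)%:C by rewrite rmorphD.
by rewrite normc_real ger0_norm.
Qed.

Lemma sqr_normcE z : normc z ^+ 2 = Re z ^+ 2 + Im z ^+ 2.
Proof. by case: z => a b /=; rewrite sqr_sqrtr// addr_ge0 ?sqr_ge0. Qed.

Lemma normc_leD z : normc z <= `|Re z| + `|Im z|.
Proof.
rewrite {1}(complexE z); apply: le_trans (normcD _ _) _.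
by rewrite Normc.normcM normc_i mul1r !normc_real.
Qed.

Lemma complex_gt0P (e : R[i]) : 0 < e -> exists2 d : R, 0 < d & e = d%:C.
Proof.
move=> e0; have /RRe_real er := gtr0_real e0.
by exists (Re e); rewrite ?er// -ltcR er.
Qed.

Lemma rcD (a b : R) : (a + b)%:C = a%:C + b%:C. Proof. exact: rmorphD. Qed.
Lemma rcN (a : R) : (- a)%:C = - a%:C. Proof. exact: rmorphN. Qed.
Lemma rcM (a b : R) : (a * b)%:C = a%:C * b%:C. Proof. exact: rmorphM. Qed.
Lemma rcV (a : R) : (a^-1)%:C = (a%:C)^-1. Proof. exact: fmorphV. Qed.
Lemma rcX (a : R) n : (a ^+ n)%:C = a%:C ^+ n. Proof. exact: rmorphXn. Qed.
Lemma rc0 : (0 : R)%:C = 0. Proof. by []. Qed.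
Lemma rc1 : (1 : R)%:C = 1. Proof. by []. Qed.
Lemma rc2 : (2 : R)%:C = 2. Proof. exact: rmorph_nat. Qed.
Definition rcE := (rcD, rcN, rcM, rcV, rc0, rc1, rc2).

Lemma normc_ltE z (e : R) : (`|z| < e%:C) = (normc z < e).
Proof. by rewrite norm_normc; exact: ltcR. Qed.

Lemma normc_leE z (e : R) : (`|z| <= e%:C) = (normc z <= e).
Proof. by rewrite norm_normc; exact: lecR. Qed.

Lemma rc_gt0 (e : R) : (0 < e%:C) = (0 < e).
Proof. exact: ltcR. Qed.

End normc_theory.

(** * An identity theorem without contour integrals *)

Section midpoint_sums.
Context {R : realType}.
Implicit Types (f : R[i] -> R[i]) (p u v : R[i]).

(* Dyadic midpoint sums stand in for the integral of f over a segment. *)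
Fixpoint midsum n f (a b : R[i]) : R[i] :=
  if n is m.+1 then midsum m f a ((a + b) / 2) + midsum m f ((a + b) / 2) b
  else (b - a) * f ((a + b) / 2).

Definition parsum n f p u v :=
  midsum n f p (p + u) + midsum n f (p + u) (p + u + v) +
  midsum n f (p + u + v) (p + v) + midsum n f (p + v) p.

Lemma midsum0 f a b : midsum 0 f a b = (b - a) * f ((a + b) / 2).
Proof. by []. Qed.

Lemma midsumS n f a b : midsum n.+1 f a b =
  midsum n f a ((a + b) / 2) + midsum n f ((a + b) / 2) b.
Proof. by []. Qed.

Lemma midsumN n f a b : midsum n f b a = - midsum n f a b.
Proof.
elim: n a b => [|n IH] a b /=; first by rewrite [b + a]addrC; ring.
rewrite [b + a]addrC; set m := (_ + _) / 2.
by rewrite [midsum n f b m]IH [midsum n f m a]IH; ring.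
Qed.

(** The midpoint rule is exact on affine functions, so affine parts drop out of closed sums at every
    level [n]. This takes the place of a primitive. *)
Lemma midsum_affine n (al be : R[i]) a b :
  midsum n (fun z => al + be * z) a b =
  al * (b - a) + be * (b ^+ 2 - a ^+ 2) / 2.
Proof. by elim: n a b => [|n IH] a b /=; rewrite ?IH; field. Qed.

Lemma midsumD n f g a b :
  midsum n (fun z => f z + g z) a b = midsum n f a b + midsum n g a b.
Proof. by elim: n a b => [|n IH] a b /=; rewrite ?IH; ring. Qed.

(** Stands in for convexity: a midpoint sum evaluates [f] only at iterated midpoints of the
    endpoints. *)
Definition midclosed (P : R[i] -> Prop) :=
  forall a b, P a -> P b -> P ((a + b) / 2).

Lemma midsum_le n f (P : R[i] -> Prop) (C : R) a b :
  midclosed P -> P a -> P b -> (forall z, P z -> normc (f z) <= C) ->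
  normc (midsum n f a b) <= C * normc (b - a).
Proof.
move=> mP; elim: n a b => [|n IH] a b Pa Pb PC /=.
  by rewrite Normc.normcM mulrC ler_wpM2r ?normc_ge0// PC//; exact: mP.
apply: le_trans (normcD _ _) _.
have Pm := mP _ _ Pa Pb.
apply: le_trans (lerD (IH _ _ Pa Pm PC) (IH _ _ Pm Pb PC)) _.
have -> : (a + b) / 2 - a = (b - a) * 2^-1 by field.
have -> : b - (a + b) / 2 = (b - a) * 2^-1 by field.
have -> : normc ((b - a) * 2^-1) = normc (b - a) / 2.
  by rewrite Normc.normcM Normc.normcV normc2.
rewrite -mulrDr -splitr//.
Qed.

Lemma eq_midsum n f g (P : R[i] -> Prop) a b :
  midclosed P -> P a -> P b -> (forall z, P z -> f z = g z) ->
  midsum n f a b = midsum n g a b.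
Proof.
move=> mP; elim: n a b => [|n IH] a b Pa Pb fg /=; first by rewrite fg//; exact: mP.
by have Pm := mP _ _ Pa Pb; rewrite !IH.
Qed.

Lemma parsumD n f g p u v :
  parsum n (fun z => f z + g z) p u v = parsum n f p u v + parsum n g p u v.
Proof. by rewrite /parsum !midsumD; ring. Qed.

Lemma parsum_affine n (al be : R[i]) p u v :
  parsum n (fun z => al + be * z) p u v = 0.
Proof. by rewrite /parsum !midsum_affine; field. Qed.

(** Sides are split at the very midpoints where the parallelogram is cut, and inner edges are run
    twice in opposite directions. Subdivision is therefore an exact identity at each level. *)
Lemma parsumS n f p u v :
  parsum n.+1 f p u v =
    parsum n f p (u / 2) (v / 2) + parsum n f (p + u / 2) (u / 2) (v / 2) +
    parsum n f (p + v / 2) (u / 2) (v / 2) +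
    parsum n f (p + u / 2 + v / 2) (u / 2) (v / 2).
Proof.
rewrite /parsum /=.
have -> : (p + (p + u)) / 2 = p + u / 2 by field.
have -> : (p + u + (p + u + v)) / 2 = p + u + v / 2 by field.
have -> : (p + u + v + (p + v)) / 2 = p + v + u / 2 by field.
have -> : (p + v + p) / 2 = p + v / 2 by field.
have e1 : p + u / 2 + u / 2 = p + u by field.
have e2 : p + v / 2 + v / 2 = p + v by field.
have e3 : p + v / 2 + u / 2 = p + u / 2 + v / 2 by field.
have e4 : p + u / 2 + v / 2 + u / 2 = p + u + v / 2 by field.
have e5 : p + u / 2 + v / 2 + v / 2 = p + v + u / 2 by field.
have e6 : p + v / 2 + u / 2 + v / 2 = p + v + u / 2 by field.
have e7 : p + u / 2 + u / 2 + v / 2 = p + u + v / 2 by field.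
have e8 : p + u / 2 + v / 2 + u / 2 + v / 2 = p + u + v by field.
rewrite e3 e8 e5 e4 e2 e1.
rewrite (midsumN n f (p + u / 2) (p + u / 2 + v / 2)).
rewrite (midsumN n f (p + v / 2) (p + u / 2 + v / 2)).
rewrite (midsumN n f (p + u / 2 + v / 2) (p + u + v / 2)).
rewrite (midsumN n f (p + u / 2 + v / 2) (p + v + u / 2)).
ring.
Qed.

End midpoint_sums.

Definition cdiff (R : realType) (f : R[i] -> R[i]) (z d : R[i]) :=
  forall e : R, 0 < e -> exists2 del : R, 0 < del &
  forall w, normc (w - z) < del ->
    normc (f w - f z - d * (w - z)) <= e * normc (w - z).

Definition cdiffable (R : realType) (f : R[i] -> R[i]) z := exists d, cdiff f z d.

(** * Goursat's lemma on parallelograms *)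

Section goursat.
Context {R : realType}.
Implicit Types (f : R[i] -> R[i]) (p u v z : R[i]).

Definition inpar p u v z := exists x y : R,
  [/\ 0 <= x <= 1, 0 <= y <= 1 & z = p + x%:C * u + y%:C * v].

Lemma inpar_mid p u v : midclosed (inpar p u v).
Proof.
move=> _ _ [x [y [x01 y01 ->]]] [x' [y' [x'01 y'01 ->]]].
exists ((x + x') / 2), ((y + y') / 2); split; [lra|lra|].
have e (a b : R) : ((a + b) / 2)%:C = (a%:C + b%:C) / 2.
  by rewrite !rcE.
by rewrite !e; field.
Qed.

Lemma inpar_corners p u v :
  [/\ inpar p u v p, inpar p u v (p + u), inpar p u v (p + u + v) &
      inpar p u v (p + v)].
Proof.
split; [exists 0, 0|exists 1, 0|exists 1, 1|exists 0, 1];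
  by split; rewrite ?lexx ?ler01 ?rc0 ?rc1//; ring.
Qed.

Lemma parsum_le n f p u v (C L : R) : normc u <= L -> normc v <= L ->
  (forall z, inpar p u v z -> normc (f z) <= C) ->
  normc (parsum n f p u v) <= 4 * C * L.
Proof.
move=> uL vL fC; have [c1 c2 c3 c4] := inpar_corners p u v.
have C0 : 0 <= C by exact: le_trans (normc_ge0 _) (fC _ c1).
have m := @inpar_mid p u v.
have h a b : inpar p u v a -> inpar p u v b -> normc (b - a) <= L ->
    normc (midsum n f a b) <= C * L.
  move=> ia ib ab; apply: le_trans (midsum_le n m ia ib fC) _.
  by rewrite ler_wpM2l.
have h1 : normc (midsum n f p (p + u)) <= C * L.
  by apply: h => //; rewrite addrC addKr.
have h2 : normc (midsum n f (p + u) (p + u + v)) <= C * L.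
  by apply: h => //; rewrite addrC addKr.
have h3 : normc (midsum n f (p + u + v) (p + v)) <= C * L.
  by apply: h => //; rewrite normcBC (_ : _ - _ = u)//; ring.
have h4 : normc (midsum n f (p + v) p) <= C * L.
  by apply: h => //; rewrite normcBC (_ : _ - _ = v)//; ring.
rewrite /parsum.
have t1 := normcD (midsum n f p (p + u)) (midsum n f (p + u) (p + u + v)).
have t2 := normcD (midsum n f p (p + u) + midsum n f (p + u) (p + u + v))
  (midsum n f (p + u + v) (p + v)).
have t3 := normcD (midsum n f p (p + u) + midsum n f (p + u) (p + u + v) +
  midsum n f (p + u + v) (p + v)) (midsum n f (p + v) p).
lra.
Qed.

(** Only an eventual bound, so that the sums never have to be shown to converge. *)
Definition evle f p u v (e : R) := exists N, forall n, (N <= n)%N ->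
  normc (parsum n f p u v) <= e.

Lemma evle_half f p u v e1 e2 e3 e4 :
  evle f p (u / 2) (v / 2) e1 -> evle f (p + u / 2) (u / 2) (v / 2) e2 ->
  evle f (p + v / 2) (u / 2) (v / 2) e3 ->
  evle f (p + u / 2 + v / 2) (u / 2) (v / 2) e4 ->
  evle f p u v (e1 + e2 + e3 + e4).
Proof.
move=> [N1 h1] [N2 h2] [N3 h3] [N4 h4].
exists (N1 + N2 + N3 + N4).+1 => -[//|n]; rewrite ltnS => nN; rewrite parsumS.
have le1 : (N1 <= n)%N by rewrite (leq_trans _ nN)// -!addnA leq_addr.
have le2 : (N2 <= n)%N by rewrite (leq_trans _ nN)// -addnA addnAC leq_addl.
have le3 : (N3 <= n)%N by rewrite (leq_trans _ nN)// addnAC leq_addl.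
have le4 : (N4 <= n)%N by rewrite (leq_trans _ nN)// leq_addl.
apply: le_trans (normcD _ _) _; apply: lerD; last exact: h4.
apply: le_trans (normcD _ _) _; apply: lerD; last exact: h3.
by apply: le_trans (normcD _ _) _; apply: lerD; [exact: h1|exact: h2].
Qed.

Let h (k : nat) : R := 2^-1 ^+ k.

Let h0 k : 0 < h k. Proof. by rewrite exprn_gt0// invr_gt0. Qed.

Let hS k : h k.+1 = h k / 2. Proof. by rewrite /h exprSr. Qed.

Let half_real (x : R) : (x / 2)%:C = x%:C / 2.
Proof. by rewrite !rcE. Qed.

Let sub f p u v (k : nat) (x y e : R) :=
  evle f (p + x%:C * u + y%:C * v) ((h k)%:C * u) ((h k)%:C * v) e.

(** A state [(k, (x, y))] is the subparallelogram of scale [h k] with corner at coordinates [x],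
    [y]. Its share of [e] is proportional to area, hence the factor $4^{-k}$. *)
Let bad f p u v e (s : nat * (R * R)) :=
  [/\ 0 <= s.2.1 /\ s.2.1 + h s.1 <= 1, 0 <= s.2.2 /\ s.2.2 + h s.1 <= 1 &
      ~ sub f p u v s.1 s.2.1 s.2.2 (e * 2^-1 ^+ (2 * s.1))].

Let next (s s' : nat * (R * R)) :=
  [/\ s'.1 = s.1.+1,
      s.2.1 <= s'.2.1 /\ s'.2.1 + h s'.1 <= s.2.1 + h s.1 &
      s.2.2 <= s'.2.2 /\ s'.2.2 + h s'.1 <= s.2.2 + h s.1].

Let bad_next f p u v e s : bad f p u v e s ->
  exists s', bad f p u v e s' /\ next s s'.
Proof.
case: s => k [x y] [[/= x0 x1] [y0 y1] nE]; apply: contrapT => nex.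
have hk := h0 k; have hSk := hS k.
have E a b : a \in [:: 0; h k.+1] -> b \in [:: 0; h k.+1] ->
    sub f p u v k.+1 (x + a) (y + b) (e * 2^-1 ^+ (2 * k.+1)).
  rewrite !inE => ab ab'; apply: contrapT => nE'; apply: nex.
  have a0 : 0 <= a <= h k.+1 by case/orP: ab => /eqP ->; lra.
  have b0 : 0 <= b <= h k.+1 by case/orP: ab' => /eqP ->; lra.
  by exists (k.+1, (x + a, y + b)); split; split=> //=; split; lra.
apply: nE; rewrite /sub.
have -> : e * 2^-1 ^+ (2 * k) = e * 2^-1 ^+ (2 * k.+1) + e * 2^-1 ^+ (2 * k.+1)
   + e * 2^-1 ^+ (2 * k.+1) + e * 2^-1 ^+ (2 * k.+1).
  by rewrite mulnS exprD; field.
have m1 : 0 \in [:: 0; h k.+1] by rewrite inE eqxx.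
have m2 : h k.+1 \in [:: 0; h k.+1] by rewrite !inE eqxx orbT.
have E1 := E _ _ m1 m1; have E2 := E _ _ m2 m1.
have E3 := E _ _ m1 m2; have E4 := E _ _ m2 m2.
move: E1 E2 E3 E4; rewrite /sub hSk !rcD rc0 !addr0 !half_real => E1 E2 E3 E4.
have c w : (h k)%:C * w / 2 = (h k)%:C / 2 * w by rewrite mulrAC.
apply: evle_half; rewrite !c.
- exact: E1.
- move: E2; congr evle; ring.
- move: E3; congr evle; ring.
- move: E4; congr evle; ring.
Qed.

(** Nested bad parallelograms shrink to a point [z]. There the affine part of [f] contributes
    nothing to any sum, and the remainder is too small compared with the area to be bad. *)
Lemma goursat f p u v :
  (forall z, inpar p u v z -> cdiffable f z) ->
  forall e, 0 < e -> evle f p u v e.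
Proof.
move=> fd e e0; apply: contrapT => nE.
have [F FP] : {F : nat * (R * R) -> nat * (R * R) &
    forall s, bad f p u v e s -> bad f p u v e (F s) /\ next s (F s)}.
  have /choice[F FP] : forall s, exists s', bad f p u v e s ->
      bad f p u v e s' /\ next s s'.
    move=> s; have [/bad_next[s' s'P]|nb] := pselect (bad f p u v e s).
      by exists s'.
    by exists s.
  by exists F.
pose s k := iter k F (0%N, (0, 0)).
have b0 : bad f p u v e (s 0%N).
  split; rewrite /= ?/h ?expr0 ?add0r; [by rewrite lexx|by rewrite lexx|].
  by rewrite /sub /h /= !expr0 !rc0 !rc1 !mul0r !mul1r !addr0 mulr1.
have bs k : bad f p u v e (s k) by elim: k => [//|k /FP[]].
have ns k : next (s k) (s k.+1) by have [_] := FP _ (bs k).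
have s1 k : (s k).1 = k by elim: k => [//|k IH]; have [-> _ _] := ns k; rewrite IH.
have lim (x : R^nat) : (forall k, x k <= x k.+1 /\ x k.+1 + h k.+1 <= x k + h k) ->
    exists X, forall k, x k <= X <= x k + h k.
  move=> xk.
  have mono j k : (j <= k)%N -> x j <= x k /\ x k + h k <= x j + h j.
    move=> /subnK <-; elim: (k - j)%N => [//|i [i1 i2]].
    by have [k1 k2] := xk (i + j)%N; rewrite addSn; split; lra.
  have ub j k : x j <= x k + h k.
    have := h0 k; have := h0 j.
    by case: (leqP j k) => [/mono[]|/ltnW/mono[]]; lra.
  have hs : has_sup (range x).
    by split; [exists (x 0%N), 0%N|exists (x 0%N + h 0) => _ [j _ <-]].
  exists (sup (range x)) => k; apply/andP; split.
    by apply: ub_le_sup; [case: hs|exists k].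
  by apply: ge_sup; [case: hs|move=> _ [j _ <-]].
have [k|X XP] := lim (fun k => (s k).2.1).
  by have [_ + _] := ns k; rewrite !s1.
have [k|Y YP] := lim (fun k => (s k).2.2).
  by have [_ _ +] := ns k; rewrite !s1.
pose z := p + X%:C * u + Y%:C * v.
have [d dz] : cdiffable f z.
  apply: fd; exists X, Y; split=> //.
    have := XP 0%N; have [[/= + +] _ _] := bs 0%N.
    by rewrite /h expr0; lra.
  have := YP 0%N; have [_ [/= + +] _] := bs 0%N.
  by rewrite /h expr0; lra.
pose L := normc u + normc v.
have uL : normc u <= L by rewrite lerDl normc_ge0.
have vL : normc v <= L by rewrite lerDr normc_ge0.
have L0 : 0 <= L by rewrite addr_ge0 ?normc_ge0.
have L1 : 0 < L + 1 by lra.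
(* At scale [h k] the remainder is at most [eta * (h k * L)] on sides no longer than [h k * L], so
   four sides give at most [4 * eta * (h k * L) ^+ 2], within the share of [e]. Using [L + 1] allows
   [L = 0]. *)
pose eta := e / (4 * (L + 1) ^+ 2).
have eta0 : 0 < eta by rewrite divr_gt0// mulr_gt0// exprn_gt0.
have [del del0 hd] := dz _ eta0.
have [k kP] : exists k, h k * (L + 1) < del.
  have hc : h @ \oo --> (0 : R) by apply: cvg_expr; rewrite ger0_norm; lra.
  move/cvgrPdist_lt: hc => /(_ _ (divr_gt0 del0 L1))[k _ /(_ k (leqnn k))] /=.
  by rewrite sub0r normrN gtr0_norm ?h0// ltr_pdivlMr// => ?; exists k.
have [_ _] := bs k; rewrite s1; apply; exists 0%N => n _.
set x := (s k).2.1; set y := (s k).2.2.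
have par w : inpar (p + x%:C * u + y%:C * v) ((h k)%:C * u) ((h k)%:C * v) w ->
    normc (w - z) <= h k * L.
  move=> [a [b [a01 b01 ->]]].
  have -> : p + x%:C * u + y%:C * v + a%:C * ((h k)%:C * u) +
    b%:C * ((h k)%:C * v) - z =
    (x + a * h k - X)%:C * u + (y + b * h k - Y)%:C * v.
    by rewrite /z !rcE; ring.
  apply: le_trans (normcD _ _) _; rewrite !Normc.normcM !normc_real mulrDr.
  have hk := h0 k.
  have bd (q r Q : R) : 0 <= r <= 1 -> q <= Q <= q + h k -> `|q + r * h k - Q| <= h k.
    move=> /andP[r0 r1] qQ; rewrite ler_norml.
    have := ler_wpM2r (ltW hk) r1; have := mulr_ge0 r0 (ltW hk).
    by rewrite mul1r; lra.
  apply: lerD; apply: ler_wpM2r; rewrite ?normc_ge0//.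
    exact: bd a01 (XP k).
  exact: bd b01 (YP k).
have nh w : normc ((h k)%:C * w) = h k * normc w.
  by rewrite Normc.normcM normc_real gtr0_norm.
have uLk : normc ((h k)%:C * u) <= h k * L by rewrite nh ler_wpM2l// ltW.
have vLk : normc ((h k)%:C * v) <= h k * L by rewrite nh ler_wpM2l// ltW.
pose g w := f w - f z - d * (w - z).
have -> : parsum n f (p + x%:C * u + y%:C * v) ((h k)%:C * u) ((h k)%:C * v) =
          parsum n g (p + x%:C * u + y%:C * v) ((h k)%:C * u) ((h k)%:C * v).
  have fE : f = fun w => g w + ((f z - d * z) + d * w).
    by apply/funext => w; rewrite /g; ring.
  by rewrite {1}fE parsumD parsum_affine addr0.
apply: le_trans (parsum_le n uLk vLk (C := eta * (h k * L)) _) _.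
  move=> w /par wz; apply: le_trans (hd _ _) _.
    apply: le_lt_trans wz (le_lt_trans _ kP).
    by rewrite ler_wpM2l ?(ltW (h0 k))//; lra.
  by rewrite ler_wpM2l// ltW.
have -> : 4 * (eta * (h k * L)) * (h k * L) = e * 2^-1 ^+ (2 * k) * (L / (L + 1)) ^+ 2.
  rewrite mulnC exprM -/(h k) /eta; field.
  by rewrite gt_eqF.
rewrite -[leRHS]mulr1 ler_wpM2l ?mulr_ge0 ?exprn_ge0 ?(ltW e0)//.
rewrite exprn_ile1// ?divr_ge0 ?(ltW L1)//.
by rewrite ler_pdivrMr//; lra.
Qed.

End goursat.

(** * Squares with a singular corner, and the sums of 1/z *)

Section cauchy_square.
Context {R : realType}.
Implicit Types (f : R[i] -> R[i]) (c p u v w z : R[i]).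

Let ii : 'i * 'i = -1 :> R[i]. Proof. by rewrite -expr2 sqr_i. Qed.

Lemma reimE (s t : R) w : s%:C * w + t%:C * ('i * w) = (s +i* t) * w.
Proof. by rewrite (complexE (s +i* t)) complexiE [Re _]/= [Im _]/=; ring. Qed.

Lemma exists_half_pow_lt (e : R) : 0 < e -> exists k, 2^-1 ^+ k < e.
Proof.
move=> e0; have hc : (GRing.exp (2^-1) : R^nat) @ \oo --> (0 : R).
  by apply: cvg_expr; rewrite ger0_norm ?invr_ge0//; lra.
move/cvgrPdist_lt: hc => /(_ _ e0)[k _ /(_ k (leqnn k))] /=.
by rewrite sub0r normrN ger0_norm ?exprn_ge0 ?invr_ge0// => ?; exists k.
Qed.

(** Meant for a difference quotient at [c], bounded there but not known to be differentiable. Each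
    halving leaves three squares that avoid [c], handled by [goursat], and one square at [c], whose
    perimeter ends up too small to matter. *)
Lemma goursat_corner f c u : u != 0 ->
  (forall z, inpar c u ('i * u) z -> z != c -> cdiffable f z) ->
  (exists C, exists2 del : R, 0 < del &
    forall z, normc (z - c) < del -> normc (f z) <= C) ->
  forall e, 0 < e -> evle f c u ('i * u) e.
Proof.
move=> u0 fd [C [del del0 fC]] e e0.
have C0 : 0 <= C.
  by apply: le_trans (normc_ge0 (f c)) (fC _ _); rewrite subrr Normc.normc0.
(* Here [k] counts the halvings still to come and [r] is slack: a quarter goes to each of the three
   squares away from [c], and the last quarter to the recursive call. *)
have main k w r : w != 0 -> (forall z, inpar c w ('i * w) z -> z != c -> cdiffable f z) ->
    2 * normc w * 2^-1 ^+ k < del -> 0 < r ->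
    evle f c w ('i * w) (4 * C * (normc w * 2^-1 ^+ k) + r).
  elim: k w r => [|k IH] w r w0 wd wk r0.
    exists 0%N => n _; rewrite expr0 mulr1.
    apply: (@le_trans _ _ (4 * C * normc w)); last by rewrite lerDl ltW.
    apply: parsum_le => // [|z [x [y [x01 y01 ->]]]].
      by rewrite Normc.normcM normc_i mul1r.
    apply: fC; apply: le_lt_trans wk.
    have -> : c + x%:C * w + y%:C * ('i * w) - c = x%:C * w + y%:C * ('i * w) by ring.
    apply: le_trans (normcD _ _) _.
    rewrite !Normc.normcM normc_i !normc_real mul1r -mulrDl expr0 mulr1.
    by rewrite ler_wpM2r ?normc_ge0// !ger0_norm; lra.
  have half2 : normc (w / 2) = normc w / 2.
    by rewrite Normc.normcM Normc.normcV normc2.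
  have w20 : w / 2 != 0 by rewrite mulf_neq0// invr_eq0 pnatr_eq0.
  have i2 : 'i * w / 2 = 'i * (w / 2) by rewrite mulrA.
  have sub (a b : R) z : a \in [:: 0; 2^-1] -> b \in [:: 0; 2^-1] ->
      inpar (c + a%:C * w + b%:C * ('i * w)) (w / 2) ('i * (w / 2)) z ->
      inpar c w ('i * w) z /\ (0 < a + b -> z != c).
    rewrite !inE => ha hb [x [y [x01 y01 ->]]].
    have a01 : a = 0 \/ a = 2^-1 by case/orP: ha => /eqP; [left|right].
    have b01 : b = 0 \/ b = 2^-1 by case/orP: hb => /eqP; [left|right].
    have zE : c + a%:C * w + b%:C * ('i * w) + x%:C * (w / 2) + y%:C * ('i * (w / 2)) =
      c + (a + x / 2)%:C * w + (b + y / 2)%:C * ('i * w).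
      by rewrite !rcE; ring.
    rewrite zE; split.
      exists (a + x / 2), (b + y / 2); split=> //; first by case: a01 => ->; lra.
      by case: b01 => ->; lra.
    move=> ab; rewrite -subr_eq0.
    have -> : c + (a + x / 2)%:C * w + (b + y / 2)%:C * ('i * w) - c =
       ((a + x / 2) +i* (b + y / 2)) * w.
      by rewrite -[RHS]reimE -(addrA c) [c + _]addrC addrK.
    rewrite mulf_neq0// eq_complex /= negb_and; apply/orP.
    by case: a01 ab => ->; case: b01 => ->; [lra|right|left|left];
      rewrite gt_eqF//; lra.
  have m0 : 0 \in [:: 0; 2^-1 : R] by rewrite inE eqxx.
  have m1 : 2^-1 \in [:: 0; 2^-1 : R] by rewrite !inE eqxx orbT.
  have r4 : 0 < r / 4 by rewrite divr_gt0.
  have E1 : evle f c (w / 2) ('i * (w / 2)) (4 * C * (normc (w / 2) * 2^-1 ^+ k) + r / 4).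
    apply: IH => //; last by rewrite half2; move: wk; rewrite exprSr; lra.
    move=> z zw; apply: wd; have [] := sub 0 0 z m0 m0; last by [].
    by rewrite rc0 !mul0r !addr0.
  have E (a b : R) : a \in [:: 0; 2^-1] -> b \in [:: 0; 2^-1] -> 0 < a + b ->
    evle f (c + a%:C * w + b%:C * ('i * w)) (w / 2) ('i * (w / 2)) (r / 4).
    move=> ha hb ab; apply: goursat => // z /(sub _ _ _ ha hb)[zw zc].
    exact: wd (zc ab).
  have [p1 p2] : 0 < 2^-1 + 0 :> R /\ 0 < 0 + 2^-1 :> R.
    by rewrite addr0 add0r invr_gt0.
  have p3 : 0 < 2^-1 + 2^-1 :> R by rewrite addr_gt0// invr_gt0.
  have E2 := E _ _ m1 m0 p1; have E3 := E _ _ m0 m1 p2; have E4 := E _ _ m1 m1 p3.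
  have -> : 4 * C * (normc w * 2^-1 ^+ k.+1) + r =
    4 * C * (normc (w / 2) * 2^-1 ^+ k) + r / 4 + r / 4 + r / 4 + r / 4.
    by rewrite half2 exprSr; field.
  have hE (x : R[i]) : (2^-1)%:C * x = x / 2 by rewrite !rcE mulrC.
  move: E2 E3 E4; rewrite !hE !rc0 !mul0r !addr0 i2 => E2 E3 E4.
  by apply: evle_half; rewrite ?i2.
have nu0 : 0 < normc u by rewrite normc_gt0.
have [k1 k1P] : exists k, 2^-1 ^+ k < del / (2 * normc u).
  by apply: exists_half_pow_lt; rewrite divr_gt0// mulr_gt0.
have [k2 k2P] : exists k, 2^-1 ^+ k < e / (8 * (C + 1) * normc u).
  by apply: exists_half_pow_lt; rewrite divr_gt0// !mulr_gt0//; lra.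
have mono a b : (2^-1 : R) ^+ (a + b) <= 2^-1 ^+ a.
  by rewrite exprD ler_piMr ?exprn_ge0 ?invr_ge0// exprn_ile1// ?invr_ge0//; lra.
have h1 : 2 * normc u * 2^-1 ^+ (k1 + k2) < del.
  rewrite mulrC -ltr_pdivlMr ?mulr_gt0//; exact: le_lt_trans (mono _ _) k1P.
have h2 : (2^-1 : R) ^+ (k1 + k2) * (8 * (C + 1) * normc u) < e.
  rewrite -ltr_pdivlMr ?mulr_gt0//; last by lra.
  by rewrite addnC; exact: le_lt_trans (mono _ _) k2P.
have e2 : 0 < e / 2 by rewrite divr_gt0.
have [N NP] := main (k1 + k2)%N u (e / 2) u0 fd h1 e2.
exists N => n /NP /le_trans; apply.
have q0 : 0 <= normc u * 2^-1 ^+ (k1 + k2).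
  by rewrite mulr_ge0 ?normc_ge0 ?exprn_ge0 ?invr_ge0.
by nra.
Qed.

(** The factor [w] cancels between the increment and [z - c], so all four sides of a square centred
    at [c] give the same sum. *)
Lemma midsum_scale n (al c w a b : R[i]) : w != 0 ->
  midsum n (fun z => al / (z - c)) (c + w * a) (c + w * b) =
  al * midsum n (fun z => z^-1) a b.
Proof.
move=> w0; elim: n a b => [|n IH] a b /=.
  have -> : (c + w * a + (c + w * b)) / 2 - c = w * ((a + b) / 2) by field.
  have -> : c + w * b - (c + w * a) = w * (b - a) by ring.
  by rewrite invfM; set t := ((a + b) / 2)^-1; field.
have -> : (c + w * a + (c + w * b)) / 2 = c + w * ((a + b) / 2) by field.
by rewrite !IH mulrDr.
Qed.

(** Along real part 1 the form $dz/z$ has imaginary part $ds/(1+s^2)\ge ds/2$ for $|s|\le 1$. This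
    lower bound at every level shows that the winding sum stays away from zero, with neither an
    arctangent nor a limit. *)
Lemma Im_midsum_inv n (a b : R) : -1 <= a -> a <= b -> b <= 1 ->
  (b - a) / 2 <= Im (midsum n (fun z => z^-1) (1 +i* a) (1 +i* b)).
Proof.
have midE (x y : R) : (1 +i* x + (1 +i* y)) / 2 = 1 +i* ((x + y) / 2) :> R[i].
  have cE (q : R) : 1 +i* q = 1 + 'i * q%:C :> R[i] by rewrite (complexE (1 +i* q)) complexiE.
  by rewrite !cE !rcE; field.
elim: n a b => [|n IH] a b a1 ab b1.
  rewrite midsum0 midE.
  set t := (a + b) / 2.
  have t1 : t ^+ 2 <= 1.
    by rewrite -[leRHS](expr1n _ 2) -ler_sqrt ?sqr_ge0// !sqrtr_sqr normr1 ler_norml /t; lra.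
  have -> : (1 +i* b - 1 +i* a) * (1 +i* t)^-1 =
    ((b - a) * t / (1 + t ^+ 2)) +i* ((b - a) / (1 + t ^+ 2)) :> R[i].
    have t0 : 1 + t ^+ 2 != 0 by rewrite gt_eqF// ltr_pwDl ?sqr_ge0.
    apply/eqP; rewrite eq_complex /= expr1n.
    by apply/andP; split; apply/eqP; field.
  rewrite /= ler_wpM2l ?subr_ge0// lef_pV2 ?posrE//; last by rewrite ltr_pwDl ?sqr_ge0.
  by lra.
rewrite midsumS midE raddfD [leRHS]/=.
have h1 := IH a ((a + b) / 2); have h2 := IH ((a + b) / 2) b.
by apply: le_trans (lerD (h1 _ _ _) (h2 _ _ _)); lra.
Qed.

End cauchy_square.

(** * Differentiability in Caratheodory's form *)

Section caratheodory.
Context {K : numFieldType}.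
Implicit Types (f g phi : K -> K) (a c z w : K).

Lemma near_normP (P : K -> Prop) z : (\forall w \near z, P w) <->
  exists2 e : K, 0 < e & forall w, `|w - z| < e -> P w.
Proof.
split=> [/nbhs_normP[e /= e0 zP]|[e e0 eP]].
  by exists e => // w wz; apply: zP; rewrite /= distrC.
by apply/nbhs_normP; exists e => // w /=; rewrite distrC; exact: eP.
Qed.

(** The difference quotient is replaced by a function [phi] continuous at [z], so the product and
    affine substitution rules become algebra on such factors. *)
Definition caradiff f z := exists phi : K -> K,
  phi w @[w --> (z : K)] --> (phi z : K) /\
  \forall w \near (z : K), f w - f z = phi w * (w - z).

Let cst_cvg a z : (fun=> a) @ z --> a.
Proof. exact: (@cvg_cst K a K (nbhs z) (nbhs_filter z)). Qed.

Let id_cvg z : id w @[w --> z] --> z.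
Proof. exact: cvg_id. Qed.

Lemma caradiff_continuous f z : caradiff f z -> f w @[w --> z] --> f z.
Proof.
move=> [phi [cphi h]].
have := cvgD (@cst_cvg (f z) z) (cvgM cphi (cvgB (@id_cvg z) (@cst_cvg z z))).
rewrite subrr mulr0 addr0 => gf P /gf; apply: filterS2 h => w wz /=.
by have -> : f w = f z + phi w * (w - z) by rewrite -wz addrC subrK.
Qed.

Lemma caradiff_cst a z : caradiff (cst a) z.
Proof.
exists (cst 0); split; first exact: cst_cvg.
by apply: filterE => w; rewrite subrr mul0r.
Qed.

Lemma caradiff_id z : caradiff id z.
Proof.
exists (cst 1); split; first exact: cst_cvg.
by apply: filterE => w; rewrite mul1r.
Qed.

Lemma caradiffD f g z : caradiff f z -> caradiff g z ->
  caradiff (fun w => f w + g w) z.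
Proof.
move=> [p [cp hp]] [q [cq hq]]; exists (fun w => p w + q w); split.
  exact: (cvgD cp cq).
by apply: filterS2 hp hq => w hp hq; rewrite mulrDl -hp -hq; ring.
Qed.

Lemma caradiffM f g z : caradiff f z -> caradiff g z ->
  caradiff (fun w => f w * g w) z.
Proof.
move=> fz gz; have cg := caradiff_continuous gz.
move: fz gz => [p [cp hp]] [q [cq hq]].
exists (fun w => p w * g w + f z * q w); split.
  exact: (cvgD (cvgM cp cg) (cvgM (@cst_cvg (f z) z) cq)).
apply: filterS2 hp hq => w hp hq.
transitivity ((p w * (w - z)) * g w + f z * (q w * (w - z))); last by ring.
by rewrite -hp -hq; ring.
Qed.

Lemma caradiff_affine f a c z : caradiff f (c + a * z) ->
  caradiff (fun w => f (c + a * w)) z.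
Proof.
move=> [p [cp hp]].
have ca : (fun w => c + a * w) @ z --> c + a * z.
  exact: (cvgD (@cst_cvg c z) (cvgM (@cst_cvg a z) (@id_cvg z))).
have cpa : (fun w => p (c + a * w)) @ z --> p (c + a * z).
  by move=> P /cp; exact: ca.
exists (fun w => p (c + a * w) * a); split.
  exact: (cvgM cpa (@cst_cvg a z)).
have : \forall w \near z, f (c + a * w) - f (c + a * z) =
  p (c + a * w) * (c + a * w - (c + a * z)) := ca _ hp.
by apply: filterS => w ->; ring.
Qed.

Lemma caradiff_inv c z : z != c -> caradiff (fun w => (w - c)^-1) z.
Proof.
move=> zc; have zc0 : z - c != 0 by rewrite subr_eq0.
have ct : (fun w => w - c) @ z --> z - c by exact: (cvgB (@id_cvg z) (@cst_cvg c z)).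
have cv : (fun w => (w - c)^-1) @ z --> (z - c)^-1 by exact: (cvgV zc0 ct).
have cm : (fun w => (w - c)^-1 * (z - c)^-1) @ z --> (z - c)^-1 * (z - c)^-1.
  exact: (cvgM cv (@cst_cvg (z - c)^-1 z)).
exists (fun w => - ((w - c)^-1 * (z - c)^-1)); split.
  exact: (cvgN cm).
have : \forall w \near z, w - c != 0 by exact: (cvgr_neq0 _ ct zc0).
by apply: filterS => w wc; field; rewrite ?wc ?zc0.
Qed.

End caratheodory.

Section caratheodory_complex.
Context {R : realType}.
Implicit Types (f : R[i] -> R[i]) (z : R[i]).

Lemma caradiff_cdiffable f z : caradiff f z -> cdiffable f z.
Proof.
move=> [phi [cphi /near_normP[_ /complex_gt0P[d1 d10 ->] h1]]]; exists (phi z) => e e0.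
move/cvgrPdist_lt : cphi => /(_ e%:C); rewrite rc_gt0 => /(_ e0)/near_normP[_ /complex_gt0P[d2 d20 ->] h2].
exists (Num.min d1 d2); first by rewrite lt_min d10.
move=> w; rewrite lt_min -!normc_ltE => /andP[/h1 -> /h2].
rewrite -mulrBl Normc.normcM normc_ltE => /ltW h.
by rewrite ler_wpM2r ?normc_ge0// normcBC.
Qed.

Lemma cdiffable_bounded f z : cdiffable f z ->
  exists C, exists2 del : R, 0 < del &
    forall w, normc (w - z) < del -> normc (f w - f z) <= C * normc (w - z).
Proof.
move=> [d /(_ 1 ltr01)[del del0 h]]; exists (normc d + 1), del => // w /h wz.
have -> : f w - f z = (f w - f z - d * (w - z)) + d * (w - z) by rewrite subrK.
apply: le_trans (normcD _ _) _; rewrite Normc.normcM mulrDl addrC lerD2l.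
by [].
Qed.

End caratheodory_complex.

(** * Vanishing at the centre of a square, and the identity theorem *)

Section identity_theorem.
Context {R : realType}.
Implicit Types (f q Q : R[i] -> R[i]) (c u w z : R[i]).

Let ii : 'i * 'i = -1 :> R[i]. Proof. by rewrite -expr2 sqrCi. Qed.

Let i0 : 'i != 0 :> R[i]. Proof. by rewrite neq0Ci. Qed.

(** On the boundary the difference quotient of [Q] at [c] is $-Q(c)/(z-c)$. Its boundary sum is thus
    [Q c] times a number bounded away from zero, while Goursat makes the sum small. The square is
    cut into four squares with a corner at [c], the shape that [goursat_corner] handles. *)
Lemma eq0_square_center Q c u : u != 0 ->
  (forall k, (k < 4)%N -> forall z, inpar c ('i ^+ k * u) ('i * ('i ^+ k * u)) z ->
    caradiff Q z) ->
  (forall k, (k < 4)%N -> forall s : R, -1 <= s <= 1 ->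
    Q (c + 'i ^+ k * u * (1 +i* s)) = 0) ->
  Q c = 0.
Proof.
move=> u0 dQ bQ; apply/eqP/negP => /negP Qc0.
pose f z := (Q z - Q c) * (z - c)^-1.
have fbd : exists C, exists2 del : R, 0 < del &
    forall z, normc (z - c) < del -> normc (f z) <= C.
  have /caradiff_cdiffable/cdiffable_bounded[C [del del0 hC]] : caradiff Q c.
    by apply: (dQ 0%N) => //; have [] := inpar_corners c ('i ^+ 0 * u) ('i * ('i ^+ 0 * u)).
  exists `|C|, del => // z /hC zC; rewrite /f Normc.normcM Normc.normcV.
  have [->|zc] := eqVneq z c.
    by rewrite !subrr Normc.normc0 mul0r normr_ge0.
  have zc0 : 0 < normc (z - c) by rewrite normc_gt0 subr_eq0.
  by rewrite ler_pdivrMr// (le_trans zC)// ler_wpM2r ?(ltW zc0)// ler_norm.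
have iu k : 'i ^+ k * u != 0 by rewrite mulf_neq0// expf_neq0.
have ev k e : (k < 4)%N -> 0 < e -> evle f c ('i ^+ k * u) ('i * ('i ^+ k * u)) e.
  move=> k4 e0; apply: goursat_corner => // z zk zc.
  apply/caradiff_cdiffable/caradiffM; last exact: caradiff_inv.
  by apply: caradiffD; [exact: dQ zk|exact: caradiff_cst].
have fb k s n t : (k < 4)%N -> -1 <= s -> s <= t -> t <= 1 ->
    midsum n f (c + 'i ^+ k * u * (1 +i* s)) (c + 'i ^+ k * u * (1 +i* t)) =
    - Q c * midsum n (fun z => z^-1) (1 +i* s) (1 +i* t).
  move=> k4 s1 st t1.
  rewrite -(@midsum_scale R n (- Q c) c ('i ^+ k * u))//.
  pose P z := exists2 x : R, -1 <= x <= 1 & z = c + 'i ^+ k * u * (1 +i* x).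
  apply: (@eq_midsum R n _ _ P).
  - move=> _ _ [x x1 ->] [y y1 ->]; exists ((x + y) / 2); first by lra.
    have cE (r : R) : 1 +i* r = 1 + 'i * r%:C :> R[i].
      by rewrite (complexE (1 +i* r)) complexiE.
    by rewrite !cE !rcE; field.
  - by exists s => //; lra.
  - by exists t => //; lra.
  - by move=> _ [x x1 ->]; rewrite /f bQ// sub0r.
(* The outer boundary of one quarter, transported to the line of real part 1: the second half of
   side [k], then the first half of side [k.+1]. *)
pose J n : R[i] := midsum n (fun z => z^-1) (1 +i* 0) (1 +i* 1) +
  midsum n (fun z => z^-1) (1 +i* (-1)) (1 +i* 0).
have J1 n : 1 <= normc (J n).
  have h1 := @Im_midsum_inv R n 0 1; have h2 := @Im_midsum_inv R n (-1) 0.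
  apply: le_trans (ler_abs_Im _); apply: le_trans (ler_norm _).
  rewrite raddfD /=.
  by apply: le_trans (lerD (h1 _ _ _) (h2 _ _ _)); lra.
have e1 : 1 +i* 0 = 1 :> R[i] by [].
have e2 : 1 +i* 1 = 1 + 'i :> R[i] by rewrite (complexE (1 +i* 1)) complexiE mulr1.
have e3 : 1 +i* (-1) = 1 - 'i :> R[i].
  by rewrite (complexE (1 +i* (-1))) complexiE rcN mulrN mulr1.
have psum n k : (k < 4)%N -> (k.+1 %% 4 < 4)%N ->
    parsum n f c ('i ^+ k * u) ('i * ('i ^+ k * u)) =
    - Q c * J n + midsum n f c (c + 'i ^+ k * u) -
      midsum n f c (c + 'i * ('i ^+ k * u)).
  move=> k4 k14; have ik : 'i ^+ (k.+1 %% 4) = 'i * 'i ^+ k :> R[i].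
    rewrite -exprS [in RHS](divn_eq k.+1 4) exprD mulnC exprM.
    by rewrite (_ : 'i ^+ 4 = 1) ?expr1n ?mul1r// (exprM _ 2 2) sqrCi expr2 mulrNN mulr1.
  rewrite /parsum /J mulrDr -(fb k 0 n 1)//; [|by lra..].
  rewrite -(fb (k.+1 %% 4)%N (-1) n 0)//; [|by lra..].
  rewrite e1 e2 e3 ik.
  have -> : c + 'i ^+ k * u * 1 = c + 'i ^+ k * u by rewrite mulr1.
  have -> : c + 'i ^+ k * u * (1 + 'i) = c + 'i ^+ k * u + 'i * ('i ^+ k * u) by ring.
  have -> : c + 'i * 'i ^+ k * u * (1 - 'i) = c + 'i ^+ k * u + 'i * ('i ^+ k * u).
    have -> : 'i * 'i ^+ k * u * (1 - 'i) =
      'i * ('i ^+ k * u) - ('i * 'i) * ('i ^+ k * u) by ring.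
    by rewrite ii; ring.
  have -> : c + 'i * 'i ^+ k * u * 1 = c + 'i * ('i ^+ k * u) by ring.
  by rewrite (midsumN n f c (c + 'i * ('i ^+ k * u))); ring.
have Qc : 0 < normc (Q c) by rewrite normc_gt0.
have h0 : 0 < normc (Q c) / 2 by rewrite divr_gt0.
have [N0 H0] := ev 0%N _ isT h0; have [N1 H1] := ev 1%N _ isT h0.
have [N2 H2] := ev 2%N _ isT h0; have [N3 H3] := ev 3%N _ isT h0.
pose n := (N0 + N1 + N2 + N3)%N.
have le0 : (N0 <= n)%N by rewrite /n -!addnA leq_addr.
have le1 : (N1 <= n)%N by rewrite /n -addnA addnAC leq_addl.
have le2 : (N2 <= n)%N by rewrite /n addnAC leq_addl.
have le3 : (N3 <= n)%N by rewrite /n leq_addl.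
have {}H0 := H0 _ le0; have {}H1 := H1 _ le1.
have {}H2 := H2 _ le2; have {}H3 := H3 _ le3.
move: H0 H1 H2 H3; rewrite !psum// => H0 H1 H2 H3.
have x1 : 'i * ('i ^+ 0 * u) = 'i ^+ 1 * u by rewrite expr0 expr1 mul1r.
have x2 : 'i * ('i ^+ 1 * u) = 'i ^+ 2 * u by rewrite mulrA expr1 expr2.
have x3 : 'i * ('i ^+ 2 * u) = 'i ^+ 3 * u by rewrite mulrA -exprS.
have x4 : 'i * ('i ^+ 3 * u) = 'i ^+ 0 * u.
  by rewrite mulrA -exprS (exprM _ 2 2) sqrCi expr2 mulrNN mulr1 expr0.
move: H0 H1 H2 H3; rewrite x1 x2 x3 x4.
set E0 := midsum n f c (c + 'i ^+ 0 * u); set E1 := midsum n f c (c + 'i ^+ 1 * u).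
set E2 := midsum n f c (c + 'i ^+ 2 * u); set E3 := midsum n f c (c + 'i ^+ 3 * u).
set T := - Q c * J n => H0 H1 H2 H3.
(* The sums along the four spokes from [c] cancel cyclically. Four quarters, each at most half of
   [normc (Q c)], contradict [J1]. *)
have T4 : normc (4%:R * T) <= normc (Q c) * 2.
  have -> : 4%:R * T = (T + E0 - E1) + (T + E1 - E2) + (T + E2 - E3) + (T + E3 - E0) by ring.
  have t1 := normcD (T + E0 - E1) (T + E1 - E2).
  have t2 := normcD (T + E0 - E1 + (T + E1 - E2)) (T + E2 - E3).
  have t3 := normcD (T + E0 - E1 + (T + E1 - E2) + (T + E2 - E3)) (T + E3 - E0).
  lra.
have n4 : normc (4%:R : R[i]) = 4.
  by rewrite (_ : 4%:R = (4%:R : R)%:C) ?normc_real ?ger0_norm// rmorph_nat.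
move: T4; rewrite Normc.normcM n4 /T Normc.normcM normcN.
have := J1 n; have := normc_ge0 (Q c).
by nra.
Qed.

(** For [c] off the real axis, take the square centred at [c] with one side on that axis. The
    product of the four rotates of [q] about [c] vanishes on all four sides and equals [q c ^+ 4] at
    the centre. The quarter radius keeps the square inside the disk of radius [r]. *)
Theorem eq0_on_real_segment q (r : R) : 0 < r ->
  (forall z, normc z < r -> caradiff q z) ->
  (forall t : R, `|t| < r -> q t%:C = 0) ->
  forall z, normc z < r / 4 -> q z = 0.
Proof.
move=> r0 dq q0 [x y]; set c := x +i* y => cr.
have cE : c = x%:C + 'i * y%:C by rewrite (complexE c) complexiE.
have xr : `|x| < r / 4 by apply: le_lt_trans cr; exact: (ler_abs_Re c).
have yr : `|y| < r / 4 by apply: le_lt_trans cr; exact: (ler_abs_Im c).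
have [y0|y0] := eqVneq y 0.
  by rewrite cE y0 rc0 mulr0 addr0 q0//; lra.
(* This [u] points from [c] straight to the real axis, so the side [c + u * (1 +i* s)] is real. *)
have [u uE] : exists u, u = - 'i * y%:C by exists (- 'i * y%:C).
have u0 : u != 0 by rewrite uE mulf_neq0 ?oppr_eq0// -normc_gt0 normc_real normr_gt0.
pose Q z := q z * q (c + 'i * (z - c)) * q (c - (z - c)) * q (c - 'i * (z - c)).
have nu : normc u = `|y| by rewrite uE Normc.normcM normcN normc_i mul1r normc_real.
have inr k a b : `|a| <= 1 -> `|b| <= 1 ->
    normc (c + 'i ^+ k * u * (a +i* b)) < r.
  move=> a1 b1; apply: le_lt_trans (normcD _ _) _.
  rewrite !Normc.normcM normcX normc_i expr1n mul1r nu.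
  have := normc_leD (a +i* b); rewrite /= => ab.
  have h : `|y| * Num.sqrt (a ^+ 2 + b ^+ 2) <= `|y| * 2.
    by rewrite ler_wpM2l// (le_trans ab)//; lra.
  apply: (@lt_le_trans _ _ (r / 4 + `|y| * 2)); last by lra.
  by rewrite ltr_leD.
suff /eqP : Q c = 0.
  by rewrite /Q !subrr !mulr0 !subr0 !addr0 !mulf_eq0 -!orbA !orbb => /eqP.
apply: (eq0_square_center u0) => k k4.
  move=> z [a [b [a01 b01 zE]]].
  have zc : z - c = 'i ^+ k * u * (a +i* b).
    rewrite zE (complexE (a +i* b)) complexiE /=; ring.
  have dqk j : caradiff q (c + 'i ^+ j * (z - c)).
    by apply: dq; rewrite zc !mulrA -exprD; apply: inr; rewrite ger0_norm; lra.
  have af j : caradiff (fun w => q (c + 'i ^+ j * (w - c))) z.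
    have -> : (fun w => q (c + 'i ^+ j * (w - c))) =
        (fun w => q (c - 'i ^+ j * c + 'i ^+ j * w)).
      by apply/funext => w; congr q; ring.
    by apply: caradiff_affine; move: (dqk j); congr caradiff; ring.
  have n2 : 'i ^+ 2 = -1 :> R[i] by rewrite sqrCi.
  have n3 : 'i ^+ 3 = - 'i :> R[i] by rewrite exprSr sqrCi mulN1r.
  have -> : Q = (fun w => q (c + 'i ^+ 0 * (w - c)) * q (c + 'i ^+ 1 * (w - c)) *
     q (c + 'i ^+ 2 * (w - c)) * q (c + 'i ^+ 3 * (w - c))).
    apply/funext => w; rewrite /Q expr0 expr1 n2 n3 mul1r mulN1r mulNr.
    by rewrite [c + (w - c)]addrC subrK.
  by do 3! (apply: caradiffM; last exact: af); exact: af.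
move=> s s1; rewrite /Q.
have real_edge : q (c + u * (1 +i* s)) = 0.
  have -> : c + u * (1 +i* s) = (x + y * s)%:C.
    rewrite cE uE (complexE (1 +i* s)) complexiE /= !rcE.
    have -> : x%:C + 'i * y%:C + - 'i * y%:C * (1 + 'i * s%:C) =
       x%:C - ('i * 'i) * (y%:C * s%:C) by ring.
    by rewrite ii; ring.
  apply: q0; apply: le_lt_trans (ler_normD _ _) _; rewrite normrM.
  have : `|y| * `|s| <= `|y| * 1 by rewrite ler_wpM2l// ler_norml.
  by lra.
have i2 : 'i ^+ 2 = -1 :> R[i] by rewrite sqrCi.
have i3 : 'i ^+ 3 = - 'i :> R[i] by rewrite exprSr sqrCi mulN1r.
set v := u * (1 +i* s).
have kE : c + 'i ^+ k * u * (1 +i* s) - c = 'i ^+ k * v by rewrite /v; ring.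
rewrite kE; case: k k4 kE => [|[|[|[|//]]]] _ _.
- by rewrite expr0 mul1r real_edge !mul0r.
- rewrite expr1 mulrA ii.
  rewrite [X in _ * q X](_ : _ = c + v) ?real_edge ?mulr0//.
  by ring.
- rewrite i2 [X in _ * q X * _](_ : _ = c + v) ?real_edge ?mulr0 ?mul0r//.
  by ring.
- rewrite i3 [X in _ * q X * _ * _](_ : _ = c + v) ?real_edge ?mulr0 ?mul0r//.
  have -> : 'i * (- 'i * v) = - ('i * 'i) * v by ring.
  by rewrite ii; ring.
Qed.

End identity_theorem.

(** * Bounded operators on L2 *)

Section real_norm.
Context {R : realType} {V : normedModType R[i]}.
Implicit Types (x y : V) (c : R[i]).

(** Norms over [R[i]] take values in [R[i]]; the real version lets order arguments run in the
    ordered field [R]. *)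
Definition nm x : R := Re `|x|.

Lemma norm_nm x : `|x| = (nm x)%:C.
Proof. by rewrite /nm RRe_real// normr_real. Qed.

Lemma nm_ge0 x : 0 <= nm x.
Proof. by rewrite -lecR -norm_nm normr_ge0. Qed.

Lemma nm_lt x (e : R) : (`|x| < e%:C) = (nm x < e).
Proof. by rewrite norm_nm ltcR. Qed.

Lemma nm_le x (e : R) : (`|x| <= e%:C) = (nm x <= e).
Proof. by rewrite norm_nm lecR. Qed.

Lemma nmD x y : nm (x + y) <= nm x + nm y.
Proof. by rewrite -nm_le rcD -!norm_nm ler_normD. Qed.

Lemma nmZ c x : nm (c *: x) = normc c * nm x.
Proof. by apply: complexI; rewrite rmorphM /= -!norm_nm normrZ norm_normc. Qed.

Lemma nm0 : nm 0 = 0.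
Proof. by rewrite /nm normr0. Qed.

Lemma nm0_eq0 x : nm x = 0 -> x = 0.
Proof. by move=> x0; apply: normr0_eq0; rewrite norm_nm x0. Qed.

Lemma nmN x : nm (- x) = nm x.
Proof. by rewrite /nm normrN. Qed.

Lemma nmB x y : nm (x - y) <= nm x + nm y.
Proof. by rewrite -(nmN y) nmD. Qed.

Lemma nmBC x y : nm (x - y) = nm (y - x).
Proof. by rewrite -nmN opprB. Qed.

End real_norm.

#[global] Opaque nm.

Section bop_algebra.
Context {R : realType} {V : normedModType R[i]}.
Implicit Types (S T U : bop V) (x : V) (c : R[i]).

Lemma bopM S T x : (S * T) x = S (T x). Proof. by []. Qed.
Lemma bopD S T x : (S + T) x = S x + T x. Proof. by []. Qed.
Lemma bopN S x : (- S) x = - S x. Proof. by []. Qed.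
Lemma bopB S T x : (S - T) x = S x - T x. Proof. by []. Qed.
Lemma bopZ c S x : (c *: S) x = c *: S x. Proof. by []. Qed.
Lemma bop1 x : (1 : bop V) x = x. Proof. by []. Qed.
Lemma bop0 x : (0 : bop V) x = 0. Proof. by []. Qed.
Definition bopE := (bopM, bopB, bopD, bopN, bopZ, bop1, bop0).

Lemma bopZAl c S T : (c *: S) * T = c *: (S * T).
Proof. by apply/bopP. Qed.

Lemma bopZAr c S T : S * (c *: T) = c *: (S * T).
Proof. by apply/bopP => x; rewrite !bopE linearZ. Qed.

Lemma nm_bop T x : nm (T x) <= nm T * nm x.
Proof. by rewrite -nm_le rcM -!norm_nm; exact: ler_opnorm. Qed.

Lemma nm_bop_le T (C : R) : 0 <= C -> (forall x, nm (T x) <= C * nm x) -> nm T <= C.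
Proof.
move=> C0 TC; rewrite -nm_le; apply: opnorm_le => x.
rewrite (nm_le x 1) nm_le => x1; apply: le_trans (TC x) _.
by rewrite -[leRHS]mulr1 ler_wpM2l.
Qed.

Lemma nm_bopM S T : nm (S * T) <= nm S * nm T.
Proof.
apply: nm_bop_le => [|x]; first by rewrite mulr_ge0 ?nm_ge0.
rewrite bopM; apply: le_trans (nm_bop _ _) _.
by rewrite -mulrA ler_wpM2l ?nm_ge0 ?nm_bop.
Qed.

End bop_algebra.

(** * Lyapunov inequality and uniqueness for the Sylvester equation *)

Section L2_forms.
Context d (T : measurableType d) (R : realType).
Variable mu : {measure set T -> \bar R}.
Local Notation V := (L2 mu).
Implicit Types (f g h : V) (c : R[i]) (A X : bop V).
Local Notation "(: f , g :)" := (L2dot f g).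

Lemma L2dotC f g : (: f, g :) = (: g, f :)^*.
Proof. exact: L2dot_conj. Qed.

Lemma L2dotNl f g : (: - f, g :) = - (: f, g :).
Proof. by rewrite -scaleN1r L2dotZl mulN1r. Qed.

Lemma L2dotNr f g : (: f, - g :) = - (: f, g :).
Proof. by rewrite -scaleN1r L2dotZr rmorphN rmorph1 mulN1r. Qed.

Lemma L2dotBl f g h : (: f - g, h :) = (: f, h :) - (: g, h :).
Proof. by rewrite L2dotDl L2dotNl. Qed.

Lemma L2dotBr f g h : (: h, f - g :) = (: h, f :) - (: h, g :).
Proof. by rewrite L2dotDr L2dotNr. Qed.

Lemma L2dotff_nm f : (: f, f :) = (nm f ^+ 2)%:C.
Proof. by rewrite rmorphXn /= -norm_nm L2normE sqrtCK. Qed.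

Lemma L2dot_le f g : normc (: f, g :) <= nm f * nm g.
Proof.
rewrite -normc_leE -ler_sqr ?nnegrE// ?ler0c ?mulr_ge0 ?nm_ge0//.
rewrite rcM exprMn -(rcX (nm f)) -(rcX (nm g)) -!L2dotff_nm.
exact: L2_CauchySchwarz.
Qed.

Lemma L2dot_eq0_all f : (forall h, (: f, h :) = 0) -> f = 0.
Proof. by move=> /(_ f)/L2dot_eq0. Qed.

Definition symmetric_bop A := forall f g, (: A f, g :) = (: f, A g :).

Lemma symmetric_Im A f : symmetric_bop A -> Im (: f, A f :) = 0.
Proof.
move=> sA; have := L2dotC f (A f); rewrite sA.
by case: (: f, A f :) => a b [] /=; lra.
Qed.

(* The form z solves a Lyapunov inequality for the dissipative i A - eps / 2;
   at an approximate minimiser f of Re z on the unit sphere, z f (A f) is nearly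
   a multiple of the real number (f, A f), so the inequality makes the minimum
   nonnegative. *)
Lemma lyapunov_ge0 (z : V -> V -> R[i]) A (eps N : R) :
  (forall f g h, z (f + g) h = z f h + z g h) ->
  (forall c f g, z (c *: f) g = c * z f g) ->
  (forall f g, z f g = (z g f)^*) ->
  (forall f, `|Re (z f f)| <= N * nm f ^+ 2) ->
  symmetric_bop A -> 0 < eps ->
  (forall f, 0 <= eps * Re (z f f) + 2 * Im (z f (A f))) ->
  forall f, 0 <= Re (z f f).
Proof.
move=> zD zZ zJ zN sA eps0 lyap.
have zDr f g h : z h (f + g) = z h f + z h g.
  by rewrite zJ zD rmorphD /= -!zJ.
have zZr c f g : z f (c *: g) = c^* * z f g.
  by rewrite zJ zZ rmorphM /= -!zJ.
have expand (B : V -> V -> R[i]) (s : R) f g :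
    (forall f g h, B (f + g) h = B f h + B g h) ->
    (forall c f g, B (c *: f) g = c * B f g) ->
    (forall f g, B f g = (B g f)^*) ->
    (forall f g h, B h (f + g) = B h f + B h g) ->
    (forall c f g, B f (c *: g) = c^* * B f g) ->
    Re (B (f + (0 -i* s) *: g) (f + (0 -i* s) *: g)) =
    Re (B f f) - 2 * s * Im (B f g) + s ^+ 2 * Re (B g g).
  move=> BD BZ BJ BDr BZr; rewrite BD !BDr !BZ !BZr (BJ g f).
  by case: (B f f) (B f g) (B g g) => [a a'] [b b'] [e e'] /=; ring.
pose S := [set m : R | 0 <= m /\ forall f, 0 <= Re (z f f) + m * nm f ^+ 2].
have SN : S `|N|.
  split=> // f; have := zN f; rewrite ler_norml => /andP[h _].
  have : N * nm f ^+ 2 <= `|N| * nm f ^+ 2 by rewrite ler_wpM2r ?sqr_ge0// ler_norm.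
  by lra.
have hS : has_inf S by split; [exists (`|N|) | exists 0 => m []].
pose m := inf S.
have m0 : 0 <= m by apply: lb_le_inf; [case: hS|move=> ? []].
have Sm : S m.
  split=> // f; have [f0|f0] := eqVneq (nm f) 0.
    by have [_ /(_ f)] := SN; rewrite f0 expr0n !mulr0.
  have f2 : 0 < nm f ^+ 2 by rewrite exprn_gt0// lt_neqAle eq_sym f0 nm_ge0.
  suff : - Re (z f f) / nm f ^+ 2 <= m by rewrite ler_pdivrMr//; lra.
  apply: lb_le_inf; first by case: hS.
  by move=> k [k0 /(_ f) kf]; rewrite ler_pdivrMr//; lra.
pose C := (`|N| + m) * nm A ^+ 2.
have C0 : 0 <= C by rewrite mulr_ge0 ?addr_ge0 ?sqr_ge0.
(* Moving [f] by [- i s A f], an Euler step of the flow of [A], changes the squared norm only at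
   order [s ^+ 2] because [(f, A f)] is real, while the hypothesis gains the factor [1 + eps * s].
   For small [s] this beats the minimal [m] unless [m = 0]. *)
have step (s : R) : 0 < s -> m <= (m + s ^+ 2 * C) / (1 + eps * s).
  move=> s0; have es0 : 0 < 1 + eps * s by rewrite ltr_wpDr ?ltr01// mulr_ge0// ltW.
  apply: ge_inf; first by exists 0 => ? [].
  split=> [|f]; first by rewrite divr_ge0 ?(ltW es0)// addr_ge0// mulr_ge0 ?sqr_ge0.
  have [_ /(_ (f + (0 -i* s) *: A f))] := Sm.
  rewrite expand//.
  have -> : nm (f + (0 -i* s) *: A f) ^+ 2 = nm f ^+ 2 + s ^+ 2 * nm (A f) ^+ 2.
    apply: complexI; rewrite -L2dotff_nm.
    have -> : (: f + (0 -i* s) *: A f, f + (0 -i* s) *: A f :) =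
      (Re (: f + (0 -i* s) *: A f, f + (0 -i* s) *: A f :))%:C.
      by rewrite L2dotff_nm.
    rewrite (expand (@L2dot _ _ _ mu)).
    - by rewrite symmetric_Im// !L2dotff_nm mulr0 subr0.
    - exact: L2dotDl.
    - exact: L2dotZl.
    - exact: L2dotC.
    - exact: L2dotDr.
    - exact: L2dotZr.
  have := lyap f; set q := Re (z f f); set i := Im _ => h1 h2.
  have h3 : Re (z (A f) (A f)) + m * nm (A f) ^+ 2 <= C * nm f ^+ 2.
    have : Re (z (A f) (A f)) <= `|N| * nm (A f) ^+ 2.
      apply: le_trans (ler_norm _) _; apply: le_trans (zN _) _.
      by rewrite ler_wpM2r ?sqr_ge0// ler_norm.
    have : (`|N| + m) * nm (A f) ^+ 2 <= C * nm f ^+ 2.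
      rewrite /C -mulrA ler_wpM2l ?addr_ge0// -exprMn.
      by rewrite ler_sqr ?nnegrE ?mulr_ge0 ?nm_ge0// nm_bop.
    by rewrite mulrDl; lra.
  have h4 : s ^+ 2 * (Re (z (A f) (A f)) + m * nm (A f) ^+ 2) <= s ^+ 2 * (C * nm f ^+ 2).
    by rewrite ler_wpM2l ?sqr_ge0.
  have h5 : 0 <= s * (eps * q + 2 * i) by rewrite mulr_ge0// ltW.
  have h6 : 0 <= q * (1 + eps * s) + (m + s ^+ 2 * C) * nm f ^+ 2 by nra.
  rewrite -(pmulr_lge0 _ es0) mulrDl.
  rewrite -mulrA [X in _ + X](_ : _ = (m + s ^+ 2 * C) * nm f ^+ 2)//.
  by field; rewrite gt_eqF.
suff : m <= 0.
  move=> mle0 f; have [_ /(_ f)] := Sm.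
  by rewrite (_ : m = 0) ?mul0r ?addr0//; apply/eqP; rewrite eq_le mle0.
rewrite leNgt; apply/negP => mgt0.
(* Small enough that [s * C < m * eps]; the denominator has [C + 1] because [C] may vanish. *)
pose s := m * eps / (2 * (C + 1)).
have C1 : 0 < C + 1 by lra.
have s0 : 0 < s by rewrite divr_gt0 ?mulr_gt0.
have := step _ s0; rewrite ler_pdivlMr; last first.
  by rewrite ltr_wpDr ?ltr01// mulr_ge0// ltW.
move=> h1; have h2 : s * C < m * eps.
  rewrite /s mulrAC ltr_pdivrMr ?mulr_gt0// ltr_pM2l ?mulr_gt0//; lra.
have : s * (s * C) < s * (m * eps) by rewrite ltr_pM2l.
by lra.
Qed.

(** The hermitian part of [s X] satisfies the Lyapunov inequality, with equality, for every scalar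
    [s]. The four choices [1], [-1], [i], [-i] annihilate [(X f, f)], and polarization does the
    rest. *)
Lemma sylvester_eq0 X A (eps : R) : symmetric_bop A -> 0 < eps ->
  X * A - A * X = ('i * eps%:C) *: X -> X = 0.
Proof.
move=> sA eps0 XA.
have XAE f : X (A f) = A (X f) + ('i * eps%:C) *: X f.
  by rewrite -bopM -[X * A](subrK (A * X)) XA !bopE addrC.
pose z (s : R[i]) f g := s * (: X f, g :) + s^* * (: f, X g :).
have zff (s : R[i]) f : z s f f = s * (: X f, f :) + (s * (: X f, f :))^*.
  by rewrite /z (L2dotC f) rmorphM.
have zge (s : R[i]) f : 0 <= Re (z s f f).
  apply: (@lyapunov_ge0 (z s) A eps (2 * normc s * nm X)) => //.
  - by move=> f1 g h; rewrite /z linearD !L2dotDl; ring.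
  - by move=> c f1 g; rewrite /z linearZ !L2dotZl; ring.
  - move=> f1 g; rewrite /z (L2dotC (X f1)) (L2dotC f1).
    by case: s (: g, X f1 :) (: X g, f1 :) => [? ?] [? ?] [? ?] /=; congr (_ +i* _); ring.
  - move=> f1; apply: le_trans (ler_abs_Re _) _; apply: le_trans (normcD _ _) _.
    rewrite !Normc.normcM normc_conj (L2dotC f1) normc_conj.
    have := L2dot_le (X f1) f1; have := nm_bop X f1; have := nm_ge0 f1.
    have := normc_ge0 s => s0 n0 n1 n2.
    have : normc s * normc (: X f1, f1 :) <= normc s * (nm X * nm f1 ^+ 2).
      rewrite ler_wpM2l// (le_trans n2)// expr2 mulrA ler_wpM2r//.
    by rewrite -!mulrA; lra.
  - move=> f1; rewrite zff /z XAE L2dotDr L2dotZr.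
    rewrite (L2dotC f1 (A (X f1))) sA (L2dotC f1 (X f1)).
    case: s (: X f1, f1 :) (: X f1, A f1 :) => [s s'] [t t'] [a a'].
    by rewrite -!complexiE /=; lra.
have t0 f : (: X f, f :) = 0.
  have h1 := zge 1 f; have h2 := zge (-1) f; have h3 := zge 'i f; have h4 := zge (-'i) f.
  move: h1 h2 h3 h4; rewrite !zff; case: (: X f, f :) => a b.
  rewrite -!complexiE /= => h1 h2 h3 h4.
  by congr (_ +i* _); lra.
have p0 f h : (: X f, h :) = 0.
  have h1 := t0 (f + h); have h2 := t0 (f + 'i *: h).
  move: h1 h2; rewrite !linearD !linearZ /= !L2dotDl !L2dotDr !L2dotZl !L2dotZr !t0.
  rewrite !mulr0 !addr0 !add0r.
  case: (: X f, h :) (: X h, f :) => [a b] [a' b'].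
  rewrite -!complexiE /= => -[h1 h1'] [h2 h2'].
  by congr (_ +i* _); lra.
by apply/bopP => f; apply: L2dot_eq0_all => h; exact: p0.
Qed.

End L2_forms.

(** * Dominated functions and completeness (Riesz-Fischer) *)

Section L2_estimates.
Context d (T : measurableType d) (R : realType).
Variable mu : {measure set T -> \bar R}.
Local Notation V := (L2 mu).
Implicit Types (f g h F : V) (u phi psi : T -> R[i]).

Lemma cmeasurable_normc2 u : cmeasurable u ->
  measurable_fun setT (fun x => (normc (u x) ^+ 2)%:E).
Proof.
move=> [m1 m2]; apply/measurable_EFinP.
apply: (@eq_measurable_fun _ _ _ _ _ (fun x => Re (u x) ^+ 2 + Im (u x) ^+ 2)).
  by move=> x _; rewrite sqr_normcE.
by apply: measurable_funD; exact: measurable_funX.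
Qed.

Lemma cmeasurableD u v : cmeasurable u -> cmeasurable v ->
  cmeasurable (fun x => u x + v x).
Proof.
move=> [u1 u2] [v1 v2]; split.
  rewrite (_ : (fun x => _) = (fun x => Re (u x) + Re (v x))); first exact: measurable_funD.
  by apply/funext => x; rewrite raddfD.
rewrite (_ : (fun x => _) = (fun x => Im (u x) + Im (v x))); first exact: measurable_funD.
by apply/funext => x; rewrite raddfD.
Qed.

Lemma cmeasurableN u : cmeasurable u -> cmeasurable (fun x => - u x).
Proof.
move=> [u1 u2]; split.
  rewrite (_ : (fun x => _) = (fun x => - Re (u x))).
    by apply: measurableT_comp.
  by apply/funext => x; rewrite raddfN.
rewrite (_ : (fun x => _) = (fun x => - Im (u x))).
  by apply: measurableT_comp.
by apply/funext => x; rewrite raddfN.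
Qed.

Lemma cmeasurableB u v : cmeasurable u -> cmeasurable v ->
  cmeasurable (fun x => u x - v x).
Proof. by move=> mu_ mv; apply: cmeasurableD => //; exact: cmeasurableN. Qed.

Lemma cmeasurableM u v : cmeasurable u -> cmeasurable v ->
  cmeasurable (fun x => u x * v x).
Proof.
move=> [u1 u2] [v1 v2]; split.
  rewrite (_ : (fun x => _) = (fun x => Re (u x) * Re (v x) - Im (u x) * Im (v x))).
    by apply: measurable_funB; exact: measurable_funM.
  by apply/funext => x; case: (u x) (v x) => [? ?] [? ?].
rewrite (_ : (fun x => _) = (fun x => Re (u x) * Im (v x) + Im (u x) * Re (v x))).
  by apply: measurable_funD; exact: measurable_funM.
by apply/funext => x; case: (u x) (v x) => [? ?] [? ?].
Qed.

Lemma cmeasurable_L2 f : cmeasurable f. Proof. by case: (L2funP f). Qed.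

Lemma L2_int_fin f : (\int[mu]_x (normc (f x) ^+ 2)%:E)%E \is a fin_num.
Proof.
rewrite ge0_fin_numE; first by case: (L2funP f).
by apply: integral_ge0 => x _; rewrite lee_fin sqr_ge0.
Qed.

Lemma nm_sqr_int f : (nm f ^+ 2)%:E = (\int[mu]_x (normc (f x) ^+ 2)%:E)%E.
Proof.
rewrite -[RHS](fineK (L2_int_fin f)); congr EFin.
by apply: complexI; rewrite -L2dotff_nm L2dotff.
Qed.

Lemma nm_sqr_le_int f u : cmeasurable u ->
  (\forall x \ae mu, normc (f x) <= normc (u x)) ->
  ((nm f ^+ 2)%:E <= \int[mu]_x (normc (u x) ^+ 2)%:E)%E.
Proof.
move=> mu_ fu; rewrite nm_sqr_int; apply: ae_ge0_le_integral => //.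
- by move=> x _; rewrite lee_fin sqr_ge0.
- exact/cmeasurable_normc2/cmeasurable_L2.
- by move=> x _; rewrite lee_fin sqr_ge0.
- exact: cmeasurable_normc2.
- apply: filterS fu => x fu _.
  by rewrite lee_fin ler_sqr ?nnegrE ?normc_ge0.
Qed.

Lemma L2class_bounded f u (C : R) : cmeasurable u ->
  (\forall x \ae mu, normc (u x) <= C * normc (f x)) -> 0 <= C ->
  sqintegrable mu u /\ nm (L2class mu u) <= C * nm f.
Proof.
move=> mu_ uf C0.
have mf := cmeasurable_L2 f.
have h : (\int[mu]_x (normc (u x) ^+ 2)%:E <= ((C * nm f) ^+ 2)%:E)%E.
  rewrite exprMn EFinM nm_sqr_int -ge0_integralZl//; first last.
  - by rewrite lee_fin sqr_ge0.
  - by move=> x _; rewrite lee_fin sqr_ge0.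
  - exact: cmeasurable_normc2.
  apply: ae_ge0_le_integral => //.
  - by move=> x _; rewrite lee_fin sqr_ge0.
  - exact: cmeasurable_normc2.
  - by move=> x _; rewrite -EFinM lee_fin mulr_ge0 ?sqr_ge0.
  - by apply: measurable_funeM; exact: cmeasurable_normc2.
  - apply: filterS uf => x uf _; rewrite -EFinM lee_fin -exprMn.
    by rewrite ler_sqr ?nnegrE ?mulr_ge0 ?normc_ge0.
have su : sqintegrable mu u by split=> //; exact: le_lt_trans h (ltry _).
split=> //.
rewrite -ler_sqr ?nnegrE ?mulr_ge0 ?nm_ge0// -lee_fin.
apply: le_trans h; apply: nm_sqr_le_int => //.
by apply: filterS (L2classE su) => x ->.
Qed.

Lemma nm_le_ae f g (C : R) : 0 <= C ->
  (\forall x \ae mu, normc (f x) <= C * normc (g x)) -> nm f <= C * nm g.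
Proof.
move=> C0 fg; have [_] := L2class_bounded (cmeasurable_L2 f) fg C0.
suff -> : L2class mu f = f by [].
apply/L2_eqP; apply: filterS (L2classE (L2funP f)) => x //.
Qed.

Lemma L2_subE f g : \forall x \ae mu, (f - g : V) x = f x - g x.
Proof. by apply: filterS2 (L2_addE f (- g)) (L2_oppE g) => x /= -> ->. Qed.

Let q n : R := 4^-1 ^+ n.

Lemma L2_complete (u : nat -> V) : (forall n, nm (u n.+1 - u n) <= 4^-1 ^+ n) ->
  exists F : V, forall n, nm (F - u n) <= 2 * 4^-1 ^+ n.
Proof.
move=> hu.
have q0 n : 0 < q n by rewrite exprn_gt0// invr_gt0.
have qS n : q n.+1 = q n / 4 by rewrite /q exprSr.
have tail n k : nm (u (n + k)%N - u n) <= 2 * q n.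
  suff : nm (u (n + k)%N - u n) <= 2 * (q n - q (n + k)%N).
    by have := q0 (n + k)%N; lra.
  elim: k => [|k IH]; first by rewrite addn0 !subrr nm0 mulr0.
  have -> : u (n + k.+1)%N - u n = (u (n + k).+1 - u (n + k)%N) + (u (n + k)%N - u n).
    by rewrite addnS addrA subrK.
  apply: le_trans (nmD _ _) _; rewrite addnS qS.
  have := hu (n + k)%N; rewrite -/(q _); have := q0 (n + k)%N.
  by move: IH; lra.
pose D n x : R[i] := u n.+1 x - u n x.
have mD n : cmeasurable (D n) by apply: cmeasurableB; exact: cmeasurable_L2.
(* The weight lies between two rates: the squared increments integrate to at most $16^{-n}$, so the
   weighted series is integrable, and where its sum is finite the increments decay like $2^{-n}$. *)
pose h n x : \bar R := (4 ^+ n * normc (D n x) ^+ 2)%:E.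
have mh n : measurable_fun setT (h n).
  apply: (@eq_measurable_fun _ _ _ _ _ (fun x => (4 ^+ n)%:E * (normc (D n x) ^+ 2)%:E)%E).
    by move=> x _; rewrite /h EFinM.
  by apply: measurable_funeM; exact: cmeasurable_normc2.
have h0 n x : (0 <= h n x)%E by rewrite /h lee_fin; apply: mulr_ge0; [exact: exprn_ge0|exact: sqr_ge0].
have ih n : (\int[mu]_x h n x <= (q n)%:E)%E.
  have -> : (\int[mu]_x h n x = (4 ^+ n)%:E * \int[mu]_x (normc (D n x) ^+ 2)%:E)%E.
    rewrite -ge0_integralZl//; first last.
    - by move=> x _; rewrite lee_fin sqr_ge0.
    - exact: cmeasurable_normc2.
  have -> : (\int[mu]_x (normc (D n x) ^+ 2)%:E = (nm (u n.+1 - u n) ^+ 2)%:E)%E.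
    rewrite nm_sqr_int; apply: ae_eq_integral => //.
    - exact: cmeasurable_normc2.
    - exact/cmeasurable_normc2/cmeasurable_L2.
    - by apply: filterS (L2_subE (u n.+1) (u n)) => x -> _.
  rewrite -EFinM lee_fin.
  have := hu n; have := nm_ge0 (u n.+1 - u n); rewrite -/(q n) => n0 nq.
  have -> : q n = 4 ^+ n * q n ^+ 2.
    by rewrite /q expr2 mulrA -exprMn mulfV ?expr1n ?mul1r.
  by rewrite ler_wpM2l ?exprn_ge0// ler_sqr ?nnegrE// ltW.
pose H x := (\sum_(n <oo) h n x)%E.
have mH : measurable_fun setT H by apply: ge0_emeasurable_sum.
have iH : (\int[mu]_x H x <= (4 / 3)%:E)%E.
  rewrite integral_nneseries//.
  apply: (@le_trans _ _ (\sum_(n <oo) (q n)%:E)%E).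
    by apply: lee_nneseries => [n _ _|n _]; [apply: integral_ge0 => x _; exact: h0|exact: ih].
  apply: lime_le.
    by apply: is_cvg_nneseries => n _ _; rewrite lee_fin ltW.
  apply: nearW => n; rewrite sumEFin lee_fin big_mkord.
  suff -> : \sum_(i < n) q i = 4 / 3 * (1 - q n) by have := q0 n; lra.
  elim: n => [|n IH]; first by rewrite big_ord0 /q expr0 subrr mulr0.
  by rewrite big_ord_recr /= IH qS; field.
have : mu.-integrable setT H.
  apply/integrableP; split => //; apply: le_lt_trans (ltry (4 / 3)).
  apply: le_trans iH; rewrite le_eqVlt; apply/orP; left; apply/eqP.
  by apply: eq_integral => x _; rewrite gee0_abs// nneseries_ge0.
move=> /(integrable_ae measurableT)[N [mN N0 NH]].
have HN x : ~ N x -> exists C : R, forall n, normc (D n x) <= C * 2^-1 ^+ n.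
  move=> Nx; have Hfin : H x \is a fin_num.
    by apply: contrapT => nH; apply: Nx; apply: NH => /= /(_ I).
  exists (Num.sqrt (fine (H x))) => n.
  have hn : (h n x <= H x)%E.
    apply: le_trans (nneseries_lim_ge n.+1 _); last by [].
    by rewrite big_nat_recr//= leeDr// sume_ge0.
  have H0 : 0 <= fine (H x) by rewrite fine_ge0// nneseries_ge0.
  rewrite -ler_sqr ?nnegrE ?normc_ge0 ?mulr_ge0 ?sqrtr_ge0 ?exprn_ge0 ?invr_ge0//.
  have -> : (Num.sqrt (fine (H x)) * 2^-1 ^+ n) ^+ 2 = fine (H x) * 4^-1 ^+ n.
    rewrite exprMn sqr_sqrtr// -exprM mulnC exprM.
    by congr (_ * _ ^+ n); field.
  have hq : 4 ^+ n * normc (D n x) ^+ 2 <= fine (H x) by rewrite -lee_fin fineK.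
  have -> : normc (D n x) ^+ 2 = 4 ^+ n * normc (D n x) ^+ 2 * 4^-1 ^+ n.
    by rewrite mulrAC -exprMn mulfV ?expr1n ?mul1r.
  by rewrite ler_wpM2r ?exprn_ge0 ?invr_ge0.
(* Resetting the values on the exceptional null set makes the limit exist at every point, so that it
   is measurable as a pointwise limit. *)
pose v n x : R[i] := if x \in N then 0 else u n x.
have cv x : exists l : R[i], (fun n => Re (v n x)) @ \oo --> Re l /\
    (fun n => Im (v n x)) @ \oo --> Im l.
  have [xN|/negP xN] := boolP (x \in N).
    by exists 0; split; rewrite /v xN; exact: cvg_cst.
  have [C CD] := HN x (fun Nx => xN (mem_set Nx)).
  have vE n : v n x = u n x by rewrite /v; case: ifP.
  have cvg (w : R^nat) : (forall n, `|w n.+1 - w n| <= C * 2^-1 ^+ n) -> cvgn w.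
    move=> wC.
    have C0 : 0 <= C by have := wC 0%N; rewrite expr0 mulr1; exact: le_trans.
    have : cvgn (series (fun n => w n.+1 - w n)).
      apply: normed_cvg; apply: (@series_le_cvg R _ (geometric C 2^-1)) => //.
      - by move=> n; exact: normr_ge0.
      - by move=> n; rewrite /geometric /=; apply: mulr_ge0 => //; rewrite exprn_ge0 ?invr_ge0.
      - by apply: is_cvg_geometric_series; rewrite ger0_norm ?invr_ge0//; lra.
    move=> cs; have -> : w = (fun n => w 0%N + series (fun n => w n.+1 - w n) n).
      by apply/funext => n; rewrite /series /= telescope_sumr// addrC subrK.
    by apply: is_cvgD => //; exact: is_cvg_cst.
  have c1 : cvgn (fun n => Re (v n x)).
    apply: cvg => n; rewrite !vE; apply: le_trans (CD n).
    by have := ler_abs_Re (D n x); rewrite raddfB.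
  have c2 : cvgn (fun n => Im (v n x)).
    apply: cvg => n; rewrite !vE; apply: le_trans (CD n).
    by have := ler_abs_Im (D n x); rewrite raddfB.
  by exists (limn (fun n => Re (v n x)) +i* limn (fun n => Im (v n x))).
have [F FP] := choice cv.
have mv n : cmeasurable (v n).
  have [m1 m2] := cmeasurable_L2 (u n).
  have E x : v n x = (\1_(~` N) x)%:C * u n x.
    rewrite /v indicE in_setC; case: (x \in N) => /=; first by rewrite rc0 mul0r.
    by rewrite rc1 mul1r.
  rewrite (_ : v n = (fun x => (\1_(~` N) x)%:C * u n x)); last exact/funext.
  apply: cmeasurableM => //; split => //=; apply: measurable_indic.
  exact: measurableC.
have mF : cmeasurable F.
  split.
    apply/measurable_EFinP.
    apply: (emeasurable_fun_cvg (fun n x => (Re (v n x))%:E) (fun x => (Re (F x))%:E)).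
      by move=> n; apply/measurable_EFinP; case: (mv n).
    by move=> x _; apply: cvg_EFin; [exact: nearW|case: (FP x)].
  apply/measurable_EFinP.
  apply: (emeasurable_fun_cvg (fun n x => (Im (v n x))%:E) (fun x => (Im (F x))%:E)).
    by move=> n; apply/measurable_EFinP; case: (mv n).
  by move=> x _; apply: cvg_EFin; [exact: nearW|case: (FP x)].
(* Fatou's lemma carries the estimate [tail] over to the pointwise limit. *)
have main n : (\int[mu]_x (normc (F x - u n x) ^+ 2)%:E <= ((2 * q n) ^+ 2)%:E)%E.
  pose G m x := (normc (v m x - v n x) ^+ 2)%:E.
  have mG m : measurable_fun setT (G m).
    by apply: cmeasurable_normc2; exact: cmeasurableB.
  have nN : \forall x \ae mu, ~ N x by exists N; split=> // x /= /contrapT.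
  have -> : (\int[mu]_x (normc (F x - u n x) ^+ 2)%:E =
             \int[mu]_x (normc (F x - v n x) ^+ 2)%:E)%E.
    apply: ae_eq_integral => //.
    - by apply: cmeasurable_normc2; apply: cmeasurableB => //; exact: cmeasurable_L2.
    - by apply: cmeasurable_normc2; exact: cmeasurableB.
    by apply: filterS nN => x Nx _; rewrite /v memNset.
  have -> : (\int[mu]_x (normc (F x - v n x) ^+ 2)%:E =
             \int[mu]_x limn_einf (G^~ x))%E.
    apply: eq_integral => x _; have [f1 f2] := FP x.
    suff /cvg_limn_einf_sup[-> _] : G^~ x @ \oo --> (normc (F x - v n x) ^+ 2)%:E by [].
    apply: cvg_EFin; first exact: nearW.
    rewrite sqr_normcE !raddfB /=.
    rewrite (_ : fine \o G^~ x = (fun m => (Re (v m x) - Re (v n x)) ^+ 2 +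
       (Im (v m x) - Im (v n x)) ^+ 2)); last first.
      by apply/funext => m; rewrite /G /= sqr_normcE !raddfB.
    have e1 : (fun m => Re (v m x) - Re (v n x)) @ \oo --> Re (F x) - Re (v n x).
      exact: (cvgB f1 (cvg_cst _)).
    have e2 : (fun m => Im (v m x) - Im (v n x)) @ \oo --> Im (F x) - Im (v n x).
      exact: (cvgB f2 (cvg_cst _)).
    exact: (cvgD (cvgM e1 e1) (cvgM e2 e2)).
  apply: le_trans (fatou _ _ _ _) _ => //.
    by move=> m x _; rewrite lee_fin sqr_ge0.
  rewrite limn_einf_lim; apply: lime_le; first exact: is_cvg_einfs.
  apply: nearW => k; apply: ereal_inf_le; exists (\int[mu]_x G (n + k)%N x)%E.
    by exists (n + k)%N => //=; exact: leq_addl.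
  have -> : (\int[mu]_x G (n + k)%N x = (nm (u (n + k)%N - u n) ^+ 2)%:E)%E.
    rewrite nm_sqr_int; apply: ae_eq_integral => //.
      exact/cmeasurable_normc2/cmeasurable_L2.
    apply: filterS2 nN (L2_subE (u (n + k)%N) (u n)) => x Nx -> _.
    by rewrite /G /v memNset.
  by rewrite lee_fin ler_sqr ?nnegrE ?nm_ge0 ?mulr_ge0 ?(ltW (q0 n)).
have sq n : sqintegrable mu (fun x => F x - u n x).
  split; first by apply: cmeasurableB => //; exact: cmeasurable_L2.
  exact: le_lt_trans (main n) (ltry _).
exists (L2class mu (fun x => F x - u 0%N x) + u 0%N) => n.
have E : \forall x \ae mu,
    (L2class mu (fun x => F x - u 0%N x) + u 0%N - u n : V) x = F x - u n x.
  set F0 := L2class _ _.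
  apply: filterS3 (L2classE (sq 0%N)) (L2_addE F0 (u 0%N)) (L2_subE (F0 + u 0%N) (u n)).
  by move=> x /= e1 e2 ->; rewrite e2 e1 subrK.
rewrite -ler_sqr ?nnegrE ?nm_ge0 ?mulr_ge0 ?(ltW (q0 n))//.
rewrite -lee_fin; apply: le_trans (main n); apply: nm_sqr_le_int.
  by case: (sq n).
by apply: filterS E => x ->.
Qed.

End L2_estimates.

(** * Multiplication operators and resolvents *)

Section multiplication.
Context d (T : measurableType d) (R : realType).
Variable mu : {measure set T -> \bar R}.
Local Notation V := (L2 mu).
Implicit Types (f g h : V) (c : R[i]) (u phi psi : T -> R[i]) (M N : bop V).

(** As a relation between operator and symbol, it reduces operator identities to pointwise
    identities of symbols through [is_mul_uniq]. *)
Definition is_mul M phi := forall f, \forall x \ae mu, (M f : V) x = phi x * f x.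

Lemma is_mul_uniq M N phi : is_mul M phi -> is_mul N phi -> M = N.
Proof.
move=> Mp Np; apply/bopP => f; apply/L2_eqP.
by apply: filterS2 (Mp f) (Np f) => x -> ->.
Qed.

Lemma is_mulM M N phi psi : is_mul M phi -> is_mul N psi ->
  is_mul (M * N) (fun x => phi x * psi x).
Proof.
by move=> Mp Np f; apply: filterS2 (Mp (N f)) (Np f) => x; rewrite bopM => -> ->; rewrite mulrA.
Qed.

Lemma is_mulC M N phi psi : is_mul M phi -> is_mul N psi -> M * N = N * M.
Proof.
move=> Mp Np; apply: (is_mul_uniq (is_mulM Mp Np)) => f.
by apply: filterS (is_mulM Np Mp f) => x ->; rewrite [psi x * _]mulrC.
Qed.

Lemma is_mul1 : is_mul 1 (cst 1).
Proof. by move=> f; apply: aeW => x; rewrite mul1r. Qed.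

Lemma is_mulD M N phi psi : is_mul M phi -> is_mul N psi ->
  is_mul (M + N) (fun x => phi x + psi x).
Proof.
move=> Mp Np f; rewrite bopD.
by apply: filterS3 (Mp f) (Np f) (L2_addE (M f) (N f)) => x e1 e2 ->; rewrite e1 e2 mulrDl.
Qed.

Lemma is_mulZ M phi c : is_mul M phi -> is_mul (c *: M) (fun x => c * phi x).
Proof.
move=> Mp f; rewrite bopZ.
by apply: filterS2 (Mp f) (L2_scaleE c (M f)) => x e ->; rewrite e mulrA.
Qed.

Lemma is_mul_ext M phi psi : (forall x, phi x = psi x) -> is_mul M phi -> is_mul M psi.
Proof. by move=> /funext ->. Qed.

Lemma is_mul_nm M phi (C : R) : is_mul M phi -> 0 <= C ->
  (\forall x \ae mu, normc (phi x) <= C) -> nm M <= C.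
Proof.
move=> Mp C0 pC; apply: nm_bop_le => // f; apply: nm_le_ae => //.
apply: filterS2 pC (Mp f) => x pC ->.
by rewrite Normc.normcM ler_wpM2r ?normc_ge0.
Qed.

Lemma L2_linE c f g : \forall x \ae mu, (c *: f + g : V) x = c * f x + g x.
Proof. by apply: filterS2 (L2_addE (c *: f) g) (L2_scaleE c f) => x -> ->. Qed.

Lemma ex_bop_ae (F : V -> T -> R[i]) (C : R) :
  (forall f, sqintegrable mu (F f) /\ nm (L2class mu (F f)) <= C * nm f) ->
  (forall c f g, \forall x \ae mu, F (c *: f + g) x = c * F f x + F g x) ->
  exists M : bop V, forall f, \forall x \ae mu, (M f : V) x = F f x.
Proof.
move=> FC Flin.
have E f : \forall x \ae mu, L2class mu (F f) x = F f x.
  by apply: L2classE; case: (FC f).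
have lin c f g : L2class mu (F (c *: f + g)) =
    c *: L2class mu (F f) + L2class mu (F g).
  apply/L2_eqP.
  have e1 : \forall x \ae mu, L2class mu (F (c *: f + g)) x = c * F f x + F g x.
    by apply: filterS2 (E (c *: f + g)) (Flin c f g) => x -> ->.
  have e2 : \forall x \ae mu, (c *: L2class mu (F f) + L2class mu (F g) : V) x =
      c * F f x + F g x.
    pose G h := L2class mu (F h).
    by apply: filterS3 (L2_linE c (G f) (G g)) (E f) (E g) => x -> -> ->.
  by apply: filterS2 e1 e2 => x -> ->.
have bP : (fun f : V => L2class mu (F f)) \in bounded_operator V.
  apply/bounded_operatorP; split=> [c f g|]; first exact: lin.
  by exists C => f; rewrite !norm_nm -rcM lecR; case: (FC f).
by exists (Bop bP) => f; exact: E.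
Qed.

Lemma ex_is_mul phi (C : R) : cmeasurable phi -> 0 <= C ->
  (forall x, normc (phi x) <= C) -> exists M, is_mul M phi.
Proof.
move=> mp C0 pC; apply: (@ex_bop_ae (fun f x => phi x * f x) C) => [f|c f g].
  apply: L2class_bounded => //.
    by apply: cmeasurableM => //; exact: cmeasurable_L2.
  by apply: aeW => x; rewrite Normc.normcM ler_wpM2r ?normc_ge0.
by apply: filterS (L2_linE c f g) => x ->; ring.
Qed.

Lemma eq_L2dot_ae f g f' g' :
  (\forall x \ae mu, f x * (g x)^* = f' x * (g' x)^*) -> L2dot f g = L2dot f' g'.
Proof. by apply: ae_eq_cintegral; exact: cmeasurable_mulC. Qed.

Lemma is_mul_adj M N phi f g : is_mul M phi -> is_mul N (fun x => (phi x)^*) ->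
  L2dot (M f) g = L2dot f (N g).
Proof.
move=> Mp Np; apply: eq_L2dot_ae; apply: filterS2 (Mp f) (Np g) => x -> ->.
by case: (phi x) (f x) (g x) => [? ?] [? ?] [? ?] /=; congr (_ +i* _); ring.
Qed.

End multiplication.

(** * Resolvents of the multiplication operator *)

Section cauchy_operators.
Context (R : realType) (rho : {finite_measure set (measurableTypeR R) -> \bar R}).
Variable (rho_supp : compactly_supported rho).
Local Notation V := (L2 rho).
Variables (g : V) (g1 : \forall x \ae rho, g x = 1).
Implicit Types (f h : V) (e : R) (l : R[i]).

Local Notation A := (mul_id rho_supp).
Local Notation B := (rank_one g).

Lemma is_mul_id : is_mul A (fun x : R => x%:C).
Proof. by move=> f; exact: mulopE. Qed.

Lemma symmetric_mul_id : symmetric_bop A.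
Proof.
move=> f h; apply: (is_mul_adj _ _ is_mul_id).
by apply: is_mul_ext is_mul_id => x; rewrite conjc_real.
Qed.

Lemma rank_oneE f : B f = L2dot f g *: g. Proof. by []. Qed.

Let cauchy_kernel l (y : R) : R[i] := (y%:C - l)^-1.

Lemma kernel_neq0 l (y : R) : Im l != 0 -> y%:C - l != 0.
Proof.
case: l => a b /= b0; rewrite eq_complex /= negb_and; apply/orP; right.
by rewrite sub0r oppr_eq0.
Qed.

Lemma kernel_le l (y : R) : Im l != 0 -> normc (cauchy_kernel l y) <= `|Im l|^-1.
Proof.
move=> l0; rewrite /cauchy_kernel Normc.normcV lef_pV2 ?posrE ?normr_gt0//.
  by have := ler_abs_Im (y%:C - l); case: l l0 => a b /=; rewrite sub0r normrN.
by rewrite normc_gt0 kernel_neq0.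
Qed.

Lemma continuous_cmeasurable (F : R -> R[i]) :
  (exists2 L : R, 0 < L & forall x y, normc (F x - F y) <= L * `|x - y|) ->
  @cmeasurable _ (measurableTypeR R) R F.
Proof.
move=> [L L0 FL].
have cont (p : R -> R) : (forall x y, `|p x - p y| <= L * `|x - y|) ->
    measurable_fun (setT : set (measurableTypeR R)) p.
  move=> pL; apply: continuous_measurable_fun => x.
  apply/cvgrPdist_lt => e e0; near=> y.
  apply: le_lt_trans (pL _ _) _; rewrite mulrC -ltr_pdivlMr//.
  near: y; apply: cvgr_dist_lt; last by rewrite divr_gt0.
  exact: cvg_id.
split; apply: cont => x y; apply: le_trans (FL x y); rewrite -raddfB.
  exact: ler_abs_Re.
exact: ler_abs_Im.
Unshelve. all: by end_near. Qed.

Lemma cmeasurable_kernel l : Im l != 0 ->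
  @cmeasurable _ (measurableTypeR R) R (cauchy_kernel l).
Proof.
move=> l0; apply: continuous_cmeasurable.
have il0 : 0 < `|Im l|^-1 by rewrite invr_gt0 normr_gt0.
exists (`|Im l|^-1 ^+ 2) => [|x y]; first by rewrite exprn_gt0.
have -> : cauchy_kernel l x - cauchy_kernel l y =
    - (cauchy_kernel l x * cauchy_kernel l y * (x - y)%:C).
  by rewrite /cauchy_kernel rcD rcN; field; rewrite !kernel_neq0.
rewrite normcN !Normc.normcM normc_real ler_wpM2r// expr2.
by rewrite ler_pM ?normc_ge0 ?kernel_le.
Qed.

(** The condition on [l] sits inside the existential so that choice yields a total function,
    unspecified at real [l]. The same device serves for [kop] and [recop]. *)
Lemma ex_resolvent l : exists M : bop V, Im l != 0 -> is_mul M (cauchy_kernel l).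
Proof.
have [l0|l0] := eqVneq (Im l) 0; first by exists 0; rewrite /is_mul => /negP[]; exact/eqP.
have [M MP] := @ex_is_mul _ _ _ rho (cauchy_kernel l) `|Im l|^-1
  (cmeasurable_kernel l0) (ltac:(by rewrite invr_ge0)) (fun y => kernel_le y l0).
by exists M.
Qed.

Definition resolvent l : bop V := projT1 (cid (ex_resolvent l)).

Lemma is_mul_resolvent l : Im l != 0 ->
  is_mul (resolvent l) (fun y : R => (y%:C - l)^-1).
Proof. by rewrite /resolvent; case: cid. Qed.

Lemma resolventK l : Im l != 0 -> resolvent l * (A - l *: (1 : bop V)) = 1.
Proof.
move=> l0; apply: (is_mul_uniq _ (@is_mul1 _ _ _ _)).
have := is_mulM (is_mul_resolvent l0) (is_mulD is_mul_id (is_mulZ (- l) (@is_mul1 _ _ _ rho))).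
rewrite scaleNr; apply: is_mul_ext => x.
by rewrite /= mulr1 mulVf// kernel_neq0.
Qed.

Lemma resolventKV l : Im l != 0 -> (A - l *: (1 : bop V)) * resolvent l = 1.
Proof.
move=> l0; rewrite -[RHS](resolventK l0); apply: is_mulC (is_mul_resolvent l0).
have := is_mulD is_mul_id (is_mulZ (- l) (@is_mul1 _ _ _ rho)).
by rewrite scaleNr; exact.
Qed.

Lemma nm_resolvent l : Im l != 0 -> nm (resolvent l) <= `|Im l|^-1.
Proof.
move=> l0; apply: is_mul_nm (is_mul_resolvent l0) _ _; first by rewrite invr_ge0.
by apply: aeW => y; exact: kernel_le.
Qed.

Lemma resolventB l l' : Im l != 0 -> Im l' != 0 ->
  resolvent l - resolvent l' = (l - l') *: (resolvent l * resolvent l').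
Proof.
move=> l0 l'0.
have h1 := is_mulD (is_mul_resolvent l0) (is_mulZ (-1) (is_mul_resolvent l'0)).
have h2 := is_mulZ (l - l') (is_mulM (is_mul_resolvent l0) (is_mul_resolvent l'0)).
rewrite -[- resolvent l']scaleN1r; apply: (is_mul_uniq h1).
apply: is_mul_ext h2 => x /=; field.
by rewrite !kernel_neq0.
Qed.

Lemma resolvent_conj l f h : Im l != 0 ->
  L2dot (resolvent l f) h = L2dot f (resolvent l^* h).
Proof.
move=> l0; have l'0 : Im l^* != 0 by case: l l0 => a b /=; rewrite oppr_eq0.
apply: is_mul_adj (is_mul_resolvent l0) _.
apply: is_mul_ext (is_mul_resolvent l'0) => x.
rewrite conjc_inv; congr (_^-1); case: (l) => a b; apply/eqP.
by rewrite eq_complex /=; apply/andP; split; apply/eqP; ring.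
Qed.

Lemma dot_resolvent_borel l : Im l != 0 ->
  L2dot (resolvent l g) g = borel_transform rho l.
Proof.
move=> l0; apply: ae_eq_cintegral; first exact: cmeasurable_mulC.
  exact: cmeasurable_kernel.
apply: filterS2 (is_mul_resolvent l0 g) g1 => x -> ->.
by rewrite rmorph1 !mulr1.
Qed.

End cauchy_operators.

#[global] Opaque resolvent.

(** * Regularized Hilbert transforms *)

Section skew_operators.
Context d (T : measurableType d) (R : realType).
Variable mu : {measure set T -> \bar R}.
Local Notation V := (L2 mu).
Implicit Types (f g h : V) (c : R[i]) (A X Y : bop V).

Lemma subrACA4 (W : zmodType) (a b c e : W) : a - b - (c - e) = a - c - (b - e).
Proof. by rewrite !opprB addrACA [RHS]addrACA [- b - c]addrC. Qed.

Lemma scale_subE (W : lmodType R[i]) (a b c : R[i]) (x y : W) : c = a - b ->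
  a *: x - b *: y = a *: (x - y) + c *: y.
Proof. by move=> ->; rewrite scalerBr scalerBl addrA subrK. Qed.

Definition skew_bop X := forall f h, L2dot (X f) h = - L2dot f (X h).

Lemma hermitian_form_eq0 (z : V -> V -> R[i]) :
  (forall f g h, z (f + g) h = z f h + z g h) ->
  (forall c f g, z (c *: f) g = c * z f g) ->
  (forall f g, z f g = (z g f)^*) ->
  (forall f, Re (z f f) = 0) -> forall f g, z f g = 0.
Proof.
move=> zD zZ zJ z0 f h.
have zDr f1 g1 h1 : z h1 (f1 + g1) = z h1 f1 + z h1 g1.
  by rewrite zJ zD rmorphD /= -!zJ.
have zZr c f1 g1 : z f1 (c *: g1) = c^* * z f1 g1.
  by rewrite zJ zZ rmorphM /= -!zJ.
have h1 := z0 (f + h); have h2 := z0 (f + 'i *: h).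
move: h1 h2 (z0 f) (z0 h); rewrite !zD !zDr !zZ !zZr (zJ h f).
case: (z f h) (z f f) (z h h) => [a b] [x x'] [y y'].
rewrite -!complexiE /= => h1 h2 h3 h4; congr (_ +i* _); lra.
Qed.

(** For skew [X] the form [(- i X f, h)] is hermitian with diagonal [Im (X f, f)], and the source
    [Y] is what makes its Lyapunov expression nonnegative. *)
Lemma skew_lyapunov_ge0 X Y A (e : R) : symmetric_bop A -> skew_bop X -> 0 < e ->
  X * A - A * X = ('i * e%:C) *: X + Y -> (forall f, 0 <= Re (L2dot (Y f) f)) ->
  forall f, 0 <= Im (L2dot (X f) f).
Proof.
move=> sA sX e0 XA Y0 f.
have XAE h : X (A h) = A (X h) + (('i * e%:C) *: X h + Y h).
  apply/eqP; rewrite addrC -subr_eq; apply/eqP.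
  exact: (congr1 (fun M : bop V => M h) XA).
have -> : Im (L2dot (X f) f) = Re (- 'i * L2dot (X f) f).
  by case: (L2dot _ _) => a b; rewrite -complexiE /=; ring.
apply: (@lyapunov_ge0 _ _ _ _ (fun f h => - 'i * L2dot (X f) h) A e (nm X)) => //.
- by move=> f1 g h; rewrite linearD L2dotDl mulrDr.
- by move=> c f1 g; rewrite linearZ L2dotZl; ring.
- move=> f1 g; rewrite sX (L2dotC f1 (X g)).
  by case: (L2dot _ _) => a b; rewrite -complexiE /=; congr (_ +i* _); ring.
- move=> f1; apply: le_trans (ler_abs_Re _) _.
  rewrite Normc.normcM normcN normc_i mul1r; apply: le_trans (L2dot_le _ _) _.
  by rewrite expr2 mulrA ler_wpM2r ?nm_ge0// nm_bop.
- move=> f1; have := Y0 f1.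
  have : L2dot (X (A f1)) f1 = - (L2dot (X f1) (A f1))^*.
    by rewrite sX (L2dotC (A f1)).
  rewrite XAE !L2dotDl L2dotZl sA.
  case: (L2dot (X f1) f1) (L2dot (X f1) (A f1)) (L2dot (Y f1) f1) => [a a'] [b b'] [c c'].
  by rewrite -!complexiE /= => -[h1 h2] h3; lra.
Qed.

(* Cauchy-Schwarz for the nonnegative operator - i X, tested on f + i X f / C *)
Lemma skew_nm_le X (C : R) f : skew_bop X -> 0 < C -> nm X <= C ->
  (forall h, 0 <= Im (L2dot (X h) h)) ->
  nm (X f) ^+ 2 <= C * Im (L2dot (X f) f).
Proof.
move=> sX C0 XC X0; have := X0 (f + (0 +i* C^-1) *: X f).
have -> : X (f + (0 +i* C^-1) *: X f) = X f + (0 +i* C^-1) *: X (X f).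
  by rewrite linearD linearZ.
rewrite !L2dotDl !L2dotDr !L2dotZl !L2dotZr.
rewrite (sX (X f) f) !L2dotff_nm.
have h1 : `|Im (L2dot (X (X f)) (X f))| <= C * nm (X f) ^+ 2.
  apply: le_trans (ler_abs_Im _) _; apply: le_trans (L2dot_le _ _) _.
  rewrite expr2 mulrA ler_wpM2r ?nm_ge0//; apply: le_trans (nm_bop _ _) _.
  by rewrite ler_wpM2r ?nm_ge0.
case: (L2dot (X f) f) (L2dot (X (X f)) (X f)) h1 => [a a'] [b b'] /= h1.
have h2 : C^-1 ^+ 2 * b' <= C^-1 * nm (X f) ^+ 2.
  have -> : C^-1 * nm (X f) ^+ 2 = C^-1 ^+ 2 * (C * nm (X f) ^+ 2).
    by field; rewrite gt_eqF.
  by rewrite ler_wpM2l ?sqr_ge0// (le_trans (ler_norm _)).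
rewrite -ler_pdivrMl// => h3; move: h2 h3; rewrite expr2; lra.
Qed.

End skew_operators.

(** * The regularized operators: Sylvester equation, skewness, monotonicity *)

Section cauchy_operators.
Context (R : realType) (rho : {finite_measure set (measurableTypeR R) -> \bar R}).
Variable (rho_supp : compactly_supported rho).
Local Notation V := (L2 rho).
Variables (g : V) (g1 : \forall x \ae rho, g x = 1).
Implicit Types (f h : V) (e : R) (l : R[i]).

Local Notation A := (mul_id rho_supp).
Local Notation B := (rank_one g).

Let Iml (x e : R) : 0 < e -> Im (x -i* e) != 0.
Proof. by move=> e0 /=; rewrite oppr_eq0 gt_eqF. Qed.

Let Iml_abs (x e : R) : 0 < e -> `|Im (x -i* e)| = e.
Proof. by move=> e0 /=; rewrite normrN gtr0_norm. Qed.

(* The value at x of the integral operator with kernel 1 / (y - x - i e). *)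
Definition cauchy_fun e f (x : R) : R[i] := L2dot f (resolvent rho (x -i* e) g).

Lemma cauchy_fun_le e f x : 0 < e -> normc (cauchy_fun e f x) <= (e^-1 * nm g) * nm f.
Proof.
move=> e0; apply: le_trans (L2dot_le _ _) _; rewrite mulrC ler_wpM2r ?nm_ge0//.
apply: le_trans (nm_bop _ _) _; rewrite ler_wpM2r ?nm_ge0//.
by rewrite -[X in X^-1](Iml_abs x e0); apply: nm_resolvent; exact: Iml.
Qed.

(** By the resolvent identity the function is Lipschitz in [x], which spares an argument on
    measurability of integrals with a parameter. *)
Lemma cmeasurable_cauchy_fun e f : 0 < e ->
  @cmeasurable _ (measurableTypeR R) R (cauchy_fun e f).
Proof.
move=> e0; apply: continuous_cmeasurable.
(* The summand 1 only makes the Lipschitz constant positive. *)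
exists (nm f * (e^-1 * e^-1 * nm g) + 1).
  by rewrite ltr_wpDl ?ltr01// !mulr_ge0 ?nm_ge0 ?invr_ge0 ?ltW.
move=> x y; rewrite /cauchy_fun -L2dotBr -bopB resolventB ?Iml// bopZ.
apply: le_trans (L2dot_le _ _) _; rewrite nmZ.
have -> : (x -i* e) - (y -i* e) = (x - y)%:C by apply/eqP; rewrite eq_complex /= subrr !eqxx.
rewrite normc_real mulrDl mul1r ler_wpDr// mulrCA mulrC ler_wpM2r// ler_wpM2l ?nm_ge0//.
rewrite bopM; apply: le_trans (nm_bop _ _) _; rewrite -mulrA.
have nr z : nm (resolvent rho (z -i* e)) <= e^-1.
  by rewrite -[X in X^-1](Iml_abs z e0); apply: nm_resolvent; exact: Iml.
apply: ler_pM; rewrite ?nm_ge0 ?nr//; apply: le_trans (nm_bop _ _) _.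
by rewrite ler_wpM2r ?nm_ge0 ?nr.
Qed.

Lemma ex_kop e : exists K : bop V, 0 < e ->
  forall f, \forall x \ae rho, (K f : V) x = cauchy_fun e f x.
Proof.
have [e0|e0] := ltP 0 e; last by exists 0.
have C0 : 0 <= nm g * (e^-1 * nm g) by rewrite !mulr_ge0 ?nm_ge0 ?invr_ge0 ?ltW.
have h f : sqintegrable rho (cauchy_fun e f) /\
    nm (L2class rho (cauchy_fun e f)) <= (e^-1 * nm g * nm f) * nm g.
  apply: L2class_bounded; first exact: cmeasurable_cauchy_fun.
    by apply: filterS g1 => x ->; rewrite Normc.normc1 mulr1 cauchy_fun_le.
  by rewrite !mulr_ge0 ?nm_ge0 ?invr_ge0 ?ltW.
have [f|c f f'|K KP] := @ex_bop_ae _ _ _ rho (cauchy_fun e) (nm g * (e^-1 * nm g)).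
- have [sf hf] := h f; split=> //; apply: le_trans hf _.
  by rewrite le_eqVlt; apply/orP; left; apply/eqP; ring.
- by apply: aeW => x; rewrite /cauchy_fun L2dotDl L2dotZl.
by exists K.
Qed.

Definition kop e : bop V := projT1 (cid (ex_kop e)).

Lemma kopE e f : 0 < e -> \forall x \ae rho, (kop e f : V) x = cauchy_fun e f x.
Proof. by move=> e0; rewrite /kop; case: cid => K /=; exact. Qed.

Lemma nm_kop_inv e : 0 < e -> nm (kop e) <= nm g ^+ 2 * e^-1.
Proof.
move=> e0; apply: nm_bop_le => [|f]; first by rewrite mulr_ge0 ?sqr_ge0 ?invr_ge0 ?ltW.
have : nm (kop e f) <= (e^-1 * nm g * nm f) * nm g.
  apply: nm_le_ae; first by rewrite !mulr_ge0 ?nm_ge0 ?invr_ge0 ?ltW.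
  apply: filterS2 g1 (kopE f e0) => x -> ->.
  by rewrite Normc.normc1 mulr1 cauchy_fun_le.
by rewrite (_ : _ * nm g = nm g ^+ 2 * e^-1 * nm f)//; ring.
Qed.

(** On kernels this is $(y-x)/(y-x-ie)=1+ie/(y-x-ie)$, where the constant 1 is the kernel of [B]. *)
Lemma kop_sylvester e : 0 < e ->
  kop e * A - A * kop e = ('i * e%:C) *: kop e + B.
Proof.
move=> e0; apply/bopP => f.
suff : kop e (A f) - A (kop e f) = ('i * e%:C) *: kop e f + L2dot f g *: g by [].
apply/L2_eqP.
have Ae : \forall x \ae rho, (A (kop e f) : V) x = x%:C * cauchy_fun e f x.
  by apply: filterS2 (is_mul_id rho_supp (kop e f)) (kopE f e0) => x -> ->.
have e1 : \forall x \ae rho, (kop e (A f) - A (kop e f) : V) x =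
    cauchy_fun e (A f) x - x%:C * cauchy_fun e f x.
  by apply: filterS3 (L2_subE (kop e (A f)) (A (kop e f))) (kopE (A f) e0)
    Ae => x -> -> ->.
have e2 : \forall x \ae rho, (('i * e%:C) *: kop e f + L2dot f g *: g : V) x =
    ('i * e%:C) * cauchy_fun e f x + L2dot f g.
  have e3 : \forall x \ae rho, (L2dot f g *: g : V) x = L2dot f g.
    by apply: filterS2 (L2_scaleE (L2dot f g) g) g1 => x -> ->; rewrite mulr1.
  by apply: filterS3 (L2_linE ('i * e%:C) (kop e f) (L2dot f g *: g)) e3 (kopE f e0) => x -> -> ->.
apply: filterS2 e1 e2 => x -> ->.
rewrite /cauchy_fun symmetric_mul_id.
have -> : A (resolvent rho (x -i* e) g) = g + (x -i* e) *: resolvent rho (x -i* e) g.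
  apply/eqP; rewrite -subr_eq; apply/eqP.
  exact: (congr1 (fun M : bop V => M g) (resolventKV rho_supp (Iml x e0))).
have xe : (x -i* e)^* = x%:C + 'i * e%:C.
  by rewrite -complexiE; apply/eqP; rewrite eq_complex /=; apply/andP; split; apply/eqP; ring.
rewrite L2dotDr L2dotZr [X in (_ + X * _) - _]xe.
by ring.
Qed.

Lemma rank_one_symmetric : symmetric_bop B.
Proof.
move=> f h; rewrite !rank_oneE L2dotZl L2dotZr (L2dotC g h); exact: mulrC.
Qed.

Lemma Re_rank_one f : 0 <= Re (L2dot (B f) f).
Proof.
rewrite rank_oneE L2dotZl (L2dotC g f); case: (L2dot f g) => a b /=.
by rewrite mulrN opprK -!expr2 addr_ge0 ?sqr_ge0.
Qed.

(** Since [B] is symmetric it drops out of the equation for the hermitian part of [kop e]. The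
    Lyapunov lemma then applies to that form with both signs, so its diagonal vanishes. *)
Lemma kop_skew e : 0 < e -> skew_bop (kop e).
Proof.
move=> e0 f0 h0; apply/eqP; rewrite -subr_eq0 opprK; apply/eqP; move: f0 h0.
pose z (s : R) f h := s%:C * (L2dot (kop e f) h + L2dot f (kop e h)).
have KAE h : kop e (A h) = A (kop e h) + (('i * e%:C) *: kop e h + B h).
  apply/eqP; rewrite addrC -subr_eq; apply/eqP.
  exact: (congr1 (fun M : bop V => M h) (kop_sylvester e0)).
have zge (s : R) f : 0 <= Re (z s f f).
  apply: (@lyapunov_ge0 _ _ _ _ (z s) A e (`|s| * (2 * nm (kop e)))) => //.
  - by move=> f1 h h'; rewrite /z linearD !L2dotDl; ring.
  - by move=> c f1 h; rewrite /z linearZ !L2dotZl; ring.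
  - move=> f1 h; rewrite /z (L2dotC f1) (L2dotC _ h).
    by case: (L2dot _ _) (L2dot _ _) => [? ?] [? ?] /=; congr (_ +i* _); ring.
  - move=> f1; apply: le_trans (ler_abs_Re _) _.
    rewrite Normc.normcM normc_real -mulrA ler_wpM2l//.
    apply: le_trans (normcD _ _) _; rewrite (L2dotC f1) normc_conj.
    have := L2dot_le (kop e f1) f1; have := nm_bop (kop e) f1; have := nm_ge0 f1.
    move=> n0 n1 n2; have : nm (kop e f1) * nm f1 <= nm (kop e) * nm f1 * nm f1.
      by rewrite ler_wpM2r.
    rewrite expr2; set a := normc _ in n2 *; move: n2; set b := nm (kop e f1); lra.
  - exact: symmetric_mul_id.
  - move=> f1; rewrite /z KAE !L2dotDr L2dotZr -(symmetric_mul_id rho_supp f1) (L2dotC (A f1)).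
    rewrite (L2dotC f1 (kop e f1)) -rank_one_symmetric.
    have : Im (L2dot (B f1) f1) = 0.
      by rewrite rank_one_symmetric; apply: symmetric_Im; exact: rank_one_symmetric.
    case: (L2dot (kop e f1) f1) (L2dot (kop e f1) (A f1)) (L2dot (B f1) f1) => [a a'] [b b'] [c c'].
    by rewrite -!complexiE /= => ->; lra.
have zE f h : z 1 f h = L2dot (kop e f) h + L2dot f (kop e h) by rewrite /z rc1 mul1r.
move=> f h; rewrite -zE; move: f h; apply: hermitian_form_eq0.
- by move=> f1 h h'; rewrite /z linearD !L2dotDl; ring.
- by move=> c f1 h; rewrite /z linearZ !L2dotZl; ring.
- move=> f1 h; rewrite /z (L2dotC f1) (L2dotC _ h).
  by case: (L2dot _ _) (L2dot _ _) => [? ?] [? ?] /=; congr (_ +i* _); ring.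
- move=> f; have := zge 1 f; have := zge (-1) f; rewrite /z.
  case: (_ + _) => a b; rewrite /= => h1 h2; lra.
Qed.

Lemma kop_ge0 e f : 0 < e -> 0 <= Im (L2dot (kop e f) f).
Proof.
move=> e0; apply: (skew_lyapunov_ge0 (symmetric_mul_id rho_supp) (kop_skew e0) e0 (kop_sylvester e0)).
exact: Re_rank_one.
Qed.

Lemma skewB (X Y : bop V) : skew_bop X -> skew_bop Y -> skew_bop (X - Y).
Proof. by move=> sX sY f h; rewrite !bopB L2dotBl L2dotBr sX sY; ring. Qed.

(** Subtracting the two Sylvester equations leaves the source $-i(e'-e)K_{e'}$, whose real part is
    nonnegative by [kop_ge0]. *)
Lemma kop_decr e e' f : 0 < e -> e <= e' -> 0 <= Im (L2dot ((kop e - kop e') f) f).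
Proof.
move=> e0 ee'; have e'0 := lt_le_trans e0 ee'.
apply: (@skew_lyapunov_ge0 _ _ _ _ _ (- ('i * (e' - e)%:C) *: kop e') A e) => //.
- exact: symmetric_mul_id.
- by apply: skewB; exact: kop_skew.
- have -> : (kop e - kop e') * A - A * (kop e - kop e') =
      (kop e * A - A * kop e) - (kop e' * A - A * kop e').
    by rewrite mulrBl mulrBr; exact: subrACA4.
  rewrite !kop_sylvester// opprD addrACA subrr addr0.
  by apply: scale_subE; rewrite rcD rcN; ring.
- move=> f1; rewrite bopZ L2dotZl; have := kop_ge0 f1 e'0.
  case: (L2dot _ _) => a b; rewrite -complexiE /= => b0.
  have : 0 <= (e' - e) * b by rewrite mulr_ge0// subr_ge0.
  lra.
Qed.

End cauchy_operators.

#[global] Opaque kop.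

(** * Null sequences and strong limits *)

Section vanishing.
Context {R : realType}.
Implicit Types w : R^nat.

(** One-sided: for nonnegative sequences it is convergence to 0, and it passes to any smaller
    sequence. *)
Definition vanish w := forall eta, 0 < eta -> exists N, forall n, (N <= n)%N -> w n <= eta.

Lemma vanish_le w w' : (forall n, w n <= w' n) -> vanish w' -> vanish w.
Proof. by move=> ww' h eta /h[N hN]; exists N => n /hN; exact: le_trans. Qed.

Lemma vanishD w w' : vanish w -> vanish w' -> vanish (fun n => w n + w' n).
Proof.
move=> h h' eta eta0; have e2 : 0 < eta / 2 by rewrite divr_gt0.
have [N hN] := h _ e2; have [N' hN'] := h' _ e2.
exists (maxn N N') => n; rewrite geq_max => /andP[/hN ? /hN' ?].
by rewrite [eta]splitr lerD.
Qed.

Lemma vanishZ c w : 0 <= c -> vanish w -> vanish (fun n => c * w n).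
Proof.
move=> c0 h eta eta0; have c1 : 0 < c + 1 by lra.
have [N hN] := h _ (divr_gt0 eta0 c1); exists N => n /hN wn.
have [n0|n0] := leP (w n) 0; first exact: le_trans (mulr_ge0_le0 c0 n0) (ltW eta0).
apply: (@le_trans _ _ ((c + 1) * w n)); first by rewrite ler_wpM2r ?ltW//; lra.
by rewrite mulrC -ler_pdivlMr.
Qed.

Lemma vanish_cst_le (x : R) w : vanish w -> (forall n, x <= w n) -> x <= 0.
Proof.
move=> h xw; rewrite leNgt; apply/negP => x0.
have x2 : 0 < x / 2 by rewrite divr_gt0.
have [N hN] := h _ x2; have := hN N (leqnn _); have := xw N; lra.
Qed.

Lemma vanish_half : vanish (fun n => 2^-1 ^+ n).
Proof.
move=> eta eta0; have [N hN] := exists_half_pow_lt eta0; exists N => n /subnKC <-.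
apply: le_trans (ltW hN); rewrite exprD ler_piMr ?exprn_ge0 ?invr_ge0//.
by rewrite exprn_ile1// ?invr_ge0//; lra.
Qed.

Lemma vanish_shift w : vanish w -> vanish (fun n => w n.+1).
Proof. by move=> h eta /h[N hN]; exists N => n Nn; apply: hN; exact: leqW. Qed.

Lemma vanish_sup (a : R^nat) (C : R) : (forall n, a n <= a n.+1) -> (forall n, a n <= C) ->
  exists l, (forall n, a n <= l) /\ vanish (fun n => l - a n).
Proof.
move=> ndec aC.
have hs : has_sup (range a) by split; [exists (a 0%N), 0%N|exists C => _ [n _ <-]].
exists (sup (range a)); split=> [n|eta eta0].
  by apply: ub_le_sup; [case: hs|exists n].
have [_ [N _ <-] hN] := sup_adherent eta0 hs; exists N => n Nn.
have mono m : a N <= a (N + m)%N.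
  by elim: m => [|m IH]; rewrite ?addn0// addnS (le_trans IH).
by have := mono (n - N)%N; rewrite subnKC//; lra.
Qed.

(** The supremum [s] satisfies [s ^+ 2 <= 2 * M * s]. The a priori bound [C] makes [s] finite, so
    that one factor can be cancelled; its size does not enter the conclusion. *)
Lemma sup_self_improve (a : R^nat) (M C : R) : 0 <= M ->
  (forall n, 0 <= a n) -> (forall n, a n <= C) ->
  (forall n, a n ^+ 2 <= 2 * M * a n.+1) -> a 0%N <= 2 * M.
Proof.
move=> M0 a0 aC aS.
have hs : has_sup (range a) by split; [exists (a 0%N), 0%N|exists C => _ [n _ <-]].
set s := sup (range a).
have as_ n : a n <= s by apply: ub_le_sup; [case: hs|exists n].
have s0 : 0 <= s by exact: le_trans (a0 0%N) (as_ 0%N).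
apply: le_trans (as_ 0%N) _.
have ms : 0 <= 2 * M * s by rewrite !mulr_ge0.
have : s <= Num.sqrt (2 * M * s).
  apply: ge_sup; first by case: hs.
  move=> _ [n _ <-]; rewrite -(ger0_norm (a0 n)) -sqrtr_sqr; apply: ler_wsqrtr.
  by apply: le_trans (aS n) _; rewrite ler_wpM2l// mulr_ge0.
rewrite -ler_sqr ?nnegrE ?sqrtr_ge0// sqr_sqrtr// expr2.
have [->|sn0] := eqVneq s 0; first by move=> _; rewrite mulr_ge0.
by rewrite ler_pM2r// lt_neqAle eq_sym sn0.
Qed.

End vanishing.

Section strong_limits.
Context d (T : measurableType d) (R : realType).
Variable mu : {measure set T -> \bar R}.
Local Notation V := (L2 mu).
Implicit Types (u v : nat -> V) (f g h : V) (c : R[i]).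

Definition tends u f := vanish (fun n => nm (u n - f)).

Lemma L2_ext f g : (forall h, L2dot f h = L2dot g h) -> f = g.
Proof.
move=> fg; apply/eqP; rewrite -subr_eq0; apply/eqP; apply: L2dot_eq0_all => h.
by rewrite L2dotBl fg subrr.
Qed.

(** The bookkeeping of [cotlar]; pairing with a test vector moves it to scalars, where [ring]
    decides. *)
Lemma commutator_combination (u1 u2 u3 u4 u5 v1 v2 v3 : V) (a b c : R[i]) : c = a + b ->
  v1 + (a *: u1 - u5) + (b *: u1 + u4) - (v2 + (c *: u2 + u4) -
    (v3 + (c *: u3 + u5))) - (v1 - (v2 - v3)) = c *: (u1 - (u2 - u3)).
Proof.
move=> ->; apply: L2_ext => h.
by rewrite !(L2dotDl, L2dotBl, L2dotNl, L2dotZl); ring.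
Qed.

Lemma tends_uniq u f g : tends u f -> tends u g -> f = g.
Proof.
move=> uf ug; apply/eqP; rewrite -subr_eq0; apply/eqP; apply: nm0_eq0.
apply/eqP; rewrite eq_le nm_ge0 andbT.
apply: vanish_cst_le (vanishD uf ug) _ => n.
rewrite (nmBC (u n) f); have -> : f - g = (f - u n) + (u n - g) by rewrite addrA subrK.
exact: nmD.
Qed.

Lemma tends_ext u v f : (forall n, u n = v n) -> tends u f -> tends v f.
Proof. by move=> /funext ->. Qed.

Lemma tends_cst f : tends (fun=> f) f.
Proof. by move=> e e0; exists 0%N => n _; rewrite subrr nm0 ltW. Qed.

Lemma tendsD u v f g : tends u f -> tends v g -> tends (fun n => u n + v n) (f + g).
Proof.
move=> uf vg; apply: vanish_le (vanishD uf vg) => n.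
by rewrite opprD addrACA; exact: nmD.
Qed.

Lemma tends_bop (S : bop V) u f : tends u f -> tends (fun n => S (u n)) (S f).
Proof.
move=> uf; apply: vanish_le (vanishZ (nm_ge0 S) uf) => n.
by rewrite -linearB; exact: nm_bop.
Qed.

Lemma tendsN u f : tends u f -> tends (fun n => - u n) (- f).
Proof. by move=> uf; apply: vanish_le uf => n; rewrite -opprD nmN. Qed.

Lemma tendsB u v f g : tends u f -> tends v g -> tends (fun n => u n - v n) (f - g).
Proof. by move=> uf vg; apply: tendsD => //; exact: tendsN. Qed.

Lemma tends_shift u f : tends u f -> tends (fun n => u n.+1) f.
Proof. exact: vanish_shift. Qed.

Lemma tends_comp (S : nat -> bop V) (C : R) u f g : (forall n, nm (S n) <= C) ->
  tends u f -> tends (fun n => S n f) g -> tends (fun n => S n (u n)) g.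
Proof.
move=> SC uf Sf; have C0 : 0 <= C by exact: le_trans (nm_ge0 _) (SC 0%N).
apply: vanish_le (vanishD (vanishZ C0 uf) Sf) => n.
have -> : S n (u n) - g = S n (u n - f) + (S n f - g).
  by rewrite linearB addrA subrK.
apply: le_trans (nmD _ _) _; rewrite lerD2r.
by apply: le_trans (nm_bop _ _) _; rewrite ler_wpM2r ?nm_ge0.
Qed.

Lemma L2_cauchy_cvg u : (forall eta, 0 < eta -> exists N, forall n m,
    (N <= n)%N -> (N <= m)%N -> nm (u n - u m) <= eta) ->
  exists f, tends u f.
Proof.
move=> cu.
have q0 k : 0 < 4^-1 ^+ k :> R by rewrite exprn_gt0// invr_gt0.
have [N NP] := choice (fun k => cu _ (q0 k)).
(* Summing the thresholds makes them nondecreasing, so that [I k] and [I k.+1] both lie beyond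
   [N k]. *)
pose I k := (\sum_(j < k.+1) N j)%N.
have NI k : (N k <= I k)%N by rewrite /I big_ord_recr leq_addl.
have IS k : (I k <= I k.+1)%N by rewrite /I [leqRHS]big_ord_recr leq_addr.
have [f fP] : exists f, forall k, nm (f - u (I k)) <= 2 * 4^-1 ^+ k.
  by apply: L2_complete => k; apply: NP => //; exact: leq_trans (NI _) (IS _).
have vq : vanish (fun k => 3 * 4^-1 ^+ k : R).
  apply: vanishZ => //; apply: vanish_le vanish_half => k.
  by rewrite lerXn2r ?nnegrE ?invr_ge0// lef_pV2 ?posrE//; lra.
exists f => eta /vq[k hk]; exists (N k) => n Nn.
apply: le_trans (hk k (leqnn _)).
have -> : u n - f = (u n - u (I k)) - (f - u (I k)) by rewrite opprB addrA subrK.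
apply: le_trans (nmB _ _) _.
have := fP k; have := NP k n (I k) Nn (NI k).
by lra.
Qed.

Lemma ex_strong_limit (S : nat -> bop V) (C : R) : (forall n, nm (S n) <= C) ->
  (forall f, exists g, tends (fun n => S n f) g) ->
  exists2 K : bop V, nm K <= C & forall f, tends (fun n => S n f) (K f).
Proof.
move=> SC /choice[F FP]; have C0 : 0 <= C by exact: le_trans (nm_ge0 _) (SC 0%N).
have lin c f g : F (c *: f + g) = c *: F f + F g.
  apply: tends_uniq (FP _) _; apply: (@tends_ext (fun n => c *: S n f + S n g)).
    by move=> n; rewrite linearP.
  apply: tendsD => //; have := tends_bop (c *: (1 : bop V)) (FP f); exact.
have FC f : nm (F f) <= C * nm f.
  rewrite -subr_le0; apply: vanish_cst_le (FP f) _ => n.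
  have h1 := nmD (F f - S n f) (S n f); rewrite subrK in h1.
  have h2 : nm (S n f) <= C * nm f.
    by apply: le_trans (nm_bop _ _) _; rewrite ler_wpM2r ?nm_ge0.
  by rewrite nmBC lerBlDr; exact: le_trans h1 (lerD (lexx _) h2).
have bP : F \in bounded_operator V.
  apply/bounded_operatorP; split=> [c f g|]; first exact: lin.
  by exists C => f; rewrite !norm_nm -rcM lecR.
by exists (Bop bP) => //; exact: nm_bop_le.
Qed.

Lemma measurable_normc (u : T -> R[i]) : cmeasurable u ->
  measurable_fun setT (fun x => normc (u x)).
Proof.
move=> [u1 u2]; rewrite (_ : (fun x => _) = (fun x => Num.sqrt (Re (u x) ^+ 2 + Im (u x) ^+ 2))).
  apply: (@measurableT_comp _ _ _ _ _ _ (@Num.sqrt R)).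
    by apply: continuous_measurable_fun; exact: sqrt_continuous.
  by apply: measurable_funD; exact: measurable_funX.
by apply/funext => x; case: (u x).
Qed.

(* The excess of |f| over M is dominated by |f - u n| for every n. *)
Lemma ae_le_limit u f (M : R) : 0 <= M -> tends u f ->
  (forall n, \forall x \ae mu, normc (u n x) <= M) -> \forall x \ae mu, normc (f x) <= M.
Proof.
move=> M0 uf uM.
pose ex x : R[i] := (Num.max (normc (f x) - M) 0)%:C.
have mex : cmeasurable ex.
  split=> //=; apply: measurable_maxr => //.
  by apply: measurable_funB => //; apply: measurable_normc; exact: cmeasurable_L2.
have ex_le n : \forall x \ae mu, normc (ex x) <= 1 * normc ((f - u n : V) x).
  apply: filterS2 (uM n) (L2_subE f (u n)) => x xM ->; rewrite mul1r normc_real.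
  rewrite ger0_norm ?le_max ?lexx ?orbT// ge_max normc_ge0 andbT.
  have := normcD (f x - u n x) (u n x); rewrite subrK; lra.
have [sex _] := L2class_bounded mex (ex_le 0%N) ler01.
have : L2class mu ex = 0.
  apply: nm0_eq0; apply/eqP; rewrite eq_le nm_ge0 andbT.
  apply: vanish_cst_le uf _ => n.
  by have [_] := L2class_bounded mex (ex_le n) ler01; rewrite mul1r nmBC.
move=> /L2_eqP ex0; apply: filterS3 ex0 (L2classE sex) (L2_zeroE mu) => x e1 e2 e3.
have [/eqP] : ex x = 0 by rewrite -e2 e1.
by rewrite eq_le ge_max => /andP[/andP[+ _] _]; lra.
Qed.

Lemma bounded_dense f (eta : R) : 0 < eta -> exists h, exists2 C : R, 0 <= C &
  nm (f - h) <= eta /\ \forall x \ae mu, normc (h x) <= C.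
Proof.
move=> eta0.
pose E k := [set x | normc (f x) <= k%:R].
have mE k : measurable (E k).
  have := measurable_normc (cmeasurable_L2 f).
  move=> /(_ measurableT _ (measurable_itv `]-oo, k%:R])); rewrite setTI.
  by congr measurable; apply/seteqP; split=> x; rewrite /= in_itv.
pose t k x : R[i] := (\1_(E k) x)%:C * f x.
have mt k : cmeasurable (t k).
  apply: cmeasurableM; last exact: cmeasurable_L2.
  by split=> //=; exact: measurable_indic.
have tf k x : normc (t k x) <= 1 * normc (f x).
  rewrite /t Normc.normcM normc_real mul1r indicE.
  by case: (x \in E k); rewrite ?normr1 ?mul1r// normr0 mul0r normc_ge0.
have st k : sqintegrable mu (t k).
  by have [] := @L2class_bounded _ _ _ mu f _ 1 (mt k) (aeW _ (tf k)) ler01.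
pose h k := L2class mu (t k).
have hE k : \forall x \ae mu, (f - h k : V) x = f x - t k x.
  by apply: filterS2 (L2_subE f (h k)) (L2classE (st k)) => x -> ->.
pose F k x := (normc (f x - t k x) ^+ 2)%:E.
have mF k : measurable_fun setT (F k).
  by apply: cmeasurable_normc2; apply: cmeasurableB => //; exact: cmeasurable_L2.
have F0 k x : x \in E k -> F k x = 0%E.
  by move=> xE; rewrite /F /t indicE xE rc1 mul1r subrr Normc.normc0 expr0n.
have Fle k x : (F k x <= (normc (f x) ^+ 2)%:E)%E.
  have [/F0 ->|/negbTE xE] := boolP (x \in E k); first by rewrite lee_fin sqr_ge0.
  by rewrite /F /t indicE xE rc0 mul0r subr0.
have if2 : mu.-integrable setT (fun x => (normc (f x) ^+ 2)%:E).
  apply/integrableP; split; first exact/cmeasurable_normc2/cmeasurable_L2.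
  under eq_integral do rewrite gee0_abs ?lee_fin ?sqr_ge0//.
  by case: (L2funP f).
have cF x : F^~ x @ \oo --> 0%E.
  apply: cvg_near_cst; exists (Num.truncn (normc (f x))).+1 => // n /= xn.
  rewrite F0// inE /E /=; apply: ltW; apply: lt_le_trans (truncnS_gt _) _.
  by rewrite ler_nat.
have abs_le k x : (`|F k x| <= (normc (f x) ^+ 2)%:E)%E.
  by rewrite gee0_abs// /F lee_fin sqr_ge0.
have [_ _] := @dominated_convergence _ _ _ mu setT measurableT F (cst 0%E)
  (fun x => (normc (f x) ^+ 2)%:E) mF (measurable_cst _)
  (aeW _ (fun x _ => cF x)) if2 (aeW _ (fun x n _ => abs_le n x)).
rewrite integral0 => /fine_cvgP[_ /cvgrPdist_lt/(_ _ (exprn_gt0 2 eta0))[k _]].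
move=> /(_ k (leqnn k)) /=; rewrite sub0r normrN => hk.
exists (h k), k%:R => //; split.
  rewrite -ler_sqr ?nnegrE ?nm_ge0 ?(ltW eta0)//; apply: ltW.
  apply: le_lt_trans hk; apply: le_trans (ler_norm _).
  rewrite -lee_fin fineK; last first.
    have -> : (\int[mu]_x F k x = (nm (f - h k) ^+ 2)%:E)%E.
      rewrite nm_sqr_int; apply: ae_eq_integral => //.
        exact/cmeasurable_normc2/cmeasurable_L2.
      by apply: filterS (hE k) => x -> _.
    by [].
  apply: nm_sqr_le_int; last by apply: filterS (hE k) => x ->.
  by apply: cmeasurableB => //; exact: cmeasurable_L2.
apply: filterS (L2classE (st k)) => x ->; rewrite /t indicE.
have [xE|xE] := boolP (x \in E k); last by rewrite rc0 mul0r Normc.normc0.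
by rewrite rc1 mul1r; rewrite inE in xE.
Qed.

(* Uniform bounds reduce the claim to bounded f, where the difference is dominated by its value at g. *)
Lemma tends_is_mul (phi : nat -> T -> R[i]) psi (M : R) (S : nat -> bop V) (S' : bop V) g f :
  0 <= M -> (forall n, is_mul (S n) (phi n)) -> is_mul S' psi ->
  (forall n x, normc (phi n x) <= M) -> (forall x, normc (psi x) <= M) ->
  (\forall x \ae mu, g x = 1) -> tends (fun n => S n g) (S' g) ->
  tends (fun n => S n f) (S' f).
Proof.
move=> M0 Sphi Spsi phiM psiM g1 Sg eta eta0.
have e1 : 0 < eta / (2 * (2 * M + 1)) by rewrite divr_gt0// mulr_gt0//; lra.
have [h [D D0 [fh hD]]] := bounded_dense f e1.
have Sdiff n : is_mul (S n - S') (fun x => phi n x - psi x).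
  have := is_mulD (Sphi n) (is_mulZ (-1) Spsi); rewrite scaleN1r.
  by apply: is_mul_ext => x; rewrite mulN1r.
have nS n : nm (S n - S') <= 2 * M.
  apply: is_mul_nm (Sdiff n) _ _; first by rewrite mulr_ge0.
  apply: aeW => x; apply: le_trans (normcB _ _) _.
  by have := phiM n x; have := psiM x; lra.
have Sh n : nm ((S n - S') h) <= D * nm ((S n - S') g).
  have e2 : \forall x \ae mu, ((S n - S') g : V) x = phi n x - psi x.
    by apply: filterS2 g1 (Sdiff n g) => x gx ->; rewrite gx mulr1.
  apply: nm_le_ae => //; apply: filterS3 hD (Sdiff n h) e2 => x xD -> ->.
  by rewrite Normc.normcM mulrC ler_wpM2r ?normc_ge0.
have [N NP] := vanishZ D0 Sg (divr_gt0 eta0 (ltr0n R 2)).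
exists N => n /NP Nn.
have -> : S n f - S' f = (S n - S') h + (S n - S') (f - h).
  have hf : h + (f - h) = f by rewrite addrC subrK.
  by rewrite -linearD hf.
apply: le_trans (nmD _ _) _; rewrite [eta]splitr; apply: lerD.
  exact: le_trans (Sh n) Nn.
apply: le_trans (nm_bop _ _) _.
have M1 : 0 < 2 * M + 1 by lra.
apply: (@le_trans _ _ ((2 * M + 1) * (eta / (2 * (2 * M + 1))))).
  by apply: ler_pM; rewrite ?nm_ge0//; apply: le_trans (nS n) _; lra.
by rewrite le_eqVlt; apply/orP; left; apply/eqP; field; rewrite gt_eqF.
Qed.

End strong_limits.

(** * Cotlar's identity, uniform bounds and the limit operator *)

Section hilbert_transform.
Context (R : realType) (rho : {finite_measure set (measurableTypeR R) -> \bar R}).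
Variable (rho_supp : compactly_supported rho).
Local Notation V := (L2 rho).
Variables (g : V) (g1 : \forall x \ae rho, g x = 1).
Variables (M : R) (M0 : 0 <= M)
  (HM : forall l, 0 < Im l -> normc (borel_transform rho l) <= M).
Implicit Types (f h : V) (e : R) (l : R[i]).

Local Notation A := (mul_id rho_supp).
Local Notation B := (rank_one g).
Local Notation K := (kop g1).

Let bfun e (x : R) := cauchy_fun g e g x.

Let bfun_le e x : 0 < e -> normc (bfun e x) <= M.
Proof.
move=> e0; have l0 : Im (x +i* e) != 0 by rewrite /= gt_eqF.
have := HM (_ : 0 < Im (x +i* e)); rewrite -(dot_resolvent_borel g1 l0).
by rewrite resolvent_conj//; exact.
Qed.

Let cmeasurable_conj (F : R -> R[i]) : @cmeasurable _ (measurableTypeR R) R F ->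
  @cmeasurable _ (measurableTypeR R) R (fun x => (F x)^*).
Proof.
move=> [F1 F2]; split.
  by rewrite (_ : (fun x => _) = (fun x => Re (F x)))//; apply/funext => x; case: (F x).
rewrite (_ : (fun x => _) = (fun x => - Im (F x))); first exact: measurableT_comp.
by apply/funext => x; case: (F x).
Qed.

Let ex_mb e : exists N : bop V * bop V, 0 < e ->
  is_mul N.1 (bfun e) /\ is_mul N.2 (fun x => (bfun e x)^*).
Proof.
have [e0|e0] := ltP 0 e; last by exists (0, 0).
have mF : @cmeasurable _ (measurableTypeR R) R (bfun e) by exact: cmeasurable_cauchy_fun.
have [N1 N1P] := @ex_is_mul _ _ _ rho _ M mF M0 (fun x => bfun_le x e0).
have [|N2 N2P] := @ex_is_mul _ _ _ rho _ M (cmeasurable_conj mF) M0.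
  by move=> x; rewrite normc_conj; exact: bfun_le.
by exists (N1, N2).
Qed.

Let mb e := (projT1 (cid (ex_mb e))).1.
Let mc e := (projT1 (cid (ex_mb e))).2.

Let mbP e : 0 < e -> is_mul (mb e) (bfun e).
Proof. by rewrite /mb; case: cid => N /= h /h[]. Qed.

Let mcP e : 0 < e -> is_mul (mc e) (fun x => (bfun e x)^*).
Proof. by rewrite /mc; case: cid => N /= h /h[]. Qed.

Let mb_g e : 0 < e -> mb e g = K e g.
Proof.
move=> e0; apply/L2_eqP; apply: filterS3 (mbP e0 g) g1 (kopE g1 g e0) => x -> -> ->.
by rewrite mulr1.
Qed.

Let KA e h : 0 < e -> K e (A h) = A (K e h) + (('i * e%:C) *: K e h + B h).
Proof.
move=> e0; apply/eqP; rewrite addrC -subr_eq; apply/eqP.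
exact: (congr1 (fun N : bop V => N h) (kop_sylvester rho_supp g1 e0)).
Qed.

Let mulA_comm (N : bop V) phi h : is_mul N phi -> N (A h) = A (N h).
Proof.
move=> Np; exact: (congr1 (fun N : bop V => N h) (is_mulC Np (is_mul_id rho_supp))).
Qed.

Let lin3 (N : bop V) c u v w : N (u + (c *: v + w)) = N u + (c *: N v + N w).
Proof. by rewrite linearD linearD linearZ. Qed.

Let linB (N : bop V) u v w : N (u - (v - w)) = N u - (N v - N w).
Proof. by rewrite linearB linearB. Qed.

(* Both sides solve the same Sylvester equation with parameter e + d. *)
Lemma cotlar e d : 0 < e -> 0 < d -> K e * K d = mb e * K (e + d) - K (e + d) * mc d.
Proof.
move=> e0 d0; have s0 : 0 < e + d by rewrite addr_gt0.
apply/eqP; rewrite -subr_eq0; apply/eqP.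
apply: (sylvester_eq0 (symmetric_mul_id rho_supp) s0); apply/bopP => f.
have f1 : K e (K d (A f)) = A (K e (K d f)) + (('i * e%:C) *: K e (K d f) + B (K d f))
    + (('i * d%:C) *: K e (K d f) + K e (B f)).
  by rewrite (KA f d0) lin3 (KA (K d f) e0).
have f2 : mb e (K (e + d) (A f)) =
    A (mb e (K (e + d) f)) + (('i * (e + d)%:C) *: mb e (K (e + d) f) + mb e (B f)).
  by rewrite (KA f s0) lin3 (mulA_comm _ (mbP e0)).
have f3 : K (e + d) (mc d (A f)) = A (K (e + d) (mc d f)) +
    (('i * (e + d)%:C) *: K (e + d) (mc d f) + B (mc d f)).
  by rewrite (mulA_comm _ (mcP d0)) (KA (mc d f) s0).
have BZ (N : bop V) : N (B f) = L2dot f g *: N g by exact: linearZ.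
(* The rank one sources cancel: [mb e] and [K e] agree on [g], and skewness turns [B (K d f)] into
   [- B (mc d f)]. *)
have f4 : mb e (B f) = K e (B f) by rewrite !BZ mb_g.
have f5 : B (K d f) = - B (mc d f).
  rewrite !rank_oneE -scaleNr (kop_skew rho_supp g1 d0) -mb_g//; congr (- _ *: _).
  have := is_mul_adj g f (mbP d0) (mcP d0); rewrite (L2dotC _ f) (L2dotC g) => e1.
  by rewrite -[LHS]conjcK e1 conjcK.
suff : K e (K d (A f)) - (mb e (K (e + d) (A f)) - K (e + d) (mc d (A f))) -
    A (K e (K d f) - (mb e (K (e + d) f) - K (e + d) (mc d f))) =
    ('i * (e + d)%:C) *: (K e (K d f) - (mb e (K (e + d) f) - K (e + d) (mc d f))) by [].
rewrite f1 f2 f3 f4 f5 linB.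
by apply: commutator_combination; rewrite rcD mulrDr.
Qed.

(** By skewness $|K_cf|^2=-(f,K_c^2f)$, so a bound on the square controls the norm, and [cotlar]
    with equal parameters doubles the scale. Going up in scale keeps the crude bound [nm_kop_inv]
    uniform, as [sup_self_improve] requires. *)
Lemma nm_kop_le e : 0 < e -> nm (K e) <= 2 * M.
Proof.
move=> e0; have [a aE] : exists a : R^nat, forall k, a k = nm (K (2 ^+ k * e)).
  by exists (fun k => nm (K (2 ^+ k * e))).
have a0 k : 0 <= a k by rewrite aE nm_ge0.
have ek k : 0 < 2 ^+ k * e by rewrite mulr_gt0// exprn_gt0.
have -> : nm (K e) = a 0%N by rewrite aE expr0 mul1r.
apply: (@sup_self_improve R a M (nm g ^+ 2 * e^-1) M0) => k; first exact: a0.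
  rewrite aE; apply: le_trans (nm_kop_inv g1 (ek k)) _; rewrite ler_wpM2l ?sqr_ge0//.
  by rewrite lef_pV2 ?posrE// ler_peMl ?(ltW e0)// exprn_ege1// ler1n.
set c := 2 ^+ k * e.
have c0 : 0 < c by exact: ek.
have cc : c + c = 2 ^+ k.+1 * e by rewrite exprS /c; ring.
have nmb : nm (mb c) <= M.
  by apply: is_mul_nm (mbP c0) M0 (aeW _ _) => x; exact: bfun_le.
have nmc : nm (mc c) <= M.
  by apply: is_mul_nm (mcP c0) M0 (aeW _ _) => x; rewrite normc_conj; exact: bfun_le.
have nKK : nm (K c * K c) <= 2 * M * a k.+1.
  rewrite cotlar// cc; apply: le_trans (nmB _ _) _.
  have h1 := nm_bopM (mb c) (K (2 ^+ k.+1 * e)).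
  have h2 := nm_bopM (K (2 ^+ k.+1 * e)) (mc c).
  rewrite -aE in h1 h2.
  have h3 := ler_wpM2r (a0 k.+1) nmb.
  have h4 := ler_wpM2l (a0 k.+1) nmc.
  apply: le_trans (lerD (le_trans h1 h3) (le_trans h2 h4)) _.
  by rewrite le_eqVlt; apply/orP; left; apply/eqP; ring.
rewrite aE -/c.
have r0 : 0 <= 2 * M * a k.+1 by rewrite !mulr_ge0.
rewrite -[leRHS]sqr_sqrtr// ler_sqr ?nnegrE ?nm_ge0 ?sqrtr_ge0//.
apply: nm_bop_le => [|f]; first exact: sqrtr_ge0.
rewrite -ler_sqr ?nnegrE ?nm_ge0 ?mulr_ge0 ?sqrtr_ge0 ?nm_ge0// exprMn sqr_sqrtr//.
have -> : nm (K c f) ^+ 2 = normc (L2dot (K c f) (K c f)).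
  by rewrite L2dotff_nm normc_real ger0_norm ?sqr_ge0.
rewrite (kop_skew rho_supp g1 c0) normcN; apply: le_trans (L2dot_le _ _) _.
rewrite expr2 mulrA [leRHS]mulrC ler_wpM2l ?nm_ge0//.
apply: le_trans (nm_bop (K c * K c) f) _; by rewrite ler_wpM2r ?nm_ge0.
Qed.

Let E n : R := 2^-1 ^+ n.

Let E0 n : 0 < E n. Proof. by rewrite exprn_gt0// invr_gt0. Qed.

Let EE n : E n.+1 + E n.+1 = E n.
Proof. by rewrite /E exprSr -splitr. Qed.

Let E_decr n m : (n <= m)%N -> E m <= E n.
Proof.
move=> /subnKC <-; rewrite /E exprD ler_piMr ?exprn_ge0 ?invr_ge0//.
by rewrite exprn_ile1// ?invr_ge0//; lra.
Qed.

Let k n := K (E n).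

Let nk n : nm (k n) <= 2 * M. Proof. exact: nm_kop_le. Qed.

(* The operators - i k n increase and are bounded above. *)
Let k_cvg f : exists F, tends (fun n => k n f) F.
Proof.
pose p n := Im (L2dot (k n f) f).
have pB n m : Im (L2dot ((k m - k n) f) f) = p m - p n.
  by rewrite bopB L2dotBl raddfB.
have [||l [pl vl]] := @vanish_sup R p (2 * M * nm f ^+ 2).
- by move=> n; rewrite -subr_ge0 -pB; apply: kop_decr => //; exact: E_decr.
- move=> n; apply: le_trans (ler_norm _) _; apply: le_trans (ler_abs_Im _) _.
  apply: le_trans (L2dot_le _ _) _; rewrite expr2 mulrA; apply: ler_wpM2r; first exact: nm_ge0.
  by apply: le_trans (nm_bop _ _) _; exact: (ler_wpM2r (nm_ge0 _) (nk n)).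
(* Two uses of [nk] bound a difference by [4 * M], and 1 is added for positivity. Through
   [skew_nm_le], convergence of the quadratic forms becomes convergence in norm. *)
pose C := 4 * M + 1; have C0 : 0 < C by rewrite /C ltr_wpDl// mulr_ge0.
have key n m : (n <= m)%N -> nm (k m f - k n f) ^+ 2 <= C * (l - p n).
  move=> nm_.
  have sX : skew_bop (k m - k n) by apply: skewB; exact: (kop_skew rho_supp).
  have nX : nm (k m - k n) <= C.
    apply: le_trans (nmB _ _) _; apply: le_trans (lerD (nk m) (nk n)) _.
    by rewrite /C -subr_ge0 (_ : _ - _ = 1) ?ler01//; ring.
  have X0 h : 0 <= Im (L2dot ((k m - k n) h) h).
    by apply: (kop_decr rho_supp) => //; exact: E_decr.
  apply: le_trans (skew_nm_le f sX C0 nX X0) _; rewrite pB.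
  by apply: ler_wpM2l; [exact: ltW|rewrite lerD2r; exact: pl].
apply: L2_cauchy_cvg => eta eta0.
have [N NP] := vanishZ (ltW C0) vl (exprn_gt0 2 (divr_gt0 eta0 (ltr0n R 2))).
have half m : (N <= m)%N -> nm (k m f - k N f) <= eta / 2.
  move=> Nm; rewrite -ler_sqr ?nnegrE ?nm_ge0 ?divr_ge0 ?(ltW eta0)//.
  exact: le_trans (key _ _ Nm) (NP _ (leqnn _)).
exists N => n m Nn Nm.
have -> : k n f - k m f = (k n f - k N f) - (k m f - k N f) by rewrite opprB addrA subrK.
by apply: le_trans (nmB _ _) _; rewrite [eta]splitr; apply: lerD; exact: half.
Qed.

Theorem ex_hilbert_transform : exists (H Mb Mc : bop V) (b : R -> R[i]),
  [/\ H * A - A * H = B, skew_bop H, Mb g = H g &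
      H * H = Mb * H - H * Mc] /\
  [/\ @cmeasurable _ (measurableTypeR R) R b, forall x, normc (b x) <= M,
      is_mul Mb b & is_mul Mc (fun x => (b x)^*)].
Proof.
have [H nH HP] := ex_strong_limit nk k_cvg.
pose hg : V := H g.
pose S := [set x | normc (hg x) <= M].
have mHg : @cmeasurable _ (measurableTypeR R) R hg by exact: cmeasurable_L2.
have mS : measurable (S : set (measurableTypeR R)).
  have := measurable_normc mHg.
  move=> /(_ measurableT _ (measurable_itv `]-oo, M])); rewrite setTI.
  by congr measurable; apply/seteqP; split=> x; rewrite /= in_itv.
(* [H g] obeys the bound [M] only almost everywhere; cutting it off gives a symbol bounded at every
   point, as [ex_is_mul] asks. *)
pose b x : R[i] := (\1_S x)%:C * hg x.
have mb_ : @cmeasurable _ (measurableTypeR R) R b.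
  apply: cmeasurableM => //.
  by split=> //=; exact: measurable_indic.
have bM x : normc (b x) <= M.
  rewrite /b indicE; have [xS|xS] := boolP (x \in S); last by rewrite rc0 mul0r Normc.normc0.
  by rewrite rc1 mul1r; rewrite inE in xS.
have bH : \forall x \ae rho, b x = hg x.
  have : \forall x \ae rho, normc (hg x) <= M.
    apply: ae_le_limit M0 (HP g) _ => n.
    by apply: filterS (kopE g1 g (E0 n)) => x ->; exact: bfun_le.
  apply: filterS => x xM; rewrite /b indicE mem_set ?rc1 ?mul1r//.
have [Mb MbP] := @ex_is_mul _ _ _ rho _ M mb_ M0 bM.
have [|Mc McP] := @ex_is_mul _ _ _ rho _ M (cmeasurable_conj mb_) M0.
  by move=> x; rewrite normc_conj.
have Mbg : Mb g = H g.
  by apply/L2_eqP; apply: filterS3 (MbP g) g1 bH => x -> -> ->; rewrite mulr1.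
exists H, Mb, Mc, b; split; last by split.
have tb f : tends (fun n => mb (E n) f) (Mb f).
  refine (@tends_is_mul _ _ _ rho (fun n => bfun (E n)) b M (fun n => mb (E n)) Mb g f M0 _ MbP _ bM g1 _).
  - by move=> n; exact: mbP.
  - by move=> n x; exact: bfun_le.
  - by rewrite Mbg; apply: tends_ext (HP g) => n; rewrite mb_g.
have tc f : tends (fun n => mc (E n) f) (Mc f).
  refine (@tends_is_mul _ _ _ rho (fun n x => (bfun (E n) x)^*) _ M (fun n => mc (E n)) Mc g f M0 _ McP _ _ g1 _).
  - by move=> n; exact: mcP.
  - by move=> n x; rewrite normc_conj; exact: bfun_le.
  - by move=> x; rewrite normc_conj.
  (* Conjugation preserves moduli, so on [g] the conjugate multipliers converge as fast as the
     multipliers. *)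
  apply: vanish_le (tb g) => n; rewrite -[leRHS]mul1r; apply: nm_le_ae => //.
  have e1 : \forall x \ae rho, (mb (E n) g - Mb g : V) x = (bfun (E n) x - b x) * g x.
    by apply: filterS3 (L2_subE (mb (E n) g) (Mb g)) (mbP (E0 n) g) (MbP g) => x -> -> ->; ring.
  have e2 : \forall x \ae rho, (mc (E n) g - Mc g : V) x = (bfun (E n) x - b x)^* * g x.
    apply: filterS3 (L2_subE (mc (E n) g) (Mc g)) (mcP (E0 n) g) (McP g) => x -> -> ->.
    by rewrite rmorphB; ring.
  apply: filterS2 e1 e2 => x -> ->.
  by rewrite mul1r !Normc.normcM normc_conj.
split=> //.
- apply/bopP => f; apply/eqP; rewrite -[B f]add0r; apply/eqP.
  suff : H (A f) - A (H f) = 0 + B f by [].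
  apply/eqP; rewrite subr_eq addrC; apply/eqP.
  apply: tends_uniq (HP (A f)) _.
  apply: (@tends_ext _ _ _ _ (fun n => A (k n f) + (('i * (E n)%:C) *: k n f + B f))).
    by move=> n; rewrite -KA.
  apply: tendsD; first exact: tends_bop.
  apply: tendsD; last exact: tends_cst.
  apply: vanish_le (vanishZ (_ : 0 <= 2 * M * nm f) vanish_half) => [n|].
    rewrite subr0 nmZ Normc.normcM normc_i mul1r normc_real ger0_norm ?(ltW (E0 n))// mulrC.
    apply: ler_wpM2r; first exact: ltW.
    by apply: le_trans (nm_bop _ _) _; exact: (ler_wpM2r (nm_ge0 _) (nk n)).
  by rewrite !mulr_ge0 ?nm_ge0.
- move=> f h; apply/eqP; rewrite -subr_eq0 opprK -normc_eq0 eq_le normc_ge0 andbT.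
  apply: vanish_cst_le (vanishD (vanishZ (nm_ge0 h) (HP f)) (vanishZ (nm_ge0 f) (HP h))) _ => n.
  have -> : L2dot (H f) h + L2dot f (H h) =
      - L2dot (k n f - H f) h - L2dot f (k n h - H h).
    by rewrite L2dotBl L2dotBr (kop_skew rho_supp g1 (E0 n)); ring.
  apply: le_trans (normcB _ _) _; rewrite normcN; apply: lerD.
    by rewrite mulrC; exact: L2dot_le.
  exact: L2dot_le.
- apply/bopP => f; suff : H (H f) = Mb (H f) - H (Mc f) by [].
  apply: (@tends_uniq _ _ _ _ (fun n => k n.+1 (k n.+1 f))).
    exact: (tends_shift (tends_comp nk (HP f) (HP (H f)))).
  (* The index shift comes from [EE]: two parameters [E n.+1] add up to [E n] in [cotlar]. *)
  apply: (@tends_ext _ _ _ _ (fun n => mb (E n.+1) (k n f) - k n (mc (E n.+1) f))).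
    move=> n; have := congr1 (fun N : bop V => N f) (cotlar (E0 n.+1) (E0 n.+1)).
    by rewrite EE => e1; symmetry; exact: e1.
  apply: tendsB.
    apply: (tends_comp (C := M)); [|exact: HP|exact: (tends_shift (tb (H f)))].
    move=> n; apply: is_mul_nm (mbP (E0 n.+1)) M0 (aeW _ _) => x; exact: bfun_le.
  exact: tends_comp nk (tends_shift (tc f)) (HP (Mc f)).
Qed.

End hilbert_transform.

(** * The holomorphic similarity *)

Section operator_derivative.
Context {R : realType} {V : normedModType R[i]}.
Lemma derivableP_real (F : R[i]^o -> bop V) (z : R[i]) : derivable F z 1 <->
  exists D : bop V, forall eta : R, 0 < eta -> exists2 del : R, 0 < del &
    forall w, w != z -> normc (w - z) < del -> nm ((w - z)^-1 *: (F w - F z) - D) <= eta.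
Proof.
split.
  move=> /cvg_ex[D /cvgrPdist_lt h]; exists D => eta eta0.
  have := h eta%:C; rewrite rc_gt0 => /(_ eta0).
  move=> /nbhs_normP[e /= /complex_gt0P[del del0 ->] he]; exists del => // w wz wd.
  have := he (w - z); rewrite /= sub0r normrN normc_ltE => /(_ wd).
  rewrite subr_eq0 => /(_ wz); rewrite [_%:A](_ : _ = w - z); last exact: mulr1.
  by rewrite subrK nm_lt nmBC => /ltW.
move=> [D hD]; apply/cvg_ex; exists D; apply/cvgrPdist_lt => _ /complex_gt0P[eta eta0 ->].
have [del del0 hd] := hD _ (divr_gt0 eta0 (ltr0n R 2)).
apply/nbhs_normP; exists del%:C; first by rewrite /= rc_gt0.
move=> h /=; rewrite sub0r normrN normc_ltE => hdel h0.
rewrite [_%:A](_ : _ = h); last exact: mulr1.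
have := hd (h + z); rewrite addrK => /(_ _ hdel).
rewrite -subr_eq0 addrK => /(_ h0) hh.
rewrite nm_lt nmBC; apply: le_lt_trans hh _; lra.
Qed.

(* The quadratic remainder is what makes products easy to differentiate. *)
Definition qdiff (F : R[i]^o -> bop V) (z : R[i]) := exists D : bop V,
  exists2 C : R, 0 <= C & exists2 del : R, 0 < del & forall w, normc (w - z) < del ->
    nm (F w - F z - (w - z) *: D) <= C * normc (w - z) ^+ 2.

Lemma qdiff_derivable F z : qdiff F z -> derivable F z 1.
Proof.
move=> [D [C C0 [del del0 h]]]; apply/derivableP_real; exists D => eta eta0.
have C1 : 0 < C + 1 by lra.
exists (Num.min del (eta / (C + 1))); first by rewrite lt_min del0 divr_gt0.
move=> w wz; rewrite lt_min => /andP[/h hw wd].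
have wz0 : w - z != 0 by rewrite subr_eq0.
have nwz : 0 < normc (w - z) by rewrite normc_gt0.
have -> : (w - z)^-1 *: (F w - F z) - D = (w - z)^-1 *: (F w - F z - (w - z) *: D).
  by rewrite [RHS]scalerBr scalerA mulVf// scale1r.
rewrite nmZ Normc.normcV ler_pdivrMl//; apply: le_trans hw _.
rewrite expr2 mulrCA ler_wpM2l ?normc_ge0//.
move: wd; rewrite ltr_pdivlMr// => wd.
have : C * normc (w - z) <= normc (w - z) * (C + 1) by rewrite mulrDr mulr1 mulrC lerDl ltW.
by lra.
Qed.

Lemma qdiff_lip F z : qdiff F z -> exists2 L : R, 0 <= L & exists2 del : R, 0 < del &
  forall w, normc (w - z) < del -> nm (F w - F z) <= L * normc (w - z).
Proof.
move=> [D [C C0 [del del0 h]]]; exists (C + nm D); first by rewrite addr_ge0 ?nm_ge0.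
exists (Num.min del 1); first by rewrite lt_min del0 ltr01.
move=> w; rewrite lt_min => /andP[/h hw w1].
rewrite -[F w - F z](subrK ((w - z) *: D)); apply: le_trans (nmD _ _) _.
rewrite nmZ mulrDl [nm D * _]mulrC lerD2r; apply: le_trans hw _.
by rewrite ler_wpM2l// expr2 ler_piMr ?normc_ge0 ?ltW.
Qed.

Lemma sandwich_expand (W : pzRingType) (x0 dx y0 dy s p q : W) :
  (x0 + dx) * s * (y0 + dy) - x0 * s * y0 - (p * s * y0 + x0 * s * q) =
  (dx - p) * (s * y0) + x0 * s * (dy - q) + dx * s * dy.
Proof.
rewrite mulrDl mulrDr !mulrDl !mulNr mulrDr mulrN !mulrA -(addrA (x0 * s * y0)).
rewrite [_ + _ - x0 * s * y0]addrC addKr opprD addrACA -[RHS]addrA.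
by congr (_ + _); rewrite addrAC.
Qed.

(** The fixed middle factor will be [phi(A)], whose conjugate by the holomorphic family is the
    continuation required in FH. *)
Lemma qdiffM_sandwich F G (S : bop V) z : qdiff F z -> qdiff G z ->
  qdiff (fun w => F w * S * G w) z.
Proof.
move=> dF dG; have [L L0 [del1 del10 hL]] := qdiff_lip dF.
have [L' L'0 [del2 del20 hL']] := qdiff_lip dG.
move: dF dG => [D [C C0 [del3 del30 hC]]] [D' [C' C'0 [del4 del40 hC']]].
exists (D * S * G z + F z * S * D').
exists (C * nm (S * G z) + nm (F z * S) * C' + L * nm S * L').
  by rewrite !addr_ge0// ?mulr_ge0 ?nm_ge0.
exists (Num.min (Num.min del1 del2) (Num.min del3 del4)); first by rewrite !lt_min del10 del20 del30.
move=> w; rewrite !lt_min => /andP[/andP[/hL h1 /hL' h2] /andP[/hC h3 /hC' h4]].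
set e := w - z in h1 h2 h3 h4 *.
have -> : F w * S * G w - F z * S * G z - e *: (D * S * G z + F z * S * D') =
    (F w - F z - e *: D) * (S * G z) + F z * S * (G w - G z - e *: D') +
    (F w - F z) * S * (G w - G z).
  rewrite -sandwich_expand ![_ + (_ - _)]addrC !subrK scalerDr.
  by rewrite !bopZAl bopZAr.
apply: le_trans (nmD _ _) _; rewrite [leRHS]mulrDl; apply: lerD.
  rewrite [leRHS]mulrDl; apply: le_trans (nmD _ _) _; apply: lerD; apply: le_trans (nm_bopM _ _) _.
    rewrite -mulrA [nm (S * G z) * _]mulrC mulrA.
    by apply: ler_wpM2r h3; exact: nm_ge0.
  by rewrite -mulrA; apply: ler_wpM2l h4; exact: nm_ge0.
apply: le_trans (nm_bopM _ _) _.
have -> : L * nm S * L' * normc e ^+ 2 = (L * normc e * nm S) * (L' * normc e) by ring.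
apply: ler_pM => //; rewrite ?nm_ge0//; apply: le_trans (nm_bopM _ _) _.
by apply: ler_wpM2r h1; exact: nm_ge0.
Qed.

End operator_derivative.

Lemma addr_telescope (Z : zmodType) (x y n : Z) : x + (y - n - (x - n)) = y.
Proof. by rewrite opprB (addrA (y - n)) (subrK n) [LHS]addrC subrK. Qed.

Lemma subr_telescope (Z : zmodType) (x a b c : Z) :
  x - a - (x - b) - - c = - (a - b - c).
Proof. by rewrite opprK !opprB (addrC _ (b - x)) subrKA addrC. Qed.

Lemma mulbop1_comm (R : realType) (V : normedModType R[i]) (X Y : bop V) :
  X * Y = 1 -> (forall f, X f = 0 -> f = 0) -> Y * X = 1.
Proof.
move=> XY X0; apply/bopP => f; apply/eqP; rewrite -subr_eq0; apply/eqP; apply: X0.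
have e : X ((Y * X) f) = X f by rewrite -(bopM X) mulrA XY mul1r.
by rewrite linearB; apply/eqP; rewrite subr_eq0; apply/eqP.
Qed.

(** * Construction of the intertwining family *)

Section unitary_family.
Context d (T : measurableType d) (R : realType).
Variable mu : {measure set T -> \bar R}.
Local Notation V := (L2 mu).
Implicit Types (f h : V) (z w : R[i]).
Variables (A : bop V) (a : T -> R[i]) (Aa : is_mul A a) (g : V).
Local Notation B := (rank_one g).

Lemma cmeasurable_cst (c : R[i]) : @cmeasurable _ T R (cst c).
Proof. by split; exact: measurable_cst. Qed.

Lemma cmeasurableV (u : T -> R[i]) : cmeasurable u -> cmeasurable (fun x => (u x)^-1).
Proof.
move=> mu_; have [u1 u2] := mu_.
have mi : measurable_fun setT (fun x => (normc (u x) ^+ 2) `^ (-1)).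
  apply: (measurableT_comp (measurable_powR _)).
  by apply: measurable_funX; exact: measurable_normc.
split.
  rewrite (_ : (fun x => _) = (fun x => Re (u x) * (normc (u x) ^+ 2) `^ (-1))).
    exact: measurable_funM.
  apply/funext => x; rewrite powR_inv1 ?sqr_ge0// sqr_normcE.
  by case: (u x) => p q.
rewrite (_ : (fun x => _) = (fun x => - (Im (u x) * (normc (u x) ^+ 2) `^ (-1)))).
  by apply: measurableT_comp => //; exact: measurable_funM.
apply/funext => x; rewrite powR_inv1 ?sqr_ge0// sqr_normcE.
by case: (u x) => p q /=; rewrite -?mulNr.
Qed.

Section reciprocals.
Variables (b : T -> R[i]) (M : R) (M0 : 0 <= M) (mb : cmeasurable b)
  (bM : forall x, normc (b x) <= M) (Mb : bop V) (MbP : is_mul Mb b).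

Let half_le z x : normc z * M <= 2^-1 -> 2^-1 <= normc (1 + z * b x).
Proof.
move=> zM; have := normcB (1 + z * b x) (z * b x); rewrite addrK Normc.normc1 Normc.normcM.
by have := ler_wpM2l (normc_ge0 z) (bM x); lra.
Qed.

Let den_neq0 z x : normc z * M <= 2^-1 -> 1 + z * b x != 0.
Proof. by move=> zM; have := @half_le z x zM; rewrite -normc_gt0; lra. Qed.

Let inv_le z x : normc z * M <= 2^-1 -> normc (1 + z * b x)^-1 <= 2.
Proof.
move=> zM; have h := @half_le z x zM; rewrite Normc.normcV -[leRHS]invrK lef_pV2 ?posrE//.
exact: lt_le_trans h.
Qed.

Let ex_rec z : exists N : bop V, normc z * M <= 2^-1 ->
  is_mul N (fun x => (1 + z * b x)^-1).
Proof.
have [zM|zM] := leP (normc z * M) 2^-1; last by exists 0.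
have [N NP] := @ex_is_mul _ _ _ mu (fun x => (1 + z * b x)^-1) 2
  (cmeasurableV (cmeasurableD (cmeasurable_cst 1) (cmeasurableM (cmeasurable_cst z) mb)))
  (ler0n R 2) (fun x => @inv_le z x zM).
by exists N.
Qed.

Definition recop z : bop V := projT1 (cid (ex_rec z)).

Lemma recopP z : normc z * M <= 2^-1 -> is_mul (recop z) (fun x => (1 + z * b x)^-1).
Proof. by rewrite /recop; case: cid. Qed.

Lemma nm_recop z : normc z * M <= 2^-1 -> nm (recop z) <= 2.
Proof.
move=> zM; apply: is_mul_nm (recopP zM) (ler0n _ _) _.
by apply: aeW => x; exact: inv_le.
Qed.

Lemma recop_mul z f : normc z * M <= 2^-1 -> z *: recop z (Mb f) = f - recop z f.
Proof.
move=> zM.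
have h1 := is_mulZ z (is_mulM (recopP zM) MbP).
have h2 := is_mulD (@is_mul1 _ _ _ mu) (is_mulZ (-1) (recopP zM)).
have e : z *: (recop z * Mb) = 1 + (-1) *: recop z.
  apply: (is_mul_uniq h1); apply: is_mul_ext h2 => x.
  by have := @den_neq0 z x zM => n0; rewrite /cst /=; field.
have := congr1 (fun N : bop V => N f) e; rewrite scaleN1r; exact.
Qed.

Lemma mul_recop z f : normc z * M <= 2^-1 -> z *: Mb (recop z f) = f - recop z f.
Proof.
move=> zM; rewrite -recop_mul//; congr (_ *: _).
exact: (congr1 (fun N : bop V => N f) (is_mulC MbP (recopP zM))).
Qed.

(** The derivative of $w/(1+wb)$ at $z$ is $(1+zb)^{-2}$. The exact remainder is $(w-z)^2$ times [b]
    and three reciprocals, each of modulus at most 2, whence [8 * M]. *)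
Lemma qdiff_recop z : normc z * M < 2^-1 -> qdiff (fun w => w *: recop w) z.
Proof.
move=> zM; exists (recop z * recop z); exists (8 * M); first by rewrite mulr_ge0.
have M1 : 0 < M + 1 by rewrite ltr_wpDl.
pose del := (2^-1 - normc z * M) / (M + 1).
have del0 : 0 < del by rewrite divr_gt0// subr_gt0.
exists del => // w wz.
have wM : normc w * M <= 2^-1.
  have h : normc w <= normc (w - z) + normc z by have := normcD (w - z) z; rewrite subrK.
  have h1 := ler_wpM2r M0 h.
  have h2 : normc (w - z) * M <= normc (w - z) * (M + 1) by rewrite ler_wpM2l ?normc_ge0// lerDl ler01.
  have h3 : normc (w - z) * (M + 1) < 2^-1 - normc z * M by rewrite -ltr_pdivlMr.
  rewrite mulrDl in h1; apply: le_trans h1 _.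
  by have := le_lt_trans h2 h3; rewrite ltrBrDr => /ltW.
have zM' := ltW zM.
have h1 := is_mulZ w (recopP wM); have h2 := is_mulZ (-1) (is_mulZ z (recopP zM')).
have h3 := is_mulZ (- (w - z)) (is_mulM (recopP zM') (recopP zM')).
have h := is_mulD (is_mulD h1 h2) h3; rewrite scaleN1r scaleNr in h.
apply: (is_mul_nm h); first exact: mulr_ge0 (mulr_ge0 (ler0n _ 8) M0) (sqr_ge0 _).
apply: aeW => x; have n1 := @den_neq0 w x wM; have n2 := @den_neq0 z x zM'.
have -> : w * (1 + w * b x)^-1 + -1 * (z * (1 + z * b x)^-1) +
    - (w - z) * ((1 + z * b x)^-1 * (1 + z * b x)^-1) =
  - ((w - z) ^+ 2 * (b x * ((1 + w * b x)^-1 * ((1 + z * b x)^-1 * (1 + z * b x)^-1)))).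
  by field; rewrite n1 n2.
rewrite normcN Normc.normcM; rewrite normcX [leRHS]mulrC; apply: ler_wpM2l; first exact: sqr_ge0.
rewrite Normc.normcM [leRHS]mulrC; apply: ler_pM; rewrite ?normc_ge0//.
have -> : 8 = 2 * (2 * 2) :> R by ring.
rewrite !Normc.normcM; apply: ler_pM; rewrite ?mulr_ge0 ?normc_ge0 ?inv_le//.
by apply: ler_pM; rewrite ?normc_ge0 ?inv_le.
Qed.

End reciprocals.

(* The quadratic relation for H makes U = 1 - z (1 + z b)^-1 H and
   W = 1 + z H (1 + z b^* )^-1 mutually inverse, and the commutator relation
   gives A U = U (A + z B). *)
Section unitary.
Variables (H Mb Mc : bop V) (b : T -> R[i]) (M : R) (M0 : 0 <= M) (mb : cmeasurable b)
  (bM : forall x, normc (b x) <= M) (MbP : is_mul Mb b)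
  (McP : is_mul Mc (fun x => (b x)^*))
  (HA : H * A - A * H = B) (skH : skew_bop H) (Mbg : Mb g = H g)
  (HH : H * H = Mb * H - H * Mc).

Let mc : cmeasurable (fun x => (b x)^*).
Proof.
have [m1 m2] := mb; split.
  by apply: eq_measurable_fun m1 => x _; case: (b x).
apply: (@eq_measurable_fun _ _ _ _ _ (fun x => - Im (b x))).
  by move=> x _; case: (b x).
exact: measurableT_comp.
Qed.

Let cM x : normc (b x)^* <= M. Proof. by rewrite normc_conj. Qed.

Let N := recop mb bM.
Let N' := recop mc cM.
Let U z : bop V := 1 - z *: (N z * H).
Let W z : bop V := 1 + z *: (H * N' z).


(** All of the quadratic relation for [H] is used up in this intertwining, after which [U z * W z]
    telescopes. *)
Let NHW z f : normc z * M <= 2^-1 -> N z (H (W z f)) = H (N' z f).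
Proof.
move=> zM; set y := N' z f.
have e : W z f = f + z *: H y by [].
have e1 : H (H y) = Mb (H y) - H (Mc y) := congr1 (fun S : bop V => S y) HH.
have e2 : z *: N z (Mb (H y)) = H y - N z (H y) by exact: recop_mul.
have e3 : z *: Mc y = f - y by exact: mul_recop.
rewrite e linearD linearZ /= e1 linearD /= !linearZ /= linearB /= scalerBr e2.
have : N z (H (z *: Mc y)) = N z (H f) - N z (H y) by rewrite e3 !linearB.
rewrite linearZ /= linearZ /= => ->.
exact: addr_telescope.
Qed.

Let UW z : normc z * M <= 2^-1 -> U z * W z = 1.
Proof.
move=> zM; apply/bopP => f.
have e : (U z * W z) f = W z f - z *: N z (H (W z f)) by [].
by rewrite e NHW// addrK.
Qed.

Let AN z : normc z * M <= 2^-1 -> N z * A = A * N z.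
Proof. by move=> zM; apply: is_mulC Aa; exact: recopP. Qed.

(** From [H B = b B] the perturbation completes [B] to [(1 + z b) B], which the reciprocal
    cancels. *)
Let AU z : normc z * M <= 2^-1 -> A * U z = U z * (A + z *: B).
Proof.
move=> zM; apply/bopP => f.
have eA : N z (A (H f)) = A (N z (H f)) := congr1 (fun S : bop V => S (H f)) (AN zM).
have e1 : H (A f) = A (H f) + B f.
  by have := congr1 (fun S : bop V => S f) HA; rewrite bopB => <-; rewrite addrC subrK.
have e2 : H (B f) = Mb (B f) by have -> : B f = L2dot f g *: g by []; rewrite !linearZ /= Mbg.
have e3 : z *: N z (Mb (B f)) = B f - N z (B f) by exact: recop_mul.
have e4 : N z (H (A f + z *: B f)) = A (N z (H f)) + B f.
  rewrite linearD linearD /= linearZ /= linearZ /= e1 linearD /= eA e2 e3.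
  by rewrite -addrA; congr (_ + _); rewrite addrC subrK.
have e5 : (U z * (A + z *: B)) f = A f + z *: B f - z *: N z (H (A f + z *: B f)) by [].
have e6 : (A * U z) f = A (f - z *: N z (H f)) by [].
rewrite e5 e6 e4 linearB linearZ /= scalerDr opprD addrACA.
by rewrite [X in _ = _ + X]subrr addr0.
Qed.

(** Upgrades the one-sided inverse [UW] to a two-sided one: [z *: (N z * H)] has norm at most one
    half. *)
Let U_inj z f : normc z * M <= 2^-1 -> 4 * (normc z * nm H) <= 1 -> U z f = 0 -> f = 0.
Proof.
move=> zM zH; have -> : U z f = f - z *: N z (H f) by [].
move=> /eqP; rewrite subr_eq0 => /eqP fE; apply: nm0_eq0; apply/eqP.
rewrite eq_le nm_ge0 andbT.
have h1 : nm f <= normc z * (2 * (nm H * nm f)).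
  rewrite {1}fE nmZ ler_wpM2l ?normc_ge0//; apply: le_trans (nm_bop _ _) _.
  have h0 : nm (N z) <= 2 by exact: nm_recop.
  exact: (ler_pM (nm_ge0 _) (nm_ge0 _) h0 (nm_bop H f)).
have h2 : 4 * (normc z * nm H) * nm f <= 1 * nm f := ler_wpM2r (nm_ge0 f) zH.
have e : normc z * (2 * (nm H * nm f)) = 2^-1 * (4 * (normc z * nm H) * nm f) by field.
rewrite e in h1.
have h3 : 2^-1 * (4 * (normc z * nm H) * nm f) <= 2^-1 * (1 * nm f) by rewrite ler_wpM2l.
by have := le_trans h1 h3; rewrite mul1r; lra.
Qed.

Let WU z : normc z * M <= 2^-1 -> 4 * (normc z * nm H) <= 1 -> W z * U z = 1.
Proof.
by move=> zM zH; apply: (mulbop1_comm (UW zM)) => f; exact: U_inj.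
Qed.

Let sim z : normc z * M <= 2^-1 -> 4 * (normc z * nm H) <= 1 ->
  A + z *: B = W z * A * U z.
Proof. by move=> zM zH; rewrite -mulrA AU// mulrA WU// mul1r. Qed.

Let adj (t : R) f h : normc t%:C * M <= 2^-1 ->
  L2dot (U t%:C f) h = L2dot f (W t%:C h).
Proof.
move=> tM.
have -> : U t%:C f = f - t%:C *: N t%:C (H f) by [].
have -> : W t%:C h = h + t%:C *: H (N' t%:C h) by [].
rewrite L2dotBl L2dotDr L2dotZl L2dotZr.
have -> : (t%:C : R[i])^*%R = t%:C by exact: conjc_real.
have -> : L2dot (N t%:C (H f)) h = L2dot (H f) (N' t%:C h).
  apply: is_mul_adj (recopP _ _ tM) _; apply: is_mul_ext (recopP _ _ tM) => x.
  rewrite conjc_inv; congr (_^-1); case: (b x) => p q; apply/eqP.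
  by rewrite eq_complex /=; apply/andP; split; apply/eqP; ring.
by rewrite skH mulrN opprK.
Qed.

Let qdiffU z : normc z * M < 2^-1 -> qdiff U z.
Proof.
move=> zM; have [D [C C0 [del del0 h]]] := qdiff_recop M0 mb bM zM.
exists (- (D * H)); exists (C * nm H); first by rewrite mulr_ge0 ?nm_ge0.
exists del => // w /h hw.
have -> : U w - U z - (w - z) *: - (D * H) =
    - ((w *: N w - z *: N z - (w - z) *: D) * H).
  by rewrite /U scalerN mulrBl mulrBl !bopZAl; exact: subr_telescope.
rewrite nmN; apply: le_trans (nm_bopM _ _) _.
by rewrite mulrAC; apply: ler_wpM2r hw; exact: nm_ge0.
Qed.

Let qdiffW z : normc z * M < 2^-1 -> qdiff W z.
Proof.
move=> zM; have [D [C C0 [del del0 h]]] := qdiff_recop M0 mc cM zM.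
exists (H * D); exists (nm H * C); first by rewrite mulr_ge0 ?nm_ge0.
exists del => // w /h hw.
have -> : W w - W z - (w - z) *: (H * D) = H * (w *: N' w - z *: N' z - (w - z) *: D).
  rewrite /W opprD addrACA subrr add0r.
  by rewrite mulrBr mulrBr !bopZAr.
apply: le_trans (nm_bopM _ _) _.
by rewrite -mulrA; apply: ler_wpM2l hw; exact: nm_ge0.
Qed.

Lemma ex_unitary_family : exists (r : R) (U W : R[i]^o -> bop V),
  [/\ 0 < r,
      forall z, normc z < r ->
        [/\ U z * W z = 1, W z * U z = 1 & A + z *: B = W z * A * U z],
      forall (t : R) f h, `|t| < r -> L2dot (U t%:C f) h = L2dot f (W t%:C h) &
      forall z, normc z < r -> qdiff U z /\ qdiff W z].
Proof.
have K0 : 0 < 4 * (M + nm H + 1).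
  by rewrite mulr_gt0// ltr_wpDl// addr_ge0 ?nm_ge0.
(* One radius serves both smallness conditions; the summand 1 keeps it finite when [M] and [nm H]
   vanish. *)
have zK z : normc z < (4 * (M + nm H + 1))^-1 ->
    normc z * M < 2^-1 /\ 4 * (normc z * nm H) <= 1.
  move=> zr; have : normc z * (4 * (M + nm H + 1)) < 1.
    by rewrite -ltr_pdivlMr// mul1r.
  have h1 := mulr_ge0 (normc_ge0 z) M0; have h2 := mulr_ge0 (normc_ge0 z) (nm_ge0 H).
  have h3 := normc_ge0 z.
  have -> : normc z * (4 * (M + nm H + 1)) = 4 * (normc z * M) + 4 * (normc z * nm H) + 4 * normc z.
    by ring.
  move=> h4; split.
    have : 4 * (normc z * M) < 4 * 2^-1 :> R.
      apply: (@lt_le_trans _ _ 1); last by rewrite (_ : 4 * 2^-1 = 2) ?ler1n//; field.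
      by apply: le_lt_trans h4; rewrite -addrA lerDl addr_ge0// mulr_ge0 ?ler0n.
    by rewrite ltr_pM2l.
  by apply: le_trans (ltW h4); rewrite addrAC lerDr addr_ge0// mulr_ge0 ?ler0n.
exists (4 * (M + nm H + 1))^-1, U, W; split; first by rewrite invr_gt0.
- by move=> z /zK[/ltW zM zH]; split; [exact: UW|exact: WU|exact: sim].
- by move=> t f h tr; apply: adj; have [/ltW] := @zK t%:C (ltac:(by rewrite normc_real)).
- by move=> z /zK[zM _]; split; [exact: qdiffU|exact: qdiffW].
Qed.

End unitary.

End unitary_family.

(** * Functional calculus of symmetric operators *)

Section polynomial_calculus.
Context {R : realType} {V : normedModType R[i]}.
Implicit Types (S T U W : bop V) (p q : {poly R[i]}) (c l : R[i]).

Lemma bop_horner_wide T p n : (size p <= n)%N ->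
  bop_horner T p = \sum_(i < n) p`_i *: T ^+ i.
Proof.
move=> pn; rewrite /bop_horner (big_ord_widen n (fun i => p`_i *: T ^+ i))//.
rewrite big_mkcond /=; apply: eq_bigr => i _.
by case: ltnP => // ?; rewrite nth_default// scale0r.
Qed.

Lemma bop_hornerD T p q : bop_horner T (p + q) = bop_horner T p + bop_horner T q.
Proof.
pose n := maxn (size (p + q)) (maxn (size p) (size q)).
rewrite !(@bop_horner_wide _ _ n) ?leq_max ?leqnn ?orbT// -big_split /=.
by apply: eq_bigr => i _; rewrite coefD scalerDl.
Qed.

Lemma bop_hornerZ T c p : bop_horner T (c *: p) = c *: bop_horner T p.
Proof.
rewrite !(@bop_horner_wide _ _ (maxn (size (c *: p)) (size p))) ?leq_max ?leqnn ?orbT//.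
by rewrite scaler_sumr; apply: eq_bigr => i _; rewrite coefZ scalerA.
Qed.

Lemma bop_hornerN T p : bop_horner T (- p) = - bop_horner T p.
Proof. by rewrite -scaleN1r bop_hornerZ scaleN1r. Qed.

Lemma bop_hornerB T p q : bop_horner T (p - q) = bop_horner T p - bop_horner T q.
Proof. by rewrite bop_hornerD bop_hornerN. Qed.

Lemma bop_horner0 T : bop_horner T 0 = 0.
Proof. by rewrite /bop_horner size_poly0 big_ord0. Qed.

Lemma bop_hornerC T c : bop_horner T c%:P = c *: (1 : bop V).
Proof.
by rewrite (@bop_horner_wide _ _ 1) ?size_polyC ?leq_b1// big_ord1 coefC eqxx expr0.
Qed.

Lemma bop_hornerMX T p : bop_horner T (p * 'X) = bop_horner T p * T.
Proof.
have s : (size (p * 'X)%R <= (size p).+1)%N.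
  by have [->|p0] := eqVneq p 0; rewrite ?mul0r ?size_poly0// size_mulX.
rewrite (bop_horner_wide _ s) big_ord_recl /= coefMX eqxx scale0r add0r.
rewrite /bop_horner mulr_suml; apply: eq_bigr => i _.
by rewrite coefMX /= /bump /= add1n /= bopZAl exprSr.
Qed.

Lemma bop_hornerX T : bop_horner T 'X = T.
Proof. by rewrite -['X]mul1r bop_hornerMX -polyC1 bop_hornerC scale1r mul1r. Qed.

Lemma bop_hornerM T p q : bop_horner T (p * q) = bop_horner T p * bop_horner T q.
Proof.
elim/poly_ind: q => [|q c IH]; first by rewrite mulr0 !bop_horner0 mulr0.
rewrite mulrDr mulrA !bop_hornerD !bop_hornerMX IH mulrDr mulrA; congr (_ + _).
by rewrite [p * _]mulrC mul_polyC bop_hornerZ bop_hornerC bopZAr mulr1.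
Qed.

Lemma bop_hornerXsubC T l : bop_horner T ('X - l%:P) = T - l *: (1 : bop V).
Proof. by rewrite bop_hornerB bop_hornerX bop_hornerC. Qed.

Lemma is_inverseM S S' T T' : is_inverse S S' -> is_inverse T T' ->
  is_inverse (S * T) (T' * S').
Proof.
move=> [S1 S2] [T1 T2]; split.
  by rewrite mulrA -(mulrA T') S1 mulr1.
by rewrite mulrA -(mulrA S) T2 mulr1.
Qed.

Lemma is_inverseZ c T S : c != 0 -> is_inverse T S -> is_inverse (c *: T) (c^-1 *: S).
Proof.
move=> c0 [h1 h2]; split; rewrite bopZAl bopZAr scalerA.
  by rewrite mulVf// scale1r.
by rewrite divff// scale1r.
Qed.

(** Over the algebraically closed field [R[i]] the polynomial splits, and each linear factor is
    invertible at [T]. *)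
Lemma inverse_bop_horner T p : p != 0 ->
  (forall a, root p a -> exists S, is_inverse (T - a *: (1 : bop V)) S) ->
  exists S, is_inverse (bop_horner T p) S.
Proof.
move=> p0 hp; have [s ps] := closed_field_poly_normal p.
have : forall a, a \in s -> exists S, is_inverse (T - a *: (1 : bop V)) S.
  move=> a as_; apply: hp; rewrite ps rootZ ?lead_coef_eq0// root_prod_XsubC.
  exact: as_.
rewrite ps bop_hornerZ => hs.
suff [S SP] : exists S, is_inverse (bop_horner T (\prod_(z <- s) ('X - z%:P))) S.
  by exists ((lead_coef p)^-1 *: S); apply: is_inverseZ; rewrite ?lead_coef_eq0.
elim: s {ps} hs => [|a s IH] hs.
  by exists 1; rewrite big_nil -polyC1 bop_hornerC scale1r; split; rewrite mulr1.
have [S SP] := IH (fun b bs => hs b (mem_behead (s := a :: s) bs)).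
have [S' S'P] := hs a (mem_head _ _).
exists (S * S'); rewrite big_cons bop_hornerM bop_hornerXsubC.
exact: is_inverseM.
Qed.

Section similarity.
Variables (U W : bop V) (WU : is_inverse U W).

Lemma bop_horner_similar T p : bop_horner (W * T * U) p = W * bop_horner T p * U.
Proof.
have [W1 U1] := WU; rewrite /bop_horner mulr_sumr mulr_suml.
apply: eq_bigr => i _; rewrite bopZAr bopZAl; congr (_ *: _).
elim: (nat_of_ord i) => [|n IH]; first by rewrite !expr0 mulr1.
rewrite !exprS IH -!mulrA; congr (_ * (_ * _)).
by rewrite mulrA U1 mul1r.
Qed.

Lemma spectrum_similar_sub T : spectrum T `<=` spectrum (W * T * U).
Proof.
have [W1 U1] := WU; move=> l nl [S [S1 S2]]; apply: nl.
have e : W * T * U - l *: (1 : bop V) = W * (T - l *: (1 : bop V)) * U.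
  by rewrite mulrBr mulrBl bopZAr bopZAl mulr1 W1.
rewrite {}e in S1 S2; exists (U * S * W); set X := T - _ in S1 S2 *; split.
  have := congr1 (fun X => U * X * W) S1; rewrite mulr1 U1 => <-.
  by rewrite -!mulrA U1 mulr1.
have := congr1 (fun X => U * X * W) S2; rewrite mulr1 U1 => <-.
by rewrite !mulrA U1 mul1r.
Qed.

End similarity.

Lemma spectrum_similar U W T : is_inverse U W -> spectrum (W * T * U) = spectrum T.
Proof.
move=> [W1 U1]; apply/seteqP; split; last by apply: spectrum_similar_sub; split.
have := @spectrum_similar_sub W U (conj U1 W1) (W * T * U).
by rewrite -!mulrA U1 mulr1 !mulrA U1 mul1r.
Qed.

Lemma bop_cvgP (F : nat -> bop V) S : F n @[n --> \oo] --> S <->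
  forall eta : R, 0 < eta -> \forall n \near \oo, nm (F n - S) <= eta.
Proof.
split=> [/cvgrPdist_lt h eta eta0|h].
  have := h eta%:C; rewrite rc_gt0 => /(_ eta0); apply: filterS => n.
  by rewrite nm_lt nmBC => /ltW.
apply/cvgrPdist_lt => _ /complex_gt0P[eta eta0 ->].
have := h _ (divr_gt0 eta0 (ltr0n R 2)); apply: filterS => n hn.
by rewrite nm_lt nmBC; apply: le_lt_trans hn _; lra.
Qed.

Lemma is_cfc_similar U W T phi S : is_inverse U W -> is_cfc T phi S ->
  is_cfc (W * T * U) phi (W * S * U).
Proof.
move=> UW [p [pphi pS]]; exists p; rewrite spectrum_similar//; split=> //.
apply/bop_cvgP => eta eta0.
have K0 : 0 < nm W * nm U + 1 by rewrite ltr_wpDl// mulr_ge0 ?nm_ge0.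
have := (bop_cvgP _ _).1 pS _ (divr_gt0 eta0 K0); apply: filterS => n hn.
rewrite bop_horner_similar// -mulrBl -mulrBr.
apply: le_trans (nm_bopM _ _) _.
have h1 : nm (W * (bop_horner T (p n) - S)) * nm U <=
    nm W * nm (bop_horner T (p n) - S) * nm U.
  exact: (ler_wpM2r (nm_ge0 U) (nm_bopM W _)).
apply: le_trans h1 _.
have h2 : nm W * nm U * nm (bop_horner T (p n) - S) <=
    (nm W * nm U + 1) * nm (bop_horner T (p n) - S).
  by rewrite ler_wpM2r ?nm_ge0// lerDl.
rewrite mulrAC; apply: le_trans h2 _; rewrite mulrC -ler_pdivlMr//.
Qed.

Lemma uniform_cvgP (A : set R) (F : nat -> R -> R[i]^o) (phi : R -> R[i]^o) :
  {uniform A, F @ \oo --> phi} <-> forall eta : R, 0 < eta ->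
    \forall n \near \oo, forall x, A x -> normc (F n x - phi x) <= eta.
Proof.
split=> [h eta eta0|h P /uniform_nbhs[E [entE sub]]].
  have : nbhs (phi : {uniform` A -> R[i]^o})
      [set k : R -> R[i]^o | forall x, A x -> ball (phi x) eta%:C (k x)].
    apply/uniform_nbhs; exists [set xy | ball xy.1 eta%:C xy.2]; split=> //.
    by rewrite -entourage_ballE; exists eta%:C => //=; rewrite rc_gt0.
  move=> /h hh.
  have {hh} : \forall n \near \oo, forall x, A x -> ball (phi x) eta%:C (F n x) by exact: hh.
  apply: filterS => n hn x Ax; have := hn x Ax.
  by rewrite -ball_normE /= normc_ltE normcBC => /ltW.
move: entE; rewrite -entourage_ballE => -[_ /= /complex_gt0P[eta eta0 ->] he].
have := h _ (divr_gt0 eta0 (ltr0n R 2)); rewrite near_simpl; apply: filterS => n hn.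
apply: sub => x Ax; apply: he => /=; rewrite -ball_normE /= normc_ltE normcBC.
by apply: le_lt_trans (hn x Ax) _; lra.
Qed.

End polynomial_calculus.

(** * Spectral bound for polynomials in a symmetric operator *)

Section symmetric_spectrum.
Context d (T : measurableType d) (R : realType).
Variable mu : {measure set T -> \bar R}.
Local Notation V := (L2 mu).
Implicit Types (f g h : V) (c l z : R[i]) (S X Y Q : bop V) (p r : {poly R[i]}).

(** With [Y] the adjoint and [Q] the difference, $|Qf|^2\le N^2(N^2|f|^2-|Xf|^2)$. A left inverse
    would bound $|f|$ by a multiple of $|Qf|$, hence $|Xf|$ by a constant below $N$ times $|f|$,
    against the definition of the norm. *)
Lemma no_left_inverse X Y : (forall f h, L2dot (X f) h = L2dot f (Y h)) ->
  0 < nm X -> ~ exists S, S * ((nm X ^+ 2)%:C *: (1 : bop V) - Y * X) = 1.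
Proof.
set N := nm X => XY N0 [S SQ].
set Q : bop V := _ - _ in SQ.
pose k := nm S ^+ 2 * N ^+ 2.
have nY h : nm (Y h) <= N * nm h.
  have [Y0|Y0] := eqVneq (nm (Y h)) 0; first by rewrite Y0 mulr_ge0 ?nm_ge0.
  have Yp : 0 < nm (Y h) by rewrite lt_neqAle eq_sym Y0 nm_ge0.
  rewrite -(ler_pM2l Yp) -expr2.
  have := L2dot_le (X (Y h)) h; rewrite XY L2dotff_nm normc_real ger0_norm ?sqr_ge0//.
  move=> h1; apply: le_trans h1 _; rewrite mulrA [nm (Y h) * N]mulrC.
  exact: (ler_wpM2r (nm_ge0 h) (nm_bop X (Y h))).
have QE f : Q f = (N ^+ 2)%:C *: f - Y (X f) by [].
have XX f : L2dot f (Y (X f)) = (nm (X f) ^+ 2)%:C by rewrite -XY L2dotff_nm.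
have XX' f : L2dot (Y (X f)) f = (nm (X f) ^+ 2)%:C.
  by rewrite L2dotC XX conjc_real.
have nQ f : nm (Q f) ^+ 2 <= N ^+ 2 * (N ^+ 2 * nm f ^+ 2 - nm (X f) ^+ 2).
  have -> : nm (Q f) ^+ 2 = (N ^+ 2) ^+ 2 * nm f ^+ 2 - 2 * N ^+ 2 * nm (X f) ^+ 2
      + nm (Y (X f)) ^+ 2.
    apply: complexI; rewrite -L2dotff_nm QE !(L2dotBl, L2dotBr, L2dotZl, L2dotZr).
    have cj : (((N ^+ 2)%:C : R[i]) ^* = (N ^+ 2)%:C)%R by exact: conjc_real.
    rewrite XX XX' !L2dotff_nm !cj -!(rcM, rcN, rcD); congr (_%:C); ring.
  have h1 : nm (Y (X f)) ^+ 2 <= N ^+ 2 * nm (X f) ^+ 2.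
    by rewrite -exprMn ler_sqr ?nnegrE ?mulr_ge0 ?nm_ge0.
  have -> : N ^+ 2 * (N ^+ 2 * nm f ^+ 2 - nm (X f) ^+ 2) =
    (N ^+ 2) ^+ 2 * nm f ^+ 2 - 2 * N ^+ 2 * nm (X f) ^+ 2 + N ^+ 2 * nm (X f) ^+ 2 by ring.
  by rewrite lerD2l.
have low f : nm f ^+ 2 <= k * (N ^+ 2 * nm f ^+ 2 - nm (X f) ^+ 2).
  have h1 : nm f <= nm S * nm (Q f).
    have := nm_bop S (Q f); rewrite -bopM SQ; exact.
  have h2 : nm f ^+ 2 <= nm S ^+ 2 * nm (Q f) ^+ 2.
    by rewrite -exprMn ler_sqr ?nnegrE ?mulr_ge0 ?nm_ge0.
  apply: le_trans h2 _; rewrite /k -mulrA.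
  exact: (ler_wpM2l (sqr_ge0 _) (nQ f)).
have k0 : 0 <= k by rewrite mulr_ge0 ?sqr_ge0.
have kp : 0 < k.
  rewrite lt_neqAle k0 andbT eq_sym; apply/negP => /eqP kz.
  have f0 f : nm f = 0.
    apply/eqP; rewrite -sqrf_eq0 eq_le sqr_ge0 andbT.
    by have := low f; rewrite kz mul0r.
  have : nm X <= 0 by apply: nm_bop_le => // f; rewrite f0 mul0r.
  by rewrite leNgt N0.
(* The maximum covers the case where the difference is negative, not yet excluded at this point. *)
pose C := Num.sqrt (Num.max 0 (N ^+ 2 - k^-1)).
have CE : C ^+ 2 = Num.max 0 (N ^+ 2 - k^-1) by rewrite sqr_sqrtr// le_max lexx.
have C0 : 0 <= C by exact: sqrtr_ge0.
have XC f : nm (X f) <= C * nm f.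
  rewrite -ler_sqr ?nnegrE ?mulr_ge0 ?nm_ge0// exprMn CE.
  have h1 : k^-1 * nm f ^+ 2 <= N ^+ 2 * nm f ^+ 2 - nm (X f) ^+ 2.
    by rewrite ler_pdivrMl.
  have h2 : (N ^+ 2 - k^-1) * nm f ^+ 2 <= Num.max 0 (N ^+ 2 - k^-1) * nm f ^+ 2.
    by rewrite ler_wpM2r ?sqr_ge0// le_max lexx orbT.
  apply: le_trans h2; rewrite mulrBl; move: h1; clear; lra.
have : N ^+ 2 <= C ^+ 2 by rewrite ler_sqr ?nnegrE ?(ltW N0)// nm_bop_le.
rewrite CE le_max => /orP[|].
  by rewrite leNgt exprn_gt0.
have ki : 0 < k^-1 by rewrite invr_gt0.
by rewrite lerDl oppr_ge0 leNgt ki.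
Qed.

Section symmetric_calculus.
Variables (X : bop V) (sX : symmetric_bop X)
  (realX : forall l, spectrum X l -> Im l = 0).

Lemma bop_horner_adj p f h :
  L2dot (bop_horner X p f) h = L2dot f (bop_horner X (map_poly (@conjc R) p) h).
Proof.
have conjZ c u v : L2dot u (c^* *: v) = c * L2dot u v.
  by rewrite L2dotZr; congr (_ * _); exact: conjcK.
elim/poly_ind: p f h => [|p c IH] f h.
  by rewrite map_poly0 !bop_horner0 !bop0 [RHS]L2dotC !L2dot0l conjc0.
rewrite rmorphD rmorphM /= map_polyX map_polyC /= !bop_hornerD !bop_hornerMX !bop_hornerC.
rewrite bopD bopD L2dotDl L2dotDr !bopM IH sX !bopZ !bop1 L2dotZl conjZ; congr (_ + _).
have e Y (r : {poly R[i]}) : Y = bop_horner X r -> Y * X = X * Y.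
  by move=> ->; rewrite -bop_hornerMX mulrC bop_hornerM bop_hornerX.
by have := congr1 (fun Y : bop V => Y h) (e _ (map_poly (@conjc R) p) erefl) => /= <-.
Qed.

Lemma horner_conj p (x : R) : (map_poly (@conjc R) p).[x%:C] = (p.[x%:C])^*.
Proof. by rewrite -{1}[x%:C]conjc_real horner_map. Qed.

(* With N = nm (p X) the operator N^2 - p(X)^* p(X) is not invertible, so the
   polynomial N^2 - p^* p, factored over R[i], has a root in the spectrum. *)
Lemma spectrum_normc p : 0 < nm (bop_horner X p) ->
  (exists l, spectrum X l) \/ (1 < size p)%N ->
  exists2 x : R, spectrum X x%:C & normc p.[x%:C] = nm (bop_horner X p).
Proof.
set N := nm _ => N0 h.
pose q := ((N ^+ 2)%:C)%:P - map_poly (@conjc R) p * p.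
have qE (x : R) : q.[x%:C] = (N ^+ 2 - normc p.[x%:C] ^+ 2)%:C.
  rewrite !hornerE horner_conj rcD rcN; congr (_ - _); rewrite sqr_normcE.
  by case: p.[_] => a b /=; apply/eqP; rewrite eq_complex /=; apply/andP; split; apply/eqP; ring.
have [l sl ql] : exists2 l, spectrum X l & q.[l] = 0.
  (* If [q] is zero, the product of [p] and its conjugate is constant, which a degree count excludes
     for nonconstant [p]. For constant [p] any point of the spectrum will do. *)
  have [q0|q0] := eqVneq q 0.
    case: h => [[l sl]|sp]; first by exists l => //; rewrite q0 horner0.
    have p0 : p != 0 by rewrite -size_poly_gt0 ltnW.
    have s1 : size (map_poly (@conjc R) p) = size p by exact: size_map_poly.
    have : size (map_poly (@conjc R) p * p) = size ((N ^+ 2)%:C)%:P.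
      by move/eqP: q0; rewrite subr_eq0 => /eqP <-.
    rewrite size_mul// -?size_poly_gt0 s1 ?size_poly_gt0// size_polyC.
    by case: (size p) sp => [//|[//|n _]]; rewrite addnS /=; case: (_ != 0).
  apply: contrapT => no.
  have [l rl|S [S1 _]] := @inverse_bop_horner _ _ X q q0.
    by apply: contrapT => nl; apply: no; exists l => //; exact/rootP.
  apply: (@no_left_inverse _ _ (bop_horner_adj p) N0); exists S.
  by move: S1; rewrite bop_hornerB bop_hornerC bop_hornerM.
have lE : l = (Re l)%:C by have := realX sl; case: (l) => a b /= ->.
exists (Re l); rewrite -lE//; apply/eqP.
rewrite -(@eqrXn2 _ 2) ?normc_ge0 ?nm_ge0//.
move: ql; rewrite lE qE => /(congr1 (@Re R)) /= /eqP.
by rewrite subr_eq0 eq_sym.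
Qed.

(** In place of Liouville's theorem, [spectrum_normc] for the polynomial ['X] produces a spectral
    point, and if [X] is zero then 0 is one. *)
Lemma spectrum_nonempty f : f != 0 -> exists l, spectrum X l.
Proof.
move=> f0; have [N0|N0] := eqVneq (nm X) 0.
  exists 0 => -[S [S1 _]]; move/eqP: f0; apply.
  have := congr1 (fun Y : bop V => Y f) S1.
  by rewrite (nm0_eq0 N0) scale0r subr0 mulr0 => /= <-.
have Np : 0 < nm (bop_horner X 'X) by rewrite bop_hornerX lt_neqAle eq_sym N0 nm_ge0.
have [|x sx _] := spectrum_normc Np; first by right; rewrite size_polyX.
by exists x%:C.
Qed.

(** Uniform closeness on the spectrum becomes closeness in operator norm; this makes the functional
    calculus single-valued. *)
Lemma nm_horner_le p (C : R) : 0 <= C ->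
  (forall x : R, spectrum X x%:C -> normc p.[x%:C] <= C) -> nm (bop_horner X p) <= C.
Proof.
move=> C0 hC; rewrite leNgt; apply/negP => CN.
have N0 := le_lt_trans C0 CN.
have [|x sx px] := spectrum_normc N0; last by have := hC x sx; rewrite px leNgt CN.
left; have [[f f0]|nf] := pselect (exists f : V, f != 0).
  exact: spectrum_nonempty f0.
have : nm (bop_horner X p) <= 0.
  apply: nm_bop_le => // f; rewrite [f](_ : _ = 0) ?linear0 ?nm0 ?mulr0//.
  by apply: contrapT => f0; apply: nf; exists f; exact/eqP.
by rewrite leNgt N0.
Qed.

Lemma is_cfc_uniq phi S S' : is_cfc X phi S -> is_cfc X phi S' -> S = S'.
Proof.
move=> [p [pphi pS]] [q [qphi qS]]; apply/eqP; rewrite -subr_eq0; apply/eqP.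
apply: nm0_eq0; apply/eqP; rewrite eq_le nm_ge0 andbT.
apply/ler_addgt0Pl => e e0; rewrite addr0.
have e4 : 0 < e / 4 by rewrite divr_gt0.
near \oo => n.
have h1 : nm (bop_horner X (p n) - S) <= e / 4.
  by near: n; exact: (bop_cvgP _ _).1 pS _ e4.
have h2 : nm (bop_horner X (q n) - S') <= e / 4.
  by near: n; exact: (bop_cvgP _ _).1 qS _ e4.
have h3 : forall x : R, spectrum X x%:C -> normc ((p n).[x%:C] - phi x) <= e / 4.
  by near: n; exact: (uniform_cvgP _ _ _).1 pphi _ e4.
have h4 : forall x : R, spectrum X x%:C -> normc ((q n).[x%:C] - phi x) <= e / 4.
  by near: n; exact: (uniform_cvgP _ _ _).1 qphi _ e4.
have h5 : nm (bop_horner X (p n - q n)) <= e / 4 + e / 4.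
  apply: nm_horner_le => [|x sx]; first by rewrite addr_ge0 ?ltW.
  have -> : (p n - q n).[x%:C] = ((p n).[x%:C] - phi x) - ((q n).[x%:C] - phi x).
    by rewrite hornerD hornerN opprB addrA subrK.
  by apply: le_trans (normcB _ _) _; apply: lerD; [exact: h3|exact: h4].
have -> : S - S' = (S - bop_horner X (p n)) + (bop_horner X (p n - q n) +
    (bop_horner X (q n) - S')).
  by rewrite bop_hornerB !subrKA.
apply: le_trans (nmD _ _) _; rewrite nmBC.
apply: le_trans (lerD h1 (le_trans (nmD _ _) (lerD h5 h2))) _.
by rewrite le_eqVlt; apply/orP; left; apply/eqP; field.
Unshelve. all: by end_near. Qed.

Lemma cfcE phi S : is_cfc X phi S -> cfc X phi = S.
Proof.
move=> hS; apply: (@is_cfc_uniq phi) => //; rewrite /cfc.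
by apply: (@xgetPex _ 0 [set S | is_cfc X phi S]); exists S.
Qed.

End symmetric_calculus.

End symmetric_spectrum.

Lemma geometric_le (R : realType) (q : R) (eta : R) : 0 <= q -> q < 1 -> 0 < eta ->
  \forall n \near \oo, q ^+ n <= eta.
Proof.
move=> q0 q1 eta0; have := @cvg_expr R q; rewrite ger0_norm// => /(_ q1).
move=> /cvgrPdist_le/(_ _ eta0); apply: filterS => n.
by rewrite sub0r normrN ger0_norm// exprn_ge0.
Qed.

(** * Neumann series and the functional calculus of resolvent functions *)

Section neumann.
Context d (T : measurableType d) (R : realType).
Variable mu : {measure set T -> \bar R}.
Local Notation V := (L2 mu).
Implicit Types (f g h : V) (S E : bop V).

Lemma nm_bopX_vec E f n : nm ((E ^+ n) f) <= nm E ^+ n * nm f.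
Proof.
elim: n => [|n IH]; first by rewrite !expr0 mul1r.
rewrite !exprS bopM -mulrA; apply: le_trans (nm_bop _ _) _.
exact: (ler_wpM2l (nm_ge0 E) IH).
Qed.

(** The series is summed strongly, vector by vector, so completeness of [L2] suffices and that of
    the operator algebra is not called upon. *)
Lemma neumann E : nm E < 1 -> exists S, is_inverse (1 - E) S.
Proof.
move=> E1; have q0 := nm_ge0 E; set q := nm E in E1 q0.
pose s n : bop V := \sum_(k < n) E ^+ k.
have sS n : s n.+1 = s n + E ^+ n by rewrite /s big_ord_recr.
have El n : (1 - E) * s n = 1 - E ^+ n.
  elim: n => [|n IH]; first by rewrite /s big_ord0 mulr0 expr0 subrr.
  by rewrite sS mulrDr IH mulrBl mul1r -exprS subrKA.
have Er n : s n * (1 - E) = 1 - E ^+ n.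
  elim: n => [|n IH]; first by rewrite /s big_ord0 mul0r expr0 subrr.
  by rewrite sS mulrDl IH mulrBr mulr1 -exprSr subrKA.
have q1 : 0 < 1 - q by rewrite subr_gt0.
have tail f m n : nm ((s (m + n)%N - s m) f) <= q ^+ m / (1 - q) * nm f.
  suff h : nm ((s (m + n)%N - s m) f) <= (q ^+ m - q ^+ (m + n)) / (1 - q) * nm f.
    apply: le_trans h _; apply: (ler_wpM2r (nm_ge0 f)).
    by rewrite ler_wpM2r ?invr_ge0 ?(ltW q1)// gerBl exprn_ge0.
  elim: n => [|n IH]; first by rewrite addn0 !subrr !mul0r -[leRHS](@nm0 R V); exact: lexx.
  rewrite addnS sS addrAC bopD; apply: le_trans (nmD _ _) _.
  apply: le_trans (lerD IH (nm_bopX_vec _ _ _)) _; rewrite -/q -mulrDl.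
  rewrite le_eqVlt; apply/orP; left; apply/eqP; congr (_ * _).
  by rewrite exprS; field; rewrite gt_eqF.
have C0 : 0 <= 1 / (1 - q) by rewrite divr_ge0// ltW.
have bnd n : nm (s n) <= 1 / (1 - q).
  apply: nm_bop_le => // f; have := tail f 0%N n.
  by rewrite add0n {2}/s big_ord0 subr0 expr0.
have [f|S _ SP] := @ex_strong_limit _ _ _ mu s _ bnd.
  apply: L2_cauchy_cvg => eta eta0.
  have K0 : 0 < nm f / (1 - q) + 1 by rewrite ltr_wpDl// divr_ge0 ?nm_ge0// ltW.
  have [N _ hN] := geometric_le q0 E1 (divr_gt0 (divr_gt0 eta0 (ltr0n R 2)) K0).
  have main m n : (N <= m)%N -> (m <= n)%N -> nm (s n f - s m f) <= eta / 2.
    move=> Nm mn; rewrite -bopB -(subnKC mn); apply: le_trans (tail _ _ _) _.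
    have := hN m Nm; rewrite /= ler_pdivlMr// => h1; apply: le_trans h1.
    rewrite mulrDr mulr1 mulrAC -mulrA; rewrite -[leLHS]addr0; apply: lerD; last exact: exprn_ge0.
    by rewrite lexx.
  exists N => n m Nn Nm; have [nm'|mn] := leqP n m.
    by rewrite nmBC; apply: le_trans (main _ _ Nn nm') _; lra.
  by apply: le_trans (main _ _ Nm (ltnW mn)) _; lra.
have Ev f : tends (fun n => (E ^+ n) f) 0.
  move=> eta eta0; have K0 : 0 < nm f + 1 by rewrite ltr_wpDl// nm_ge0.
  have [N _ hN] := geometric_le q0 E1 (divr_gt0 eta0 K0); exists N => n Nn.
  rewrite subr0; apply: le_trans (nm_bopX_vec _ _ _) _; rewrite -/q.
  have := hN n Nn; rewrite /= ler_pdivlMr// mulrDr => h1; apply: le_trans h1.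
  by rewrite lerDl mulr1 exprn_ge0.
have lim f : tends (fun n => (1 - E ^+ n : bop V) f) f.
  have := tendsB (tends_cst f) (Ev f); rewrite subr0; exact.
exists S; split; apply/bopP => f.
  apply: (tends_uniq (SP ((1 - E : bop V) f))).
  by refine (tends_ext _ (lim f)) => n; rewrite -Er.
apply: (tends_uniq (tends_bop (1 - E) (SP f))).
by refine (tends_ext _ (lim f)) => n; rewrite -El.
Qed.

Lemma spectrum_le E l : spectrum E l -> normc l <= nm E.
Proof.
move=> sl; rewrite leNgt; apply/negP => El; apply: sl.
have l0 : l != 0 by rewrite -normc_gt0; apply: le_lt_trans El; exact: nm_ge0.
have [|S SP] := @neumann (l^-1 *: E).
  by rewrite nmZ Normc.normcV mulrC ltr_pdivrMr ?mul1r// normc_gt0.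
have -> : E - l *: (1 : bop V) = - l *: (1 - l^-1 *: E).
  by rewrite scalerBr !scaleNr scalerA divff// scale1r opprK addrC.
by exists ((- l)^-1 *: S); apply: is_inverseZ => //; rewrite oppr_eq0.
Qed.

Lemma is_cfc_resolvent X l S : symmetric_bop X ->
  (forall l', spectrum X l' -> Im l' = 0) -> Im l != 0 ->
  is_inverse (X - l *: (1 : bop V)) S -> is_cfc X (fun x => (x%:C - l)^-1) S.
Proof.
move=> sX rX l0 [SX _].
(* Exceeds $|x-l|^2$ on the spectrum, so the ratio of the series is nonnegative there; the distance
   [Im l] from the real line keeps it at most [q < 1]. *)
pose K := (nm X + normc l) ^+ 2 + 1.
have K0 : 0 < K by rewrite ltr_wpDl// sqr_ge0.
pose q := 1 - `|Im l| ^+ 2 / K.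
have h0 : 0 < `|Im l| ^+ 2 by rewrite exprn_gt0// normr_gt0.
have q1 : q < 1 by rewrite gtrBl divr_gt0.
pose b : {poly R[i]} := 'X - l%:P.
pose b' : {poly R[i]} := 'X - (l^*)%:P.
pose gp : {poly R[i]} := 1 - (K^-1)%:C *: (b * b').
pose p n : {poly R[i]} := (K^-1)%:C *: b' * \sum_(k < n) gp ^+ k.
have bp n : b * p n = 1 - gp ^+ n.
  rewrite /p mulrA -scalerAr.
  have -> : (K^-1)%:C *: (b * b') = 1 - gp by rewrite /gp opprB addrC subrK.
  by rewrite -opprB mulNr -subrX1 opprB.
have gE (x : R) : gp.[x%:C] = (1 - normc (x%:C - l) ^+ 2 / K)%:C.
  have e : (x%:C - l) * (x%:C - l^*) = (normc (x%:C - l) ^+ 2)%:C.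
    rewrite sqr_normcE; case: (l) => u v /=; apply/eqP.
    by rewrite eq_complex /=; apply/andP; split; apply/eqP; ring.
  rewrite /gp /b /b' hornerD hornerN hornerZ hornerM !hornerXsubC hornerC e -rcM.
  by rewrite rcD rcN mulrC.
have xl0 (x : R) : x%:C - l != 0 by exact: kernel_neq0.
have Iml (x : R) : `|Im l| <= normc (x%:C - l).
  by have := ler_abs_Im (x%:C - l); case: (l) => u v /=; rewrite sub0r normrN.
have gle (x : R) : spectrum X x%:C -> normc gp.[x%:C] <= q.
  move=> /spectrum_le; rewrite normc_real => xX.
  have h1 : normc (x%:C - l) ^+ 2 <= K.
    rewrite /K -[leLHS]addr0; apply: lerD => //.
    rewrite ler_sqr ?nnegrE ?addr_ge0 ?nm_ge0 ?normc_ge0//.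
    by apply: le_trans (normcB _ _) _; rewrite normc_real lerD2r.
  rewrite gE normc_real ger0_norm ?subr_ge0 ?ler_pdivrMr ?mul1r//.
  by rewrite /q lerD2l lerN2 ler_pM2r ?invr_gt0// ler_sqr ?nnegrE ?normc_ge0.
have q0 : 0 <= q.
  rewrite subr_ge0 ler_pdivrMr// mul1r /K -[leLHS]addr0; apply: lerD => //.
  rewrite ler_sqr ?nnegrE ?addr_ge0 ?nm_ge0 ?normc_ge0//.
  by apply: le_trans (ler_abs_Im l) _; rewrite lerDr nm_ge0.
exists p; split.
  apply/uniform_cvgP => eta eta0.
  have := geometric_le q0 q1 (mulr_gt0 eta0 (ltac:(by rewrite normr_gt0) : 0 < `|Im l|)).
  apply: filterS => n hn x sx /=.
  have e : (p n).[x%:C] = (x%:C - l)^-1 * (1 - gp.[x%:C] ^+ n).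
    have := congr1 (horner^~ x%:C) (bp n).
    rewrite /= hornerM /b hornerXsubC hornerD hornerN hornerC horner_exp => <-.
    by rewrite mulrA mulVf// mul1r.
  rewrite e mulrBr mulr1 [X in normc X](_ : _ = - ((x%:C - l)^-1 * gp.[x%:C] ^+ n)); last by ring.
  rewrite normcN Normc.normcM Normc.normcV normcX ler_pdivrMl ?normc_gt0//.
  apply: le_trans (_ : q ^+ n <= _).
    by rewrite lerXn2r ?nnegrE ?normc_ge0// gle.
  by apply: le_trans hn _; rewrite mulrC; apply: ler_wpM2r (Iml x); exact: ltW.
apply/bop_cvgP => eta eta0.
have S1 : 0 < nm S + 1 by rewrite ltr_wpDl// nm_ge0.
have := geometric_le q0 q1 (divr_gt0 eta0 S1); apply: filterS => n hn.
have -> : bop_horner X (p n) - S = - (S * bop_horner X (gp ^+ n)).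
  have -> : bop_horner X (p n) = S * bop_horner X (b * p n).
    by rewrite bop_hornerM bop_hornerXsubC mulrA SX mul1r.
  rewrite bp bop_hornerB -polyC1 bop_hornerC scale1r mulrBr mulr1.
  by rewrite addrAC subrr add0r.
rewrite nmN; apply: le_trans (nm_bopM _ _) _.
have h1 : nm (bop_horner X (gp ^+ n)) <= q ^+ n.
  apply: (nm_horner_le sX rX); first exact: exprn_ge0.
  by move=> x sx; rewrite horner_exp normcX lerXn2r ?nnegrE ?normc_ge0// gle.
apply: le_trans (ler_wpM2l (nm_ge0 S) h1) _.
move: hn; rewrite ler_pdivlMr// => hn; apply: le_trans hn.
by rewrite mulrC ler_wpM2l ?exprn_ge0// lerDl.
Qed.

End neumann.

(** * Rank one perturbations *)

Section rank_one_perturbation.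
Context d (T : measurableType d) (R : realType).
Variable mu : {measure set T -> \bar R}.
Local Notation V := (L2 mu).
Variables (A : bop V) (g : V).
Local Notation B := (rank_one g).
Implicit Types (f h : V) (S : bop V) (l z : R[i]).

Lemma rank_one_sandwich S : B * S * B = L2dot (S g) g *: B.
Proof.
apply/bopP => f.
have -> : (B * S * B) f = L2dot (S (L2dot f g *: g)) g *: g by [].
have -> : (L2dot (S g) g *: B) f = L2dot (S g) g *: (L2dot f g *: g) by [].
by rewrite linearZ /= L2dotZl scalerA mulrC.
Qed.

(** The Sherman-Morrison formula. It closes up because any operator between two copies of [B] gives
    a scalar multiple of [B]. *)
Lemma sherman_morrison l z S : is_inverse (A - l *: (1 : bop V)) S ->
  1 + z * L2dot (S g) g != 0 ->
  exists S', is_inverse (A + z *: B - l *: (1 : bop V)) S'.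
Proof.
move=> [SX XS] n0; set beta := L2dot _ _ in n0; set c := z / (1 + z * beta).
have cE : z - c * z * beta = c by rewrite /c; field.
exists (S - c *: (S * B * S)); rewrite addrAC; set X := A - _ in SX XS *.
have SBSB : S * B * S * B = beta *: (S * B).
  by rewrite -!mulrA (mulrA B) rank_one_sandwich bopZAr.
have BSBS : B * (S * B * S) = beta *: (B * S).
  by rewrite !mulrA rank_one_sandwich bopZAl.
split.
  have e1 : (S - c *: (S * B * S)) * X = 1 - c *: (S * B).
    by rewrite mulrBl bopZAl -(mulrA (S * B)) SX mulr1.
  have e2 : (S - c *: (S * B * S)) * (z *: B) = c *: (S * B).
    by rewrite mulrBl bopZAr bopZAr bopZAl SBSB !scalerA -scalerBl -{2}cE; congr (_ *: _); ring.
  by rewrite mulrDr e1 e2 subrK.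
have e1 : X * (S - c *: (S * B * S)) = 1 - c *: (B * S).
  by rewrite mulrBr bopZAr !mulrA XS mul1r.
have e2 : (z *: B) * (S - c *: (S * B * S)) = c *: (B * S).
  by rewrite mulrBr bopZAl bopZAr bopZAl BSBS !scalerA -scalerBl -{2}cE; congr (_ *: _); ring.
by rewrite mulrDl e1 e2 subrK.
Qed.

(** The second resolvent identity paired with [g], kept free of division: the zero of the first
    factor is what [identity_bound] exploits. *)
Lemma borel_perturbation l z S S' : is_inverse (A - l *: (1 : bop V)) S ->
  is_inverse (A + z *: B - l *: (1 : bop V)) S' ->
  (1 + z * L2dot (S g) g) * L2dot (S' g) g = L2dot (S g) g.
Proof.
move=> [SX _] [_ XS].
have e : (A - l *: (1 : bop V)) (S' g) + z *: (L2dot (S' g) g *: g) = g.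
  have := congr1 (fun Y : bop V => Y g) XS; rewrite addrAC; exact.
have e1 : S ((A - l *: (1 : bop V)) (S' g)) = S' g := congr1 (fun Y : bop V => Y (S' g)) SX.
have := congr1 (fun v => L2dot (S v) g) e.
rewrite linearD /= e1 !linearZ /= L2dotDl !L2dotZl => e2.
by rewrite -[RHS]e2; ring.
Qed.

(** The imaginary part equals [Im l] times the squared norm of [S g], the Herglotz property of the
    Borel transform. *)
Lemma cyclic_Im l S : symmetric_bop A -> Im l != 0 -> is_inverse (A - l *: (1 : bop V)) S ->
  L2dot (S g) g != 0 -> Im (L2dot (S g) g) != 0.
Proof.
move=> sA l0 [SX XS] b0.
have gE : A (S g) - l *: S g = g := congr1 (fun Y : bop V => Y g) XS.
have bE : L2dot (S g) g = L2dot (S g) (A (S g)) - L2dot (S g) (l *: S g).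
  by rewrite -L2dotBr gE.
have iA := symmetric_Im (S g) sA.
have [f0|f0] := eqVneq (nm (S g)) 0.
  by move: b0; rewrite (nm0_eq0 f0) L2dot0l eqxx.
rewrite bE L2dotZr L2dotff_nm; case: (L2dot (S g) (A (S g))) iA => u v /= ->.
have : nm (S g) ^+ 2 != 0 by rewrite sqrf_eq0.
case: l l0 {SX XS gE bE} => p q /= q0 n0.
have -> : 0 - (p * 0 + - q * nm (S g) ^+ 2) = q * nm (S g) ^+ 2 by ring.
by rewrite mulf_neq0.
Qed.

(** The Sherman-Morrison denominator cannot vanish for real [t], since [(S g, g)] is zero or not
    real. This yields reality of the perturbed spectrum. *)
Lemma perturbation_ex l (t : R) S : symmetric_bop A -> Im l != 0 ->
  is_inverse (A - l *: (1 : bop V)) S ->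
  exists S', is_inverse (A + t%:C *: B - l *: (1 : bop V)) S'.
Proof.
move=> sA l0 SP; apply: (sherman_morrison SP); apply/eqP.
have [b0|b0] := eqVneq (L2dot (S g) g) 0.
  by rewrite b0 mulr0 addr0 => /eqP; rewrite oner_eq0.
have := cyclic_Im sA l0 SP b0; case: (L2dot (S g) g) => u v /= v0 [].
rewrite !mul0r => h1 h2; have tv : t * v = 0 by move: h2; rewrite add0r addr0.
move/eqP: tv; rewrite mulf_eq0 (negbTE v0) orbF => /eqP t0.
by move: h1; rewrite t0 mul0r subr0 addr0 => /eqP; rewrite oner_eq0.
Qed.

Lemma symmetric_add_rank_one (t : R) : symmetric_bop A -> symmetric_bop (A + t%:C *: B).
Proof.
move=> sA f h; have e v : (A + t%:C *: B) v = A v + t%:C *: (L2dot v g *: g) by [].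
rewrite !e L2dotDl L2dotDr !L2dotZl !L2dotZr sA (L2dotC g h); congr (_ + _).
have -> : (t%:C : R[i])^*%R = t%:C by exact: conjc_real.
by congr (_ * _); exact: mulrC.
Qed.

End rank_one_perturbation.

(** The identity extends to the disk of radius [r / 4]. If the point [- b^-1] lay there, its left
    side would vanish and force [b = 0]. *)
Lemma identity_bound (R : realType) (h : R[i] -> R[i]) (b : R[i]) (r : R) :
  0 < r -> (forall z, normc z < r -> caradiff h z) ->
  (forall t : R, `|t| < r -> (1 + t%:C * b) * h t%:C = b) -> normc b <= 4 / r.
Proof.
move=> r0 dh hb; have [->|b0] := eqVneq b 0; first by rewrite Normc.normc0 divr_ge0// ltW.
rewrite leNgt; apply/negP => br.
have bp : 0 < normc b by rewrite normc_gt0.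
have q0 : forall z, normc z < r / 4 -> (1 + z * b) * h z - b = 0.
  apply: (@eq0_on_real_segment _ (fun z => (1 + z * b) * h z - b) r r0) => [z zr|t tr].
    apply: caradiffD; last exact: caradiff_cst.
    apply: caradiffM; last exact: dh.
    apply: caradiffD; first exact: caradiff_cst.
    by apply: caradiffM; [exact: caradiff_id|exact: caradiff_cst].
  by rewrite hb// subrr.
have := q0 (- b^-1); rewrite normcN Normc.normcV mulNr mulVf// subrr mul0r sub0r.
have h1 : (normc b)^-1 < r / 4.
  by rewrite -[r / 4]invrK ltf_pV2 ?posrE ?invr_gt0 ?divr_gt0// invf_div.
by move=> /(_ h1)/eqP; rewrite oppr_eq0 (negbTE b0).
Qed.

Lemma cvg_at_distP {K : numFieldType} (phi : K -> K) (z : K) :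
  (forall e, 0 < e -> exists2 del, 0 < del &
    forall w, `|w - z| < del -> `|phi z - phi w| < e) ->
  phi w @[w --> z] --> phi z.
Proof.
move=> h; apply: (proj2 (@cvgrPdist_lt _ K K (nbhs z) (nbhs_filter z) phi (phi z))).
by move=> e /h; exact: (near_normP _ _).2.
Qed.

(** * Holomorphy of inner products of operator families *)

Section sesquilinear_derivative.
Context d (T : measurableType d) (R : realType).
Variable mu : {measure set T -> \bar R}.
Local Notation V := (L2 mu).
Implicit Types (P Q : R[i] -> V) (z w : R[i]).

Definition vcont P z := forall eta : R, 0 < eta -> exists2 del : R, 0 < del &
  forall w, normc (w - z) < del -> nm (P w - P z) <= eta.

Definition vdiff P z := exists2 Phi : R[i] -> V,
  forall w, P w = P z + (w - z) *: Phi w & vcont Phi z.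

(** Antiholomorphic dependence, which the conjugate-linear second slot of the inner product turns
    back into holomorphic dependence. *)
Definition conj_vdiff P z := exists2 Phi : R[i] -> V,
  forall w, P w = P z + (w - z)^* *: Phi w & vcont Phi z.

Lemma caradiff_dot P Q z : vdiff P z -> conj_vdiff Q z ->
  caradiff (fun w => L2dot (P w) (Q w)) z.
Proof.
move=> [F PF cF] [G QG cG].
exists (fun w => L2dot (F w) (Q w) + L2dot (P z) (G w)); split; last first.
  apply/near_normP; exists 1 => // w _; rewrite (PF w) [in L2dot (P z) (Q z)](_ : Q z = Q w - (w - z)^* *: G w); last first.
    by rewrite (QG w) addrK.
  have conjZ c u v : L2dot u (c^* *: v) = c * L2dot u v.
    by rewrite L2dotZr; congr (_ * _); exact: conjcK.
  by rewrite L2dotDl L2dotZl L2dotBr conjZ; ring.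
have nG : 0 <= nm (G z) by exact: nm_ge0.
apply: cvg_at_distP => _ /complex_gt0P[eta eta0 ->].
pose K := nm (Q z) + nm (G z) + 1 + nm (F z) * (nm (G z) + 1) + nm (P z) + 1.
have K0 : 0 < K.
  by rewrite ltr_wpDl// !addr_ge0 ?mulr_ge0 ?addr_ge0 ?nm_ge0.
(* [K] adds up the factors of [e] in the three error terms; the minimum with 1 keeps products of two
   small quantities linear in [e]. *)
pose e := Num.min 1 (eta / (2 * K)).
have e0 : 0 < e by rewrite lt_min ltr01 divr_gt0// mulr_gt0.
have e1 : e <= 1 by rewrite ge_min lexx.
have eK : e * K <= eta / 2.
  have : e <= eta / (2 * K) by rewrite ge_min lexx orbT.
  move=> h; apply: le_trans (ler_wpM2r (ltW K0) h) _.
  by rewrite invfM mulrA divfK ?gt_eqF.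
have [d1 d10 h1] := cF _ e0; have [d2 d20 h2] := cG _ e0.
exists (Num.min (Num.min d1 d2) e)%:C; first by rewrite rc_gt0 lt_min lt_min d10 d20.
move=> w; rewrite normc_ltE lt_min lt_min => /andP[/andP[/h1 hF /h2 hG] we].
rewrite normc_ltE.
have hQ : nm (Q w - Q z) <= e * (nm (G z) + 1).
  rewrite (QG w) addrAC subrr add0r nmZ normc_conj; apply: ler_pM; rewrite ?normc_ge0 ?nm_ge0 ?(ltW we)//.
  have -> : G w = G z + (G w - G z) by rewrite addrC subrK.
  by apply: le_trans (nmD _ _) _; rewrite lerD2l (le_trans hG).
have Qw : nm (Q w) <= nm (Q z) + nm (G z) + 1.
  have -> : Q w = Q z + (Q w - Q z) by rewrite addrC subrK.
  apply: le_trans (nmD _ _) _; rewrite -addrA lerD2l; apply: le_trans hQ _.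
  by rewrite ler_piMl// addr_ge0.
have -> : L2dot (F z) (Q z) + L2dot (P z) (G z) - (L2dot (F w) (Q w) + L2dot (P z) (G w)) =
    - (L2dot (F w - F z) (Q w) + L2dot (F z) (Q w - Q z) + L2dot (P z) (G w - G z)).
  by rewrite L2dotBl !L2dotBr; ring.
rewrite normcN.
have b1 : normc (L2dot (F w - F z) (Q w)) <= e * (nm (Q z) + nm (G z) + 1).
  apply: le_trans (L2dot_le _ _) _; apply: ler_pM => //; exact: nm_ge0.
have b2 : normc (L2dot (F z) (Q w - Q z)) <= e * (nm (F z) * (nm (G z) + 1)).
  apply: le_trans (L2dot_le _ _) _; rewrite mulrCA; apply: ler_wpM2l hQ; exact: nm_ge0.
have b3 : normc (L2dot (P z) (G w - G z)) <= e * nm (P z).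
  apply: le_trans (L2dot_le _ _) _; rewrite mulrC; apply: ler_wpM2r hG; exact: nm_ge0.
have := normcD (L2dot (F w - F z) (Q w) + L2dot (F z) (Q w - Q z)) (L2dot (P z) (G w - G z)).
have := normcD (L2dot (F w - F z) (Q w)) (L2dot (F z) (Q w - Q z)).
have : e * (nm (Q z) + nm (G z) + 1) + e * (nm (F z) * (nm (G z) + 1)) + e * nm (P z) <= e * K.
  by rewrite -!mulrDr /K; rewrite ler_wpM2l ?(ltW e0)// lerDl ler01.
move: b1 b2 b3 eK eta0; clear; lra.
Qed.

Lemma conj_vdiff_cst f z : conj_vdiff (cst f) z.
Proof.
exists (cst 0) => [w|eta eta0]; first by rewrite scaler0 addr0.
by exists 1 => // w _; rewrite subrr nm0 ltW.
Qed.

Lemma derivable_vdiff (F : R[i]^o -> bop V) (S : bop V) f z : derivable F z 1 ->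
  vdiff (fun w => S (F w f)) z.
Proof.
move=> /derivableP_real[D hD].
pose Phi w : bop V := if w == z then D else (w - z)^-1 *: (F w - F z).
exists (fun w => S (Phi w f)) => [w|eta eta0].
  rewrite /Phi; have [->|wz] := eqVneq w z; first by rewrite subrr scale0r addr0.
  set X : bop V := (w - z)^-1 *: (F w - F z); have -> : F w = F z + (w - z) *: X.
    by rewrite scalerA divff ?subr_eq0// scale1r addrC subrK.
  have -> : (F z + (w - z) *: X) f = F z f + (w - z) *: X f by [].
  by rewrite linearD linearZ.
have K0 : 0 < nm S * nm f + 1 by rewrite ltr_wpDl// mulr_ge0 ?nm_ge0.
have [del del0 h] := hD _ (divr_gt0 eta0 K0); exists del => // w wdel.
have -> : Phi z = D by rewrite /Phi eqxx.
have {h} : nm (Phi w - D) <= eta / (nm S * nm f + 1).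
  rewrite /Phi; have [wz|wz] := eqVneq w z; last exact: h.
  by rewrite subrr nm0 divr_ge0 ?ltW.
rewrite ler_pdivlMr// => h; rewrite -linearB -bopB.
apply: le_trans (nm_bop _ _) _.
apply: le_trans (ler_wpM2l (nm_ge0 S) (nm_bop _ _)) _.
apply: le_trans h; rewrite mulrDr mulr1 mulrCA lerDl; exact: nm_ge0.
Qed.

Lemma derivable_conj_vdiff (F : R[i]^o -> bop V) f z : derivable F z^* 1 ->
  conj_vdiff (fun w => F w^* f) z.
Proof.
move=> /(derivable_vdiff 1 f)[Phi hP cP]; exists (fun w => Phi w^*) => [w|eta eta0].
  by have := hP w^*; rewrite -rmorphB.
have [del del0 h] := cP _ eta0; exists del => // w wd; apply: h.
by rewrite -rmorphB normc_conj.
Qed.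

End sesquilinear_derivative.

Lemma disk_normc (R : realType) (r : R) (z : R[i]) : disk r z <-> normc z < r.
Proof. by rewrite /disk /= normc_ltE. Qed.

(** * The implications between the four properties *)

Section equivalence.
Context (R : realType) (rho : {finite_measure set (measurableTypeR R) -> \bar R}).
Variable (rho_supp : compactly_supported rho).
Local Notation V := (L2 rho).
Variables (g : V) (g1 : \forall x \ae rho, g x = 1).
Local Notation A := (mul_id rho_supp).
Local Notation B := (rank_one g).
Implicit Types (f h : V) (l z : R[i]) (t : R).

Lemma is_inverse_resolvent l : Im l != 0 ->
  is_inverse (A - l *: (1 : bop V)) (resolvent rho l).
Proof. by move=> l0; split; [exact: resolventK|exact: resolventKV]. Qed.

Lemma symmetric_perturbation t : symmetric_bop (A + t%:C *: B).
Proof. exact: symmetric_add_rank_one (symmetric_mul_id rho_supp). Qed.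

Lemma perturbation_spectrum_real t l : spectrum (A + t%:C *: B) l -> Im l = 0.
Proof.
move=> sl; apply/eqP; apply: contrapT => /negP l0; apply: sl.
exact: perturbation_ex (symmetric_mul_id rho_supp) l0 (is_inverse_resolvent l0).
Qed.

Lemma BTBP (r : R) : 0 < r ->
  (forall l, 0 < Im l -> normc (borel_transform rho l) <= 4 / r) -> BTB rho.
Proof. by move=> r0 h; exists (4 / r) => l l0; rewrite normc_leE h. Qed.

Lemma dot_family_bound (h : R[i] -> R[i]) (r : R) l : 0 < r -> 0 < Im l ->
  (forall z, normc z < r -> caradiff h z) ->
  (forall t, `|t| < r -> exists2 S, is_inverse (A + t%:C *: B - l *: (1 : bop V)) S &
     h t%:C = L2dot (S g) g) ->
  normc (borel_transform rho l) <= 4 / r.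
Proof.
move=> r0 l0 dh hS; have l0' : Im l != 0 by rewrite gt_eqF.
apply: (identity_bound r0 dh) => t /hS[S SP ->].
rewrite -(dot_resolvent_borel g1 l0').
exact: borel_perturbation (is_inverse_resolvent l0') SP.
Qed.

Lemma HUE_BTB : HUE A B -> BTB rho.
Proof.
move=> [r r0 [U UP [F hF FU]]]; apply: (BTBP r0) => l l0.
have l0' : Im l != 0 by rewrite gt_eqF.
(* For real [z] unitarity turns this into the perturbed resolvent at [g], paired with [g].
   Conjugating the argument in the second slot makes the expression holomorphic off the real axis as
   well. *)
pose h z := L2dot ((resolvent rho l : bop V) (F z g)) (F z^* g).
apply: (@dot_family_bound h) => // [z zr|t tr].
  apply: caradiff_dot.
    by apply: derivable_vdiff; apply: hF; apply/disk_normc.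
  by apply: derivable_conj_vdiff; apply: hF; apply/disk_normc; rewrite normc_conj.
have [[Uiso _] [U' [UU1 UU2] AE]] := UP t tr.
have [R1 R2] := is_inverse_resolvent l0'.
exists (U' * resolvent rho l * U t).
  have -> : A + t%:C *: B - l *: (1 : bop V) = U' * (A - l *: (1 : bop V)) * U t.
    by rewrite AE mulrBr mulrBl bopZAr bopZAl mulr1 UU1.
  rewrite -(mulrA U' (A - _)); apply: is_inverseM; first exact: conj UU2 UU1.
  exact: is_inverseM (is_inverse_resolvent l0') (conj UU1 UU2).
rewrite /h conjc_real FU// -[in RHS]Uiso; congr L2dot.
exact: (congr1 (fun Y : bop V => Y (resolvent rho l (U t g))) (esym UU2)).
Qed.

Lemma continuous_kernel l : Im l != 0 -> continuous (fun x : R => (x%:C - l)^-1 : R[i]^o).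
Proof.
move=> l0 x; apply/cvgrPdist_lt => _ /complex_gt0P[e e0 ->].
have il0 : 0 < `|Im l|^-1 ^+ 2 by rewrite exprn_gt0// invr_gt0 normr_gt0.
near=> y.
have -> : (x%:C - l)^-1 - (y%:C - l)^-1 =
    - ((x%:C - l)^-1 * (y%:C - l)^-1 * (x - y)%:C).
  by rewrite rcD rcN; field; rewrite !kernel_neq0.
rewrite normc_ltE normcN !Normc.normcM normc_real.
have h : normc (x%:C - l)^-1 * normc (y%:C - l)^-1 <= `|Im l|^-1 ^+ 2.
  by rewrite expr2 ler_pM ?normc_ge0 ?kernel_le.
apply: le_lt_trans (ler_wpM2r (normr_ge0 _) h) _.
rewrite mulrC -ltr_pdivlMr//.
near: y; apply: cvgr_dist_lt; last by rewrite divr_gt0.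
exact: cvg_id.
Unshelve. all: by end_near. Qed.

Lemma FH_BTB : FH A B -> BTB rho.
Proof.
move=> [r r0 hr]; apply: (BTBP r0) => l l0.
have l0' : Im l != 0 by rewrite gt_eqF.
(* FH fixes its radius before the function, so [r] does not depend on [l]. *)
have [F hF Ft] := hr _ (continuous_kernel l0').
apply: (@dot_family_bound (fun z => L2dot ((1 : bop V) (F z g)) g)) => // [z zr|t tr].
  apply: caradiff_dot; last exact: conj_vdiff_cst.
  by apply: derivable_vdiff; apply: hF; apply/disk_normc.
have [S SP] := perturbation_ex g t (symmetric_mul_id rho_supp) l0' (is_inverse_resolvent l0').
exists S => //; rewrite Ft// (_ : cfc _ _ = S)//.
apply: cfcE; [exact: symmetric_perturbation|exact: perturbation_spectrum_real|].
apply: is_cfc_resolvent => //; first exact: symmetric_perturbation.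
exact: perturbation_spectrum_real.
Qed.

(* For z = -1 / B(l) the vector (A - l)^-1 g is in the kernel of A + z B - l. *)
Lemma CLI_BTB : CLI A B -> BTB rho.
Proof.
move=> [r r0 hr]; exists r^-1 => l l0; rewrite normc_leE leNgt; apply/negP => bl.
have l0' : Im l != 0 by rewrite gt_eqF.
set b := borel_transform rho l in bl.
have b0 : b != 0 by rewrite -normc_gt0; apply: lt_trans bl; rewrite invr_gt0.
have zr : disk r (- b^-1).
  apply/disk_normc; rewrite normcN Normc.normcV -[r]invrK ltf_pV2 ?posrE ?invr_gt0//.
  by rewrite normc_gt0.
have : ~ spectrum (A + (- b^-1) *: B) l.
  by rewrite hr// => sl; apply: sl; exists (resolvent rho l); exact: is_inverse_resolvent.
apply; move=> [S [S1 _]].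
have [_ R2] := is_inverse_resolvent l0'.
pose f : V := resolvent rho l g.
have e0 : (A + (- b^-1) *: B - l *: (1 : bop V)) f = 0.
  have e1 : (A - l *: (1 : bop V)) f = g := congr1 (fun Y : bop V => Y g) R2.
  have e2 : (A + (- b^-1) *: B - l *: (1 : bop V)) f =
    (A - l *: (1 : bop V)) f + (- b^-1) *: (L2dot f g *: g).
    by rewrite addrAC.
  rewrite e2 e1 (dot_resolvent_borel g1 l0') scalerA mulNr mulVf// scaleN1r.
  exact: subrr.
have f0 : f = 0.
  have := congr1 (fun Y : bop V => Y f) S1; rewrite bopM e0 linear0; exact: esym.
by move: b0; rewrite /b -(dot_resolvent_borel g1 l0') -/f f0 L2dot0l eqxx.
Qed.

Section bounded_transform.
Hypothesis btb : BTB rho.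

Lemma BTB_unitary_family : exists (r : R) (U W : R[i]^o -> bop V),
  [/\ 0 < r,
      forall z, normc z < r ->
        [/\ U z * W z = 1, W z * U z = 1 & A + z *: B = W z * A * U z],
      forall t f h, `|t| < r -> L2dot (U t%:C f) h = L2dot f (W t%:C h) &
      forall z, normc z < r -> qdiff U z /\ qdiff W z].
Proof.
have [M hM] := btb.
have HM l : 0 < Im l -> normc (borel_transform rho l) <= `|M|.
  by move=> /hM; rewrite normc_leE => h; apply: le_trans h (ler_norm M).
have [H [Mb [Mc [b [[HA skH Mbg HH] [mb bM MbP McP]]]]]] :=
  ex_hilbert_transform rho_supp g1 (normr_ge0 M) HM.
exact: (ex_unitary_family (is_mul_id rho_supp) (normr_ge0 M) mb bM MbP McP HA skH Mbg HH).
Qed.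

Lemma BTB_HUE : HUE A B.
Proof.
have [r [U [W [r0 sim adj dU]]]] := BTB_unitary_family.
exists r => //; exists (fun t => U t%:C); last first.
  exists U => // z /disk_normc/dU[dz _]; exact: qdiff_derivable.
move=> t tr; have tr' : normc t%:C < r by rewrite normc_real.
have [UW WU e] := sim _ tr'; split; last by exists (W t%:C).
split; last by exists (W t%:C).
move=> f h; rewrite adj//; congr L2dot.
exact: (congr1 (fun Y : bop V => Y h) WU).
Qed.

Lemma BTB_CLI : CLI A B.
Proof.
have [r [U [W [r0 sim _ _]]]] := BTB_unitary_family.
exists r => // z /disk_normc/sim[UW WU ->].
by apply: spectrum_similar.
Qed.

Lemma BTB_FH : FH A B.
Proof.
have [r [U [W [r0 sim _ dUW]]]] := BTB_unitary_family.
exists r => // phi _; have [[S SP]|nS] := pselect (exists S, is_cfc A phi S).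
  exists (fun z => W z * S * U z).
    move=> z /disk_normc/dUW[dU dW]; apply: qdiff_derivable.
    exact: qdiffM_sandwich.
  move=> t tr; have [|UW WU e] := sim t%:C; first by rewrite normc_real.
  apply/esym/cfcE; [exact: symmetric_perturbation|exact: perturbation_spectrum_real|].
  by rewrite e; exact: is_cfc_similar.
(* If no operator were [phi(A)], similarity would exclude one for each perturbed operator too; [cfc]
   would then take its default value 0 throughout, which continues as a constant. *)
exists (cst 0) => [z _|t tr]; first exact: derivable_cst.
have [|UW WU e] := sim t%:C; first by rewrite normc_real.
rewrite /cfc xgetPN// => S /= SP; apply: nS; exists (U t%:C * S * W t%:C).
have := @is_cfc_similar _ _ (W t%:C) (U t%:C) _ _ _ (conj UW WU) SP.
by rewrite e -!mulrA UW mulr1 !mulrA UW mul1r.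
Qed.

End bounded_transform.
End equivalence.

Theorem theorem4p14 (R : realType)
    (rho : {finite_measure set (measurableTypeR R) -> \bar R})
    (rho_supp : compactly_supported rho)
    (g : L2 rho) (g1 : \forall x \ae rho, g x = 1) :
  let A := mul_id rho_supp in
  let B := rank_one g in
  [<-> HUE A B; FH A B; CLI A B; BTB rho].
Proof.
move=> A B; tfae.
- by move=> /(HUE_BTB g1)/(BTB_FH rho_supp g1).
- by move=> /(FH_BTB g1)/(BTB_CLI rho_supp g1).
- exact: CLI_BTB.
- exact: BTB_HUE.
Qed.
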